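(* Let $p$ be a prime, let $A=\{a_1,\dots,a_n\}$ be a finite set, and let $\mathbb{F}$ be the free pro-$p$ group with basis $A$. Let $R$ be a commutative ring with unit (respectively, a commutative unital $\mathbb{Z}_p$-algebra), with no topology, and suppose that $R$ is fully residually $\mathbb{Z}_p$, i.e. for every finite subset $M\subset R$ there is a ring homomorphism (respectively, a $\mathbb{Z}_p$-algebra homomorphism) $R\to\mathbb{Z}_p$ which is injective on $M$. Let $R^{bin}$ be the binomial closure of $R$ and let $\mathbb{F}(A,R^{bin})$ be the free pro-Hall $R^{bin}$-group on $A$. Then the abstract group $\mathbb{F}(A,R^{bin})$ is fully residually $\mathbb{F}$, i.e. for every finite subset $C\subset \mathbb{F}(A,R^{bin})$ there is a homomorphism of abstract groups $\mathbb{F}(A,R^{bin})\to\mathbb{F}$ which is injective on $C$.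
   Context: $\mathbb{Z}_p$ denotes the ring of $p$-adic integers. Rings are commutative with unit. Binomial ring: a domain $R$ of characteristic $0$ such that for every $\lambda\in R$ and every natural number $n$ the ring $R$ contains the binomial coefficient $C_\lambda^n=\frac{\lambda(\lambda-1)\cdots(\lambda-n+1)}{n!}$. Binomial closure: let $R$ be a domain of characteristic $0$ (a ring that is fully residually $\mathbb{Z}_p$ is such a domain), and let $L=\mathbb{Z}^{-1}R$ be the localisation of $R$ at the nonzero elements of the copy of $\mathbb{Z}$ generated by the unit of $R$. Put $R_{-1}=\emptyset$, $R_0=R\subset L$ and recursively let $R_{i+1}$ be the subring of $L$ generated by $R_i$ and all $C_\alpha^n$ with $\alpha\in R_i\smallsetminus R_{i-1}$, $n\in\mathbb{N}$. Then $R^{bin}=\varinjlim R_i=\bigcup_i R_i\subset L$; it is a binomial ring. Hall $R$-groups: let $R$ be a binomial ring. A Hall $R$-group of class $c$ is a nilpotent group $G$ of class at most $c$ with a map $G\times R\to G$, $(g,r)\mapsto g^r$, such that for all $g,x,y,x_1,\dots,x_k\in G$ and $\alpha,\beta,\lambda\in R$: (i) $g^0=1$, $g^1=g$, $g^{\alpha+\beta}=g^\alpha g^\beta$, $(g^\alpha)^\beta=g^{\alpha\beta}$; (ii) $y^{-1}x^\lambda y=(y^{-1}xy)^\lambda$; (iii) $x_1^\lambda\cdots x_k^\lambda=(x_1\cdots x_k)^\lambda\,\tau_2(X)^{C_\lambda^2}\cdots\tau_c(X)^{C_\lambda^c}$, where $X=\{x_1,\dots,x_k\}$ and $\tau_i$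 is the $i$-th Petresco word, defined recursively in the free group on $a_1,\dots,a_k$ by $a_1^i\cdots a_k^i=\tau_1^{C_i^1}\tau_2^{C_i^2}\cdots\tau_i^{C_i^i}$. These axioms are identities, so for fixed $c$ they define a variety, and $R$-subgroups, $R$-homomorphisms and free objects are defined as usual. Free pro-Hall $R$-group: let $F(A,R,c)$ be the free Hall $R$-group of class $c$ on $A$. There are natural homomorphisms $\psi_c:F(A,R,c+1)\to F(A,R,c)$ that are the identity on $A$, and $\mathbb{F}(A,R)=\varprojlim_c F(A,R,c)$ is the free pro-Hall $R$-group on $A$. *)

(* Defs.v *)
From HB Require Import structures.
From mathcomp Require Import all_boot all_order all_algebra.
From mathcomp Require Import boolp classical_sets cardinality.
From mathcomp Require Import ring.

Set Implicit Arguments.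
Unset Strict Implicit.
Unset Printing Implicit Defensive.

Import GRing.Theory.

Section PadicIntegers.
Local Open Scope ring_scope.
Variable p : nat.

(* Z_p is the inverse limit of the rings Z/p^(k+1).  As 'Z_0 and 'Z_1 denote  *)
(* Z/2, this is only the intended ring for p > 1 (below, p is prime).        *)
Definition padic_coherent (x : forall k, 'Z_(p ^ k.+1)) : bool :=
  `[< forall k, ((x k.+1 : nat)%:R : 'Z_(p ^ k.+1)) = x k >].

Definition padic := {x : forall k, 'Z_(p ^ k.+1) | padic_coherent x}.

HB.instance Definition _ := Choice.on padic.

Lemma padic_eqP (x y : padic) : (forall k, val x k = val y k) -> x = y.
Proof. by move=> xy; apply/val_inj/functional_extensionality_dep. Qed.

Lemma padicP (x : padic) k :
  ((val x k.+1 : nat)%:R : 'Z_(p ^ k.+1)) = val x k.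
Proof. by have /asboolP := valP x. Qed.

Lemma padic_dvd k : ((Zp_trunc (p ^ k.+1)).+2 %| (Zp_trunc (p ^ k.+2)).+2)%N.
Proof.
case: p => [|[|q]]; rewrite ?exp0n ?exp1n //.
rewrite !Zp_cast ?dvdn_exp2l // -[1%N](exp1n k.+1) ?ltn_exp2r //.
by rewrite exp1n -[1%N](exp1n k.+2) ltn_exp2r.
Qed.

Lemma natZp_modn k a b : a = b %[mod (Zp_trunc (p ^ k.+2)).+2] ->
  a%:R = b%:R :> 'Z_(p ^ k.+1).
Proof.
move=> ab; apply/val_inj; rewrite /= !Zp_nat /=.
by rewrite -(modn_dvdm a (padic_dvd k)) ab modn_dvdm // padic_dvd.
Qed.

Definition red k (a : 'Z_(p ^ k.+2)) : 'Z_(p ^ k.+1) := (a : nat)%:R.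

Lemma red_nat k n : red (n%:R : 'Z_(p ^ k.+2)) = n%:R.
Proof. by rewrite /red; apply: natZp_modn; rewrite Zp_nat /= modn_mod. Qed.

Lemma redD k : {morph @red k : a b / a + b}.
Proof.
by move=> a b; rewrite -[a]natr_Zp -[b]natr_Zp -natrD !red_nat natrD.
Qed.

Lemma redM k : {morph @red k : a b / a * b}.
Proof.
by move=> a b; rewrite -[a]natr_Zp -[b]natr_Zp -natrM !red_nat natrM.
Qed.

Lemma redN k : {morph @red k : a / - a}.
Proof.
move=> a; apply: (@addrI _ (red a)); rewrite -redD !subrr.
exact: (red_nat k 0).
Qed.

Lemma padic_of_subproof (x : forall k, 'Z_(p ^ k.+1)) :
  (forall k, red (x k.+1) = x k) -> padic_coherent x.
Proof. by move=> h; apply/asboolP. Qed.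

Definition padic_zero : padic :=
  exist _ (fun k => 0) (padic_of_subproof (fun k => red_nat k 0)).
Definition padic_one : padic :=
  exist _ (fun k => 1) (padic_of_subproof (fun k => red_nat k 1)).

Lemma padic_add_subproof (x y : padic) k :
  red (val x k.+1 + val y k.+1) = val x k + val y k.
Proof. by rewrite redD /red !padicP. Qed.
Lemma padic_mul_subproof (x y : padic) k :
  red (val x k.+1 * val y k.+1) = val x k * val y k.
Proof. by rewrite redM /red !padicP. Qed.
Lemma padic_opp_subproof (x : padic) k : red (- val x k.+1) = - val x k.
Proof. by rewrite redN /red !padicP. Qed.

Definition padic_add (x y : padic) : padic :=
  exist _ (fun k => val x k + val y k)
    (padic_of_subproof (padic_add_subproof x y)).
Definition padic_mul (x y : padic) : padic :=
  exist _ (fun k => val x k * val y k)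
    (padic_of_subproof (padic_mul_subproof x y)).
Definition padic_opp (x : padic) : padic :=
  exist _ (fun k => - val x k) (padic_of_subproof (padic_opp_subproof x)).

Fact padic_addA : associative padic_add.
Proof. by move=> x y z; apply: padic_eqP => k; exact: addrA. Qed.
Fact padic_addC : commutative padic_add.
Proof. by move=> x y; apply: padic_eqP => k; exact: addrC. Qed.
Fact padic_add0 : left_id padic_zero padic_add.
Proof. by move=> x; apply: padic_eqP => k; exact: add0r. Qed.
Fact padic_addN : left_inverse padic_zero padic_opp padic_add.
Proof. by move=> x; apply: padic_eqP => k; exact: addNr. Qed.
HB.instance Definition _ :=
  GRing.isZmodule.Build padic padic_addA padic_addC padic_add0 padic_addN.

Fact padic_mulA : associative padic_mul.
Proof. by move=> x y z; apply: padic_eqP => k; exact: mulrA. Qed.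
Fact padic_mulC : commutative padic_mul.
Proof. by move=> x y; apply: padic_eqP => k; exact: mulrC. Qed.
Fact padic_mul1 : left_id padic_one padic_mul.
Proof. by move=> x; apply: padic_eqP => k; exact: mul1r. Qed.
Fact padic_mulDl : left_distributive padic_mul +%R.
Proof. by move=> x y z; apply: padic_eqP => k; exact: mulrDl. Qed.
Fact padic_1neq0 : padic_one != 0.
Proof. by apply/eqP => /(congr1 (fun x : padic => val x 0%N)). Qed.
HB.instance Definition _ := GRing.Zmodule_isComNzRing.Build padic
  padic_mulA padic_mulC padic_mul1 padic_mulDl padic_1neq0.

Lemma padic_natE n k : val (n%:R : padic) k = n%:R.
Proof. by elim: n => // n IHn; rewrite !mulrS /= IHn. Qed.

End PadicIntegers.

Section Domains.
Local Open Scope ring_scope.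

Definition domain0 (R : comPzRingType) : Prop :=
  [/\ (1 : R) != 0, forall x y : R, x * y = 0 -> x = 0 \/ y = 0
    & forall n, (n.+1%:R : R) != 0].

Definition fully_residually_padic (p : nat) (R : comPzRingType) : Prop :=
  forall M : seq R, exists f : {rmorphism R -> padic p}, {in M &, injective f}.

Definition alg_fully_residually_padic (p : nat) (R : comAlgType (padic p)) :
    Prop :=
  forall M : seq R,
    exists f : {lrmorphism R -> (padic p)^o}, {in M &, injective f}.

Lemma alg_fully_residually_ring p (R : comAlgType (padic p)) :
  alg_fully_residually_padic R -> fully_residually_padic p R.
Proof. by move=> h M; have [f fM] := h M; exists f. Qed.

Lemma padic_level p (p_pr : prime p) (x : padic p) k j :
  (k <= j)%N -> val x j = val x k %[mod p ^ k.+1].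
Proof.
have p_gt1 := prime_gt1 p_pr.
have pk i : (1 < p ^ i.+1)%N.
  by rewrite -[1%N](exp1n i.+1) ltn_exp2r.
elim: j => [|j IHj]; first by rewrite leqn0 => /eqP->.
rewrite leq_eqVlt => /predU1P[->//|]; rewrite ltnS => kj; rewrite -(IHj kj).
rewrite -(padicP x j) val_Zp_nat //.
by rewrite modn_dvdm // dvdn_exp2l.
Qed.

Lemma padic_domain0 p : prime p -> domain0 (padic p).
Proof.
move=> p_pr; have p_gt1 := prime_gt1 p_pr.
have pk i : (1 < p ^ i.+1)%N by rewrite -[1%N](exp1n i.+1) ltn_exp2r.
split; first exact: padic_1neq0.
- move=> x y xy0; apply: contrapT => /not_orP[xn0 yn0].
  have nz (z : padic p) : z <> 0 -> exists k, ~~ (p ^ k.+1 %| val z k)%N.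
    move=> zn0; apply: contrapT => /forallNP zk; apply: zn0.
    apply: padic_eqP => k; apply/val_inj => /=.
    have /negP := zk k; rewrite negbK => /eqP.
    by rewrite modn_small // -[X in (_ < X)%N](Zp_cast (pk k)) ltn_ord.
  have [k xk] := nz x xn0; have [l yl] := nz y yn0.
  pose m := (k + l).+1.
  have kx : ~~ (p ^ k.+1 %| val x m)%N.
    by rewrite /dvdn (padic_level p_pr) // leqW // leq_addr.
  have ly : ~~ (p ^ l.+1 %| val y m)%N.
    by rewrite /dvdn (padic_level p_pr) // leqW // leq_addl.
  have x0 : (0 < val x m)%N by rewrite lt0n; apply: contraNneq kx => ->.
  have y0 : (0 < val y m)%N by rewrite lt0n; apply: contraNneq ly => ->.
  have : (p ^ m.+1 %| val x m * val y m)%N.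
    have /(congr1 (fun z : padic p => val (val z m))) /= := xy0.
    by move: (_ * _)%N => a; rewrite Zp_cast // => /eqP.
  move: kx ly; rewrite !pfactor_dvdn ?muln_gt0 ?x0 // lognM // -!ltnNge.
  rewrite !ltnS => kx ly; rewrite /m => klm.
  have := leq_trans klm (leq_add kx ly).
  by rewrite ltnNge leqW // leqnn.
- move=> n; apply/eqP => /(congr1 (fun z : padic p => val z n : nat)).
  by rewrite padic_natE val_Zp_nat // modn_small // ltn_expl.
Qed.

Lemma fully_residually_domain0 p (p_pr : prime p) (R : comPzRingType) :
  fully_residually_padic p R -> domain0 R.
Proof.
move=> hR; have [Z1 ZM Zn] := padic_domain0 p_pr; split.
- have [f _] := hR [::]; apply: contraNneq Z1 => /(congr1 f).
  by rewrite rmorph1 rmorph0 => ->.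
- move=> x y xy0; have [f fM] := hR [:: x; y; 0].
  have := ZM (f x) (f y); rewrite -rmorphM xy0 rmorph0 => /(_ erefl)[]f0.
    by left; apply: fM; rewrite ?inE ?eqxx ?orbT ?rmorph0.
  by right; apply: fM; rewrite ?inE ?eqxx ?orbT ?rmorph0.
- move=> n; have [f _] := hR [::]; apply: contraNneq (Zn n) => /(congr1 f).
  by rewrite rmorph_nat rmorph0 => ->.
Qed.

End Domains.

Section Localisation.
Local Open Scope ring_scope.
Local Open Scope quotient_scope.
Variable R : comPzRingType.

(* (r, d) stands for the fraction r / d with denominator d * 1_R.            *)
Definition fracpair : Type := R * {d : int | d != 0}.
HB.instance Definition _ := Choice.on fracpair.

Definition frac_eq (x y : fracpair) : bool :=
  `[< exists t : int, t != 0 /\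
      (x.1 *~ val y.2) *~ t = (y.1 *~ val x.2) *~ t >].

Lemma frac_eqP x y : reflect (exists t : int, t != 0 /\
  (x.1 *~ val y.2) *~ t = (y.1 *~ val x.2) *~ t) (frac_eq x y).
Proof. exact: asboolP. Qed.

Fact frac_eq_refl : reflexive frac_eq.
Proof. by move=> x; apply/asboolP; exists 1. Qed.
Fact frac_eq_sym : symmetric frac_eq.
Proof. by move=> x y; apply/asboolP/asboolP => -[t [t0 e]]; exists t. Qed.
Fact frac_eq_trans : transitive frac_eq.
Proof.
move=> y x z /asboolP[t [t0 xy]] /asboolP[u [u0 yz]]; apply/asboolP.
exists (t * u * val y.2); split; first by rewrite !mulf_neq0 // (valP y.2).
have -> : x.1 *~ val z.2 *~ (t * u * val y.2) =
  (x.1 *~ val y.2 *~ t) *~ (val z.2 * u).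
  by rewrite -!mulrzA; congr (_ *~ _); ring.
rewrite xy.
have -> : y.1 *~ val x.2 *~ t *~ (val z.2 * u) =
  (y.1 *~ val z.2 *~ u) *~ (val x.2 * t).
  by rewrite -!mulrzA; congr (_ *~ _); ring.
by rewrite yz -!mulrzA; congr (_ *~ _); ring.
Qed.

Canonical frac_equiv :=
  EquivRel frac_eq frac_eq_refl frac_eq_sym frac_eq_trans.

Definition Zloc := {eq_quot frac_equiv}.
HB.instance Definition _ := Choice.on Zloc.

Definition Zfrac (r : R) (d : int) (d0 : d != 0) : Zloc :=
  \pi_Zloc (r, exist _ d d0).

Lemma Zfrac_eq r d d0 s e e0 (t : int) : t != 0 ->
  r *~ (e * t) = s *~ (d * t) -> @Zfrac r d d0 = @Zfrac s e e0.
Proof.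
by move=> t0 h; apply/eqmodP/frac_eqP; exists t; split; rewrite // -!mulrzA.
Qed.

Lemma Zfrac_eqP r d d0 s e e0 : @Zfrac r d d0 = @Zfrac s e e0 ->
  exists t : int, t != 0 /\ r *~ (e * t) = s *~ (d * t).
Proof.
by move=> /eqmodP/frac_eqP[t [t0 /= h]]; exists t; rewrite !mulrzA.
Qed.

Lemma ZlocP (P : Zloc -> Prop) :
  (forall r d d0, P (@Zfrac r d d0)) -> forall x, P x.
Proof. by move=> h x; rewrite -[x]reprK; case: (repr x) => r [d d0]; exact: h. Qed.

Definition addf (x y : fracpair) : fracpair :=
  (x.1 *~ val y.2 + y.1 *~ val x.2,
   exist _ (val x.2 * val y.2) (mulf_neq0 (valP x.2) (valP y.2))).
Definition mulf (x y : fracpair) : fracpair :=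
  (x.1 * y.1,
   exist _ (val x.2 * val y.2) (mulf_neq0 (valP x.2) (valP y.2))).
Definition oppf (x : fracpair) : fracpair := (- x.1, x.2).

Definition Zloc_add (x y : Zloc) : Zloc := \pi_Zloc (addf (repr x) (repr y)).
Definition Zloc_mul (x y : Zloc) : Zloc := \pi_Zloc (mulf (repr x) (repr y)).
Definition Zloc_opp (x : Zloc) : Zloc := \pi_Zloc (oppf (repr x)).
Definition Zloc_of (r : R) : Zloc := @Zfrac r 1 (oner_neq0 _).

Lemma Zloc_addE r d d0 s e e0 : Zloc_add (@Zfrac r d d0) (@Zfrac s e e0) =
  Zfrac (r *~ e + s *~ d) (mulf_neq0 d0 e0).
Proof.
rewrite /Zloc_add; case: (repr _) (reprK (@Zfrac r d d0)) => r' [d' d'0].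
case: (repr _) (reprK (@Zfrac s e e0)) => s' [e' e'0].
move=> /Zfrac_eqP[u [u0 yy]] /Zfrac_eqP[t [t0 xx]].
apply: (@Zfrac_eq _ _ _ _ _ _ (t * u)); rewrite ?mulf_neq0 //=.
rewrite !mulrzDl -!mulrzA.
have -> : e' * (d * e * (t * u)) = (d * t) * (e' * e * u) by ring.
have -> : d' * (d * e * (t * u)) = (e * u) * (d' * d * t) by ring.
rewrite !(mulrzA _ (d * t)) !(mulrzA _ (e * u)) xx yy -!mulrzA.
by congr (_ *~ _ + _ *~ _); ring.
Qed.

Lemma Zloc_mulE r d d0 s e e0 : Zloc_mul (@Zfrac r d d0) (@Zfrac s e e0) =
  Zfrac (r * s) (mulf_neq0 d0 e0).
Proof.
rewrite /Zloc_mul; case: (repr _) (reprK (@Zfrac r d d0)) => r' [d' d'0].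
case: (repr _) (reprK (@Zfrac s e e0)) => s' [e' e'0].
move=> /Zfrac_eqP[u [u0 yy]] /Zfrac_eqP[t [t0 xx]].
apply: (@Zfrac_eq _ _ _ _ _ _ (t * u)); rewrite ?mulf_neq0 //=.
have -> : d * e * (t * u) = (d * t) * (e * u) by ring.
rewrite (mulrzA _ (d * t)) -mulrzAl -mulrzAr xx yy mulrzAl mulrzAr -mulrzA.
by congr (_ *~ _); ring.
Qed.

Lemma Zloc_oppE r d d0 : Zloc_opp (@Zfrac r d d0) = Zfrac (- r) d0.
Proof.
rewrite /Zloc_opp; case: (repr _) (reprK (@Zfrac r d d0)) => r' [d' d'0].
move=> /Zfrac_eqP[t [t0 xx]].
by apply: (@Zfrac_eq _ _ _ _ _ _ t); rewrite ?mulNrz ?xx.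
Qed.

Fact Zloc_addA : associative Zloc_add.
Proof.
elim/ZlocP=> r d d0; elim/ZlocP=> s e e0; elim/ZlocP=> v f f0.
rewrite !Zloc_addE; apply: (@Zfrac_eq _ _ _ _ _ _ 1); rewrite // !mulr1.
rewrite !mulrzDl -!mulrzA addrA.
by congr (_ *~ _ + _ *~ _ + _ *~ _); ring.
Qed.
Fact Zloc_addC : commutative Zloc_add.
Proof.
elim/ZlocP=> r d d0; elim/ZlocP=> s e e0; rewrite !Zloc_addE.
by apply: (@Zfrac_eq _ _ _ _ _ _ 1); rewrite // addrC (mulrC e).
Qed.
Fact Zloc_add0 : left_id (Zloc_of 0) Zloc_add.
Proof.
elim/ZlocP=> r d d0; rewrite Zloc_addE; apply: (@Zfrac_eq _ _ _ _ _ _ 1) => //.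
by rewrite mul0rz add0r mul1r.
Qed.
Fact Zloc_addN : left_inverse (Zloc_of 0) Zloc_opp Zloc_add.
Proof.
elim/ZlocP=> r d d0; rewrite Zloc_oppE Zloc_addE.
apply: (@Zfrac_eq _ _ _ _ _ _ 1) => //.
by rewrite mulNrz addNr !mul0rz.
Qed.
HB.instance Definition _ :=
  GRing.isZmodule.Build Zloc Zloc_addA Zloc_addC Zloc_add0 Zloc_addN.

Fact Zloc_mulA : associative Zloc_mul.
Proof.
elim/ZlocP=> r d d0; elim/ZlocP=> s e e0; elim/ZlocP=> v f f0.
rewrite !Zloc_mulE; apply: (@Zfrac_eq _ _ _ _ _ _ 1); rewrite // !mulr1.
by rewrite mulrA; congr (_ *~ _); ring.
Qed.
Fact Zloc_mulC : commutative Zloc_mul.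
Proof.
elim/ZlocP=> r d d0; elim/ZlocP=> s e e0; rewrite !Zloc_mulE.
by apply: (@Zfrac_eq _ _ _ _ _ _ 1); rewrite // mulrC (mulrC e).
Qed.
Fact Zloc_mul1 : left_id (Zloc_of 1) Zloc_mul.
Proof.
elim/ZlocP=> r d d0; rewrite Zloc_mulE; apply: (@Zfrac_eq _ _ _ _ _ _ 1) => //.
by rewrite !mul1r.
Qed.
Fact Zloc_mulDl : left_distributive Zloc_mul Zloc_add.
Proof.
elim/ZlocP=> r d d0; elim/ZlocP=> s e e0; elim/ZlocP=> v f f0.
rewrite Zloc_addE !Zloc_mulE Zloc_addE.
apply: (@Zfrac_eq _ _ _ _ _ _ 1); rewrite // !mulr1.
rewrite mulrDl !mulrzDl !mulrzAl -!mulrzA.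
by congr (_ *~ _ + _ *~ _); ring.
Qed.
HB.instance Definition _ := GRing.Zmodule_isComPzRing.Build Zloc
  Zloc_mulA Zloc_mulC Zloc_mul1 Zloc_mulDl.

Lemma ZlocD r d d0 s e e0 : @Zfrac r d d0 + @Zfrac s e e0 =
  Zfrac (r *~ e + s *~ d) (mulf_neq0 d0 e0).
Proof. exact: Zloc_addE. Qed.
Lemma ZlocM r d d0 s e e0 : @Zfrac r d d0 * @Zfrac s e e0 =
  Zfrac (r * s) (mulf_neq0 d0 e0).
Proof. exact: Zloc_mulE. Qed.
Lemma ZlocN r d d0 : - @Zfrac r d d0 = Zfrac (- r) d0.
Proof. exact: Zloc_oppE. Qed.

Fact Zloc_of_zmod_morphism : zmod_morphism Zloc_of.
Proof.
move=> r s; rewrite ZlocN ZlocD; apply: (@Zfrac_eq _ _ _ _ _ _ 1) => //.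
Qed.
Fact Zloc_of_monoid_morphism : monoid_morphism Zloc_of.
Proof.
split=> // r s; rewrite ZlocM; exact: (@Zfrac_eq _ _ _ _ _ _ 1).
Qed.
HB.instance Definition _ :=
  GRing.isZmodMorphism.Build R Zloc Zloc_of Zloc_of_zmod_morphism.
HB.instance Definition _ :=
  GRing.isMonoidMorphism.Build R Zloc Zloc_of Zloc_of_monoid_morphism.

Lemma Zfrac_divP r d d0 : @Zfrac r d d0 * d%:~R = Zloc_of r.
Proof.
have -> : d%:~R = Zloc_of d%:~R by rewrite rmorph_int.
rewrite ZlocM; apply: (@Zfrac_eq _ _ _ _ _ _ 1) => //.
by rewrite -mulrzAr -mulrzA mulrzAr mulr1 !mulr1.
Qed.

Lemma Zloc_domain0 : domain0 R -> domain0 Zloc.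
Proof.
move=> [R1 RM Rn].
have Rz (r : R) (t : int) : t != 0 -> r *~ t = 0 -> r = 0.
  have Rnat (n : nat) : r *+ n.+1 = 0 -> r = 0.
    by rewrite -mulr_natr => /RM[] // /eqP; rewrite (negPf (Rn n)).
  case: t => [[|n]|n] // _; first exact: Rnat.
  by rewrite NegzE mulrNz => /eqP; rewrite oppr_eq0 => /eqP/Rnat.
have Z0 r d d0 : @Zfrac r d d0 = 0 -> r = 0.
  move=> /Zfrac_eqP[t [t0]]; rewrite mul0rz mul1r; exact: Rz.
split.
- by apply/eqP => /Z0/eqP; rewrite (negPf R1).
- elim/ZlocP=> r d d0; elim/ZlocP=> s e e0.
  rewrite ZlocM => /Z0/RM[]->; [left|right];
  by apply: (@Zfrac_eq _ _ _ _ _ _ 1); rewrite // !mul0rz.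
- move=> n; apply/eqP; have -> : n.+1%:R = Zloc_of n.+1%:R by rewrite rmorph_nat.
  by move=> /Z0/eqP; rewrite (negPf (Rn n)).
Qed.

End Localisation.

HB.mixin Record isBinomial R of GRing.ComNzRing R := {
  binr_domain : domain0 R;
  binr : R -> nat -> R;
  binrP : forall (l : R) n,
    (binr l n * n`!%:R = \prod_(i < n) (l - i%:R))%R
}.

#[short(type="binomialRingType")]
HB.structure Definition BinomialRing := {R of isBinomial R & GRing.ComNzRing R}.

Section BinomialTheory.
Local Open Scope ring_scope.

Lemma fact_neq0 n : (n`!%:Z != 0) :> bool.
Proof. by rewrite eqz_nat -lt0n fact_gt0. Qed.

Lemma domain0_factI (R : comPzRingType) : domain0 R ->
  forall n (x y : R), x * n`!%:R = y * n`!%:R -> x = y.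
Proof.
move=> [_ RM Rn] n x y /eqP; rewrite -subr_eq0 -mulrBl => /eqP/RM[].
  by move/eqP; rewrite subr_eq0 => /eqP.
by case: n`! (fact_gt0 n) => // m _ /eqP; rewrite (negPf (Rn m)).
Qed.

Lemma binr_uniq (R : binomialRingType) (l : R) n b :
  b * n`!%:R = \prod_(i < n) (l - i%:R) -> b = binr l n.
Proof. by rewrite -binrP; exact: domain0_factI (@binr_domain R) _ _ _. Qed.

Lemma binr_nat (R : binomialRingType) m n : binr (m%:R : R) n = 'C(m, n)%:R.
Proof.
apply/esym/binr_uniq; rewrite -natrM bin_ffact.
elim: n => [|n IHn]; first by rewrite big_ord0.
rewrite big_ord_recr /= -IHn ffactnSr natrM.
have [nm|mn] := leqP n m; first by rewrite natrB.
by rewrite ffact_small // !mul0r.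
Qed.

End BinomialTheory.

Section BinomialClosure.
Local Open Scope ring_scope.
Local Open Scope classical_set_scope.
Variable R : comPzRingType.

Definition is_subring (L : comPzRingType) (S : set L) : Prop :=
  [/\ S 1, forall x y, S x -> S y -> S (x - y)
    & forall x y, S x -> S y -> S (x * y)].

Definition Zloc_binom (a : Zloc R) n : Zloc R :=
  (\prod_(i < n) (a - i%:R)) * Zfrac 1 (fact_neq0 n).

(* The indices are shifted by one: binc_stage k.+1 is the subring R_k of the *)
(* localisation, and binc_stage 0 is the empty set R_{-1}.                   *)
Fixpoint binc_stage (k : nat) : set (Zloc R) :=
  match k with
  | 0 => set0
  | k'.+1 =>
    match k' with
    | 0 => range (@Zloc_of R)
    | k''.+1 => smallest (@is_subring (Zloc R)) (binc_stage k' `|`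
        [set b | exists a n, (binc_stage k' `\` binc_stage k'') a /\
                             b = Zloc_binom a n])
    end
  end.

Definition binc_pred : {pred Zloc R} :=
  fun x => `[< (\bigcup_k binc_stage k) x >].

Lemma binc_predP x : reflect (exists k, binc_stage k x) (x \in binc_pred).
Proof.
by apply: (iffP (asboolP _)) => [[k _ kx]|[k kx]]; exists k.
Qed.

Lemma smallest_subring (S : set (Zloc R)) :
  is_subring (smallest (@is_subring (Zloc R)) S).
Proof.
split=> [T [[]]//|x y Sx Sy T TS|x y Sx Sy T TS]; have [[_ TB TM] _] := TS.
  by apply: TB; [apply: Sx|apply: Sy].
by apply: TM; [apply: Sx|apply: Sy].
Qed.

Lemma binc_stage_subring k : is_subring (binc_stage k.+1).
Proof.
case: k => [|k]; last exact: smallest_subring.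
split=> [|_ _ [r _ <-] [s _ <-]|_ _ [r _ <-] [s _ <-]] /=.
- by exists 1 => //; rewrite rmorph1.
- by exists (r - s) => //; rewrite rmorphB.
- by exists (r * s) => //; rewrite rmorphM.
Qed.

Lemma binc_stageS k : binc_stage k `<=` binc_stage k.+1.
Proof.
case: k => [//|k] x kx; rewrite -/(binc_stage k.+1) in kx.
by move=> T [_]; apply; left.
Qed.

Lemma binc_stage_le k l : (k <= l)%N -> binc_stage k `<=` binc_stage l.
Proof.
elim: l => [|l IHl]; first by rewrite leqn0 => /eqP->.
rewrite leq_eqVlt => /predU1P[->//|/IHl kl x /kl]; exact: binc_stageS.
Qed.

Lemma binc_binom a n : a \in binc_pred -> Zloc_binom a n \in binc_pred.
Proof.
move=> /binc_predP aP; have {}aP : exists k, `[< binc_stage k a >].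
  by have [k ka] := aP; exists k; apply/asboolP.
case: (ex_minnP aP) => -[|k] /asboolP // ka kmin.
apply/binc_predP; exists k.+2 => T [_]; apply; right; exists a, n; split=> //.
by split=> // ka'; have := kmin k; rewrite ltnn => /(_ (asboolT ka')).
Qed.

Fact binc_subring_closed : subring_closed binc_pred.
Proof.
have dir x y : x \in binc_pred -> y \in binc_pred ->
    exists k, binc_stage k.+1 x /\ binc_stage k.+1 y.
  move=> /binc_predP[k kx] /binc_predP[l ly]; exists (maxn k l); split.
    by apply: binc_stage_le kx; rewrite leqW // leq_maxl.
  by apply: binc_stage_le ly; rewrite leqW // leq_maxr.
split=> [|x y xP yP|x y xP yP].
- by apply/binc_predP; exists 1%N; have [] := binc_stage_subring 0.
- have [k [kx ky]] := dir x y xP yP; apply/binc_predP; exists k.+1.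
  by have [_ + _] := binc_stage_subring k; apply.
- have [k [kx ky]] := dir x y xP yP; apply/binc_predP; exists k.+1.
  by have [_ _] := binc_stage_subring k; apply.
Qed.

(* The type only depends on R; the hypothesis is there for the instances.    *)
Definition binc (_ : domain0 R) := {x : Zloc R | x \in binc_pred}.

Variable dR : domain0 R.

HB.instance Definition _ := SubChoice.on (binc dR).
HB.instance Definition _ := GRing.SubChoice_isSubComPzRing.Build
  (Zloc R) binc_pred (binc dR) binc_subring_closed.

Fact binc_1neq0 : (1 : binc dR) != 0.
Proof.
have [Z1 _ _] := Zloc_domain0 dR; apply: contraNneq Z1 => /(congr1 val).
by rewrite rmorph1 rmorph0 => ->.
Qed.
HB.instance Definition _ :=
  GRing.PzSemiRing_isNonZero.Build (binc dR) binc_1neq0.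

Fact binc_domain0 : domain0 (binc dR).
Proof.
have [_ ZM Zn] := Zloc_domain0 dR; split; first exact: binc_1neq0.
  move=> x y /(congr1 val); rewrite rmorphM => /ZM[]h; [left|right];
  by apply/val_inj; rewrite h.
move=> n; apply: contraNneq (Zn n) => /(congr1 val).
by rewrite rmorph_nat rmorph0 => ->.
Qed.

Definition binc_binr (l : binc dR) n : binc dR :=
  Sub (Zloc_binom (val l) n) (binc_binom n (valP l)).

Fact binc_binrP (l : binc dR) n :
  binc_binr l n * n`!%:R = \prod_(i < n) (l - i%:R).
Proof.
have lB i : val (l - i%:R : binc dR) = val l - i%:R.
  by rewrite rmorphB rmorph_nat.
apply/val_inj; rewrite rmorphM rmorph_nat rmorph_prod /= /Zloc_binom.
rewrite -mulrA -[X in _ * X]/(_ * (n`!%:Z)%:~R) Zfrac_divP mulr1.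
by apply: eq_bigr => i _; exact/esym/lB.
Qed.
HB.instance Definition _ := isBinomial.Build (binc dR) binc_domain0 binc_binrP.

End BinomialClosure.

Section Groups.
Local Open Scope group_scope.
Local Open Scope classical_set_scope.

Definition is_subgroup (G : groupType) (S : set G) : Prop :=
  [/\ S 1, forall x y, S x -> S y -> S (x * y) & forall x, S x -> S x^-1].

(* lcs G i is the (i+1)-st term gamma_(i+1) of the lower central series.     *)
Fixpoint lcs (G : groupType) (i : nat) : set G :=
  if i is i'.+1 then
    smallest (@is_subgroup G) [set z | exists x y, @lcs G i' x /\ z = [~ x, y]]
  else setT.
#[global] Arguments lcs : clear implicits.

Definition nilpotent_le (c : nat) (G : groupType) : Prop := lcs G c `<=` [set 1].

(* petrescos x i is the list [tau_1; ...; tau_i] of the Petresco words        *)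
(* evaluated at the elements of x; taking for x the basis of a free group    *)
(* gives the words themselves (see petresco_morph).                          *)
Fixpoint petrescos (G : groupType) (x : seq G) (i : nat) : seq G :=
  if i is i'.+1 then
    let s := petrescos x i' in
    rcons s ((\prod_(0 <= j < i') s`_j ^+ 'C(i, j.+1))^-1 *
             \prod_(a <- x) a ^+ i)
  else [::].

Definition petresco (G : groupType) (x : seq G) (i : nat) : G :=
  last 1 (petrescos x i).

Lemma size_petrescos (G : groupType) (x : seq G) i : size (petrescos x i) = i.
Proof. by elim: i => // i IHi; rewrite /= size_rcons IHi. Qed.

Lemma nth_petrescos (G : groupType) (x : seq G) i j :
  (j < i)%N -> (petrescos x i)`_j = petresco x j.+1.
Proof.
elim: i => // i IHi; rewrite ltnS leq_eqVlt /= nth_rcons size_petrescos.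
case: ltngtP => //= [ji _|-> _]; first exact: IHi.
by rewrite /petresco /= last_rcons.
Qed.

Lemma petrescoP (G : groupType) (x : seq G) i :
  \prod_(a <- x) a ^+ i = \prod_(1 <= j < i.+1) petresco x j ^+ 'C(i, j).
Proof.
case: i => [|i].
  by rewrite big_geq // big1 // => a _; rewrite expg0.
rewrite big_nat_recr //= binn expg1 big_add1 /=.
rewrite [X in _ * X]/petresco /= last_rcons.
have -> : \prod_(0 <= j < i) (petrescos x i)`_j ^+ 'C(i.+1, j.+1) =
          \prod_(0 <= j < i) petresco x j.+1 ^+ 'C(i.+1, j.+1).
  by apply: eq_big_nat => j /andP[_ ji]; rewrite nth_petrescos.
by rewrite mulVKg.
Qed.

Definition group_morph (G H : groupType) (f : G -> H) : Prop :=
  {morph f : x y / x * y}.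

Section GroupMorph.
Variables (G H : groupType) (f : G -> H) (fM : group_morph f).

Lemma group_morph1 : f 1 = 1.
Proof. by apply: (@mulgI _ (f 1)); rewrite -fM !mulg1. Qed.
Lemma group_morphV : {morph f : x / x^-1}.
Proof.
by move=> x; apply: (@mulgI _ (f x)); rewrite -fM !mulgV group_morph1.
Qed.
Lemma group_morphX n : {morph f : x / x ^+ n}.
Proof.
by move=> x; elim: n => [|n IHn]; rewrite ?group_morph1 // !expgS fM IHn.
Qed.
Lemma group_morph_prod I r (P : pred I) E :
  f (\prod_(i <- r | P i) E i) = \prod_(i <- r | P i) f (E i).
Proof. exact: (big_morph f fM group_morph1). Qed.
Lemma group_morphR : {morph f : x y / [~ x, y]}.
Proof. by move=> x y; rewrite /commg /conjg !fM !group_morphV. Qed.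

Lemma petrescos_morph x i : map f (petrescos x i) = petrescos (map f x) i.
Proof.
elim: i => //= i IHi; rewrite map_rcons -IHi fM group_morphV.
rewrite !group_morph_prod big_map; congr (rcons _ (_^-1 * _)).
  apply: eq_big_nat => j /andP[_ ji].
  by rewrite group_morphX (nth_map 1) // size_petrescos.
by apply: eq_bigr => a _; rewrite group_morphX.
Qed.

Lemma petresco_morph x i : f (petresco x i) = petresco (map f x) i.
Proof. by rewrite /petresco -petrescos_morph -group_morph1 last_map. Qed.

Lemma lcs_morph i x : lcs G i x -> lcs H i (f x).
Proof.
elim: i x => // i IHi x xi.
apply: (xi [set y | lcs H i.+1 (f y)]); split.
  split=> [T [[]]|y z yS zS T TS|y yS T TS] /=; first by rewrite group_morph1.
    by rewrite fM; have [[_ + _] _] := TS; apply; [apply: yS|apply: zS].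
  by rewrite group_morphV; have [[_ _ +] _] := TS; apply; apply: yS.
move=> _ [y [z [yi ->]]] T [_ TC]; apply: TC; exists (f y), (f z).
by rewrite group_morphR; split; first exact: IHi.
Qed.

End GroupMorph.
End Groups.

HB.mixin Record isHall (R : binomialRingType) (c : nat) G of Group G := {
  hall_nilpotent : nilpotent_le c G;
  hpow : G -> R -> G;
  hpow0 : forall g, hpow g 0%R = 1%g;
  hpow1 : forall g, hpow g 1%R = g;
  hpowD : forall g a b, hpow g (a + b)%R = (hpow g a * hpow g b)%g;
  hpowM : forall g a b, hpow (hpow g a) b = hpow g (a * b)%R;
  hpowJ : forall (x y : G) l, (y^-1 * hpow x l * y = hpow (y^-1 * x * y) l)%g;
  hall_petresco : forall (x : seq G) (l : R),
    (\prod_(a <- x) hpow a l =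
     hpow (\prod_(a <- x) a) l *
     \prod_(2 <= i < c.+1) hpow (petresco x i) (binr l i))%g
}.

#[short(type="hallGroupType")]
HB.structure Definition HallGroup (R : binomialRingType) (c : nat) :=
  {G of isHall R c G & Group G}.

Definition hall_morph (R : binomialRingType) c d
    (G : hallGroupType R c) (H : hallGroupType R d) (f : G -> H) : Prop :=
  group_morph f /\
  forall g l, f (@hpow R c G g l) = @hpow R d H (f g) l.

Section HallTheory.
Local Open Scope group_scope.
Local Open Scope classical_set_scope.
Variables (R : binomialRingType) (c : nat) (G : hallGroupType R c).

Lemma hpow_nat (g : G) n : @hpow R c G g n%:R%R = g ^+ n.
Proof.
elim: n => [|n IHn]; first exact: hpow0.
by rewrite -natr1 hpowD IHn hpow1 -expgSr.
Qed.

Lemma petresco1 (x : seq G) : petresco x 1 = \prod_(a <- x) a.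
Proof. by rewrite /petresco /= big_geq // invg1 mul1g; apply: eq_bigr. Qed.

Lemma hall0 : c = 0 -> forall x : G, x = 1.
Proof.
have lcs0 (H : groupType) i (x : H) : i = 0 -> lcs H i x by move->.
by move=> c0 x; apply: (@hall_nilpotent R c G); exact: lcs0.
Qed.

Lemma hall_petresco_last (x : seq G) : petresco x c.+1 = 1.
Proof.
case: (posnP c) => [c0|c_gt0].
  exact: hall0.
have := @hall_petresco R c G x c.+1%:R%R; rewrite hpow_nat.
under eq_bigr do rewrite hpow_nat.
under [X in _ = _ * X]eq_bigr do rewrite binr_nat hpow_nat.
rewrite petrescoP big_nat_recr //= big_ltn // bin1 petresco1 binn expg1.
by rewrite -[RHS]mulg1 => /mulgI.
Qed.

Lemma lcsS (H : groupType) i : lcs H i.+1 `<=` lcs H i.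
Proof.
elim: i => [//|i IHi] x xi T TS; apply: xi; have [TG TC] := TS; split=> //.
by move=> _ [y [z [yi ->]]]; apply: TC; exists y, z; split=> //; apply: IHi.
Qed.

(* A Hall R-group of class c is one of class c+1: the extra factor of the   *)
(* last axiom vanishes by hall_petresco_last.                               *)
Definition hall_up := (G : Type).
HB.instance Definition _ := Group.on hall_up.

Fact hall_up_nilpotent : nilpotent_le c.+1 hall_up.
Proof. by move=> x /lcsS; apply: (@hall_nilpotent R c G). Qed.

Fact hall_up_petresco (x : seq hall_up) (l : R) :
  \prod_(a <- x) (@hpow R c G a l : hall_up) =
  @hpow R c G (\prod_(a <- x) a) l *
  \prod_(2 <= i < c.+2) (@hpow R c G (petresco x i) (binr l i) : hall_up).
Proof.
case: (posnP c) => [c0|c_gt0].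
  by rewrite [LHS](hall0 c0) [RHS](hall0 c0).
rewrite big_nat_recr //= hall_petresco_last.
have -> : @hpow R c G 1 (binr l c.+1) = 1.
  by rewrite -(@hpow0 R c G 1) hpowM mul0r.
rewrite mulg1; exact: hall_petresco.
Qed.

HB.instance Definition _ := isHall.Build R c.+1 hall_up hall_up_nilpotent
  (@hpow0 R c G) (@hpow1 R c G) (@hpowD R c G) (@hpowM R c G) (@hpowJ R c G)
  hall_up_petresco.

End HallTheory.

Inductive hterm (R A : Type) : Type :=
| HVar of A
| HOne
| HMul of hterm R A & hterm R A
| HInv of hterm R A
| HPow of hterm R A & R.
Arguments HVar {R A}.
Arguments HOne {R A}.

HB.instance Definition _ R A := gen_eqMixin (hterm R A).
HB.instance Definition _ R A := gen_choiceMixin (hterm R A).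

Section FreeHall.
Local Open Scope group_scope.
Local Open Scope quotient_scope.
Variables (A : Type) (R : binomialRingType) (c : nat).
Implicit Type G : hallGroupType R c.

Fixpoint heval (G : hallGroupType R c) (f : A -> G) (t : hterm R A) : G :=
  match t with
  | HVar a => f a
  | HOne => 1
  | HMul t1 t2 => heval f t1 * heval f t2
  | HInv t1 => (heval f t1)^-1
  | HPow t1 l => @hpow R c G (heval f t1) l
  end.

(* Terms are identified when they are equal identically in the variety of    *)
(* Hall R-groups of class c.                                                 *)
Definition hterm_eq (t s : hterm R A) : bool :=
  `[< forall (G : hallGroupType R c) (f : A -> G), heval f t = heval f s >].

Fact hterm_eq_refl : reflexive hterm_eq.
Proof. by move=> t; apply/asboolP. Qed.
Fact hterm_eq_sym : symmetric hterm_eq.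
Proof. by move=> t s; apply/asboolP/asboolP => h G f; rewrite h. Qed.
Fact hterm_eq_trans : transitive hterm_eq.
Proof.
by move=> t s u /asboolP st /asboolP tu; apply/asboolP => G f; rewrite st tu.
Qed.
Canonical hterm_equiv :=
  EquivRel hterm_eq hterm_eq_refl hterm_eq_sym hterm_eq_trans.

Definition hallFree := {eq_quot hterm_equiv}.
HB.instance Definition _ := Choice.on hallFree.

Definition hclass (t : hterm R A) : hallFree := \pi_hallFree t.
Definition hgen (a : A) : hallFree := hclass (HVar a).

Definition hlift (G : hallGroupType R c) (f : A -> G) (x : hallFree) : G :=
  heval f (repr x).

Lemma hlift_class G (f : A -> G) t : hlift f (hclass t) = heval f t.
Proof.
rewrite /hlift; have /eqmodP/asboolP h := reprK (hclass t); exact: h.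
Qed.

Lemma hallFreeP (x y : hallFree) :
  (forall (G : hallGroupType R c) (f : A -> G), hlift f x = hlift f y) -> x = y.
Proof. by move=> h; rewrite -[x]reprK -[y]reprK; apply/eqmodP/asboolP. Qed.

Definition hf_one : hallFree := hclass HOne.
Definition hf_mul (x y : hallFree) := hclass (HMul (repr x) (repr y)).
Definition hf_inv (x : hallFree) := hclass (HInv (repr x)).
Definition hf_pow (x : hallFree) (l : R) := hclass (HPow (repr x) l).

Let liftM G f x y : @hlift G f (hf_mul x y) = hlift f x * hlift f y.
Proof. exact: hlift_class. Qed.
Let lift1 G f : @hlift G f hf_one = 1.
Proof. exact: hlift_class. Qed.
Let liftV G f x : @hlift G f (hf_inv x) = (hlift f x)^-1.
Proof. exact: hlift_class. Qed.
Let liftX G f x l : @hlift G f (hf_pow x l) = @hpow R c G (hlift f x) l.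
Proof. exact: hlift_class. Qed.

Fact hf_mulA : associative hf_mul.
Proof. by move=> x y z; apply: hallFreeP => G f; rewrite !liftM mulgA. Qed.
Fact hf_mul1 : left_id hf_one hf_mul.
Proof. by move=> x; apply: hallFreeP => G f; rewrite liftM lift1 mul1g. Qed.
Fact hf_mul1r : right_id hf_one hf_mul.
Proof. by move=> x; apply: hallFreeP => G f; rewrite liftM lift1 mulg1. Qed.
Fact hf_mulV : left_inverse hf_one hf_inv hf_mul.
Proof.
by move=> x; apply: hallFreeP => G f; rewrite liftM liftV lift1 mulVg.
Qed.
Fact hf_mulVr : right_inverse hf_one hf_inv hf_mul.
Proof.
by move=> x; apply: hallFreeP => G f; rewrite liftM liftV lift1 mulgV.
Qed.
HB.instance Definition _ :=
  isGroup.Build hallFree hf_mulA hf_mul1 hf_mul1r hf_mulV hf_mulVr.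

Lemma hlift_morph G (f : A -> G) : group_morph (hlift f).
Proof. exact: liftM. Qed.

Fact hf_nilpotent : nilpotent_le c hallFree.
Proof.
move=> x xc; apply: hallFreeP => G f; rewrite lift1.
exact: (@hall_nilpotent R c G) (lcs_morph (hlift_morph f) xc).
Qed.
Fact hf_pow0 x : hf_pow x 0%R = 1.
Proof. by apply: hallFreeP => G f; rewrite liftX lift1 hpow0. Qed.
Fact hf_pow1 x : hf_pow x 1%R = x.
Proof. by apply: hallFreeP => G f; rewrite liftX hpow1. Qed.
Fact hf_powD x a b : hf_pow x (a + b)%R = hf_pow x a * hf_pow x b.
Proof.
by apply: hallFreeP => G f; rewrite hlift_morph !liftX hpowD.
Qed.
Fact hf_powM x a b : hf_pow (hf_pow x a) b = hf_pow x (a * b)%R.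
Proof. by apply: hallFreeP => G f; rewrite !liftX hpowM. Qed.
Fact hf_powJ (x y : hallFree) l :
  y^-1 * hf_pow x l * y = hf_pow (y^-1 * x * y) l.
Proof.
apply: hallFreeP => G f; rewrite liftX !hlift_morph.
by rewrite (group_morphV (hlift_morph f)) liftX hpowJ.
Qed.
Fact hf_petresco (x : seq hallFree) (l : R) :
  \prod_(a <- x) hf_pow a l = hf_pow (\prod_(a <- x) a) l *
    \prod_(2 <= i < c.+1) hf_pow (petresco x i) (binr l i).
Proof.
apply: hallFreeP => G f; have fM := hlift_morph f.
rewrite fM liftX !(group_morph_prod fM).
have := @hall_petresco R c G (map (hlift f) x) l; rewrite !big_map.
under eq_bigr do rewrite -liftX; move=> ->; congr (_ * _).
by apply: eq_bigr => i _; rewrite liftX (petresco_morph fM).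
Qed.
HB.instance Definition _ := isHall.Build R c hallFree hf_nilpotent
  hf_pow0 hf_pow1 hf_powD hf_powM hf_powJ hf_petresco.

Lemma hlift_hall G (f : A -> G) : @hall_morph R c c hallFree G (hlift f).
Proof. by split; [exact: hlift_morph|exact: liftX]. Qed.

Lemma hlift_gen G (f : A -> G) a : hlift f (hgen a) = f a.
Proof. exact: hlift_class. Qed.

Lemma hlift_uniq (G : hallGroupType R c) (g h : hallFree -> G) :
  @hall_morph R c c hallFree G g -> @hall_morph R c c hallFree G h ->
  (forall a, g (hgen a) = h (hgen a)) -> g =1 h.
Proof.
move=> [gM gX] [hM hX] gh x; rewrite -[x]reprK -/(hclass _).
have cM t s : hclass (HMul t s) = hclass t * hclass s.
  by apply: hallFreeP => G' f; rewrite hlift_morph !hlift_class.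
have cV t : hclass (HInv t) = (hclass t)^-1.
  by apply: hallFreeP => G' f; rewrite liftV !hlift_class.
have c1 : hclass HOne = 1 by [].
have cX t l : hclass (HPow t l) = @hpow R c hallFree (hclass t) l.
  by apply: hallFreeP => G' f; rewrite liftX !hlift_class.
elim: (repr x) => [a||t1 IH1 t2 IH2|t1 IH1|t1 IH1 l]; first exact: gh.
- by rewrite c1 !group_morph1.
- by rewrite cM gM hM IH1 IH2.
- by rewrite cV !group_morphV // IH1.
- by rewrite cX gX hX IH1.
Qed.

End FreeHall.

Section InverseLimits.
Local Open Scope group_scope.
Variables (I E : Type) (G : I -> groupType) (src tgt : E -> I).
Variable f : forall e, {multiplicative G (src e) -> G (tgt e)}.

(* The limit of a diagram with objects G i and one arrow for each e : E.     *)
Definition invlim_coherent (x : forall i, G i) : bool :=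
  `[< forall e, f e (x (src e)) = x (tgt e) >].

Definition invlim := {x : forall i, G i | invlim_coherent x}.
HB.instance Definition _ := Choice.on invlim.

Lemma invlim_eqP (x y : invlim) : (forall i, val x i = val y i) -> x = y.
Proof. by move=> xy; apply/val_inj/functional_extensionality_dep. Qed.

Lemma invlimP (x : invlim) e : f e (val x (src e)) = val x (tgt e).
Proof. by have /asboolP := valP x. Qed.

Fact invlim_one_subproof : invlim_coherent (fun=> 1).
Proof. by apply/asboolP => e; rewrite (@group_morph1 _ _ (f e) (@gmulfM _ _ (f e))). Qed.
Fact invlim_mul_subproof (x y : invlim) :
  invlim_coherent (fun i => val x i * val y i).
Proof. by apply/asboolP => e; rewrite gmulfM !invlimP. Qed.
Fact invlim_inv_subproof (x : invlim) : invlim_coherent (fun i => (val x i)^-1).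
Proof.
by apply/asboolP => e; rewrite (@group_morphV _ _ (f e) (@gmulfM _ _ (f e))) invlimP.
Qed.

Definition invlim_one : invlim := exist invlim_coherent _ invlim_one_subproof.
Definition invlim_mul (x y : invlim) : invlim :=
  exist invlim_coherent _ (invlim_mul_subproof x y).
Definition invlim_inv (x : invlim) : invlim :=
  exist invlim_coherent _ (invlim_inv_subproof x).

Fact invlim_mulA : associative invlim_mul.
Proof. by move=> x y z; apply: invlim_eqP => i; exact: mulgA. Qed.
Fact invlim_mul1 : left_id invlim_one invlim_mul.
Proof. by move=> x; apply: invlim_eqP => i; exact: mul1g. Qed.
Fact invlim_mul1r : right_id invlim_one invlim_mul.
Proof. by move=> x; apply: invlim_eqP => i; exact: mulg1. Qed.
Fact invlim_mulV : left_inverse invlim_one invlim_inv invlim_mul.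
Proof. by move=> x; apply: invlim_eqP => i; exact: mulVg. Qed.
Fact invlim_mulVr : right_inverse invlim_one invlim_inv invlim_mul.
Proof. by move=> x; apply: invlim_eqP => i; exact: mulgV. Qed.
HB.instance Definition _ := isGroup.Build invlim
  invlim_mulA invlim_mul1 invlim_mul1r invlim_mulV invlim_mulVr.

End InverseLimits.

Section ProHall.
Variables (A : Type) (R : binomialRingType).

(* The R-homomorphism F(A,R,c+1) -> F(A,R,c) which is the identity on A.     *)
Definition hall_psi (c : nat) : hallFree A R c.+1 -> hallFree A R c :=
  @hlift A R c.+1 (hall_up (hallFree A R c)) (@hgen A R c).

Fact hall_psiM c : {morph @hall_psi c : x y / (x * y)%g}.
Proof. exact: (@hlift_morph A R c.+1 (hall_up (hallFree A R c))). Qed.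
HB.instance Definition _ c := isMultiplicative.Build
  (hallFree A R c.+1) (hallFree A R c) (@hall_psi c) (@hall_psiM c).

Lemma hall_psi_hall c : @hall_morph R c.+1 c _ _ (@hall_psi c).
Proof. exact: (@hlift_hall A R c.+1 (hall_up (hallFree A R c))). Qed.

Lemma hall_psi_gen c a : @hall_psi c (hgen R c.+1 a) = hgen R c a.
Proof. exact: (@hlift_gen A R c.+1 (hall_up (hallFree A R c))). Qed.

Definition proHallFree : groupType :=
  @invlim nat nat (fun c => hallFree A R c) S id (fun c => @hall_psi c).

End ProHall.

Section QuotientGroups.
Local Open Scope group_scope.
Local Open Scope quotient_scope.
Local Open Scope classical_set_scope.
Variable G : groupType.

Record normalSubgroup := NormalSubgroup {
  normal_set :> set G;
  normal_subgroup : is_subgroup normal_set;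
  normal_conj : forall x y, normal_set x -> normal_set (x ^ y)
}.

Variable N : normalSubgroup.

Definition coset_eq (x y : G) : bool := `[< normal_set N (x^-1 * y) >].

Fact coset_eq_refl : reflexive coset_eq.
Proof.
by move=> x; apply/asboolP; rewrite mulVg; have [] := normal_subgroup N.
Qed.
Fact coset_eq_sym : symmetric coset_eq.
Proof.
have [_ _ NV] := normal_subgroup N.
by move=> x y; apply/asboolP/asboolP => /NV; rewrite invgM invgK.
Qed.
Fact coset_eq_trans : transitive coset_eq.
Proof.
have [_ NM _] := normal_subgroup N.
move=> y x z /asboolP xy /asboolP yz; apply/asboolP.
by rewrite -[x^-1](mulgK y) -(mulgA _ _ z); apply: NM.
Qed.
Canonical coset_equiv :=
  EquivRel coset_eq coset_eq_refl coset_eq_sym coset_eq_trans.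

Definition quotg := {eq_quot coset_equiv}.
HB.instance Definition _ := Choice.on quotg.

Definition qclass (x : G) : quotg := \pi_quotg x.

Lemma qclassP x y : qclass x = qclass y <-> normal_set N (x^-1 * y).
Proof. by split=> [/eqmodP/asboolP|h] //; apply/eqmodP/asboolP. Qed.

Lemma qclass_ind (P : quotg -> Prop) : (forall x, P (qclass x)) -> forall u, P u.
Proof. by move=> h u; rewrite -[u]reprK; apply: h. Qed.

Definition quotg_mul (u v : quotg) := qclass (repr u * repr v).
Definition quotg_inv (u : quotg) := qclass (repr u)^-1.

Lemma quotg_mulE x y : quotg_mul (qclass x) (qclass y) = qclass (x * y).
Proof.
have [_ NM _] := normal_subgroup N.
have /qclassP hx : qclass (repr (qclass x)) = qclass x by apply: reprK.
have /qclassP hy : qclass (repr (qclass y)) = qclass y by apply: reprK.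
apply/qclassP; move: (repr (qclass x)) (repr (qclass y)) hx hy => x' y' hx hy.
have := NM _ _ (normal_conj y' hx) hy; rewrite /conjg invgM !mulgA.
by rewrite mulgK -!mulgA.
Qed.

Lemma quotg_invE x : quotg_inv (qclass x) = qclass x^-1.
Proof.
have [_ _ NV] := normal_subgroup N.
have /qclassP hx : qclass (repr (qclass x)) = qclass x by apply: reprK.
apply/qclassP; rewrite invgK.
by have := NV _ (normal_conj x^-1 hx); rewrite /conjg mulgK invgM !invgK.
Qed.

Fact quotg_mulA : associative quotg_mul.
Proof.
elim/qclass_ind=> x; elim/qclass_ind=> y; elim/qclass_ind=> z.
by rewrite !quotg_mulE mulgA.
Qed.
Fact quotg_mul1 : left_id (qclass 1) quotg_mul.
Proof. by elim/qclass_ind=> x; rewrite quotg_mulE mul1g. Qed.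
Fact quotg_mul1r : right_id (qclass 1) quotg_mul.
Proof. by elim/qclass_ind=> x; rewrite quotg_mulE mulg1. Qed.
Fact quotg_mulV : left_inverse (qclass 1) quotg_inv quotg_mul.
Proof. by elim/qclass_ind=> x; rewrite quotg_invE quotg_mulE mulVg. Qed.
Fact quotg_mulVr : right_inverse (qclass 1) quotg_inv quotg_mul.
Proof. by elim/qclass_ind=> x; rewrite quotg_invE quotg_mulE mulgV. Qed.
HB.instance Definition _ := isGroup.Build quotg
  quotg_mulA quotg_mul1 quotg_mul1r quotg_mulV quotg_mulVr.

Lemma qclassM : {morph qclass : x y / x * y}.
Proof. by move=> x y; rewrite -quotg_mulE. Qed.

End QuotientGroups.

Section ProPCompletion.
Local Open Scope classical_set_scope.
Local Open Scope quotient_scope.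
Variables (p : nat) (G : groupType).

Record ppowNormal := PpowNormal {
  ppow_normal :> normalSubgroup G;
  ppow_index : exists k, ([set: quotg ppow_normal] #= `I_(p ^ k))%card
}.

(* The arrows of the inverse system, one for each inclusion.                 *)
Record ppowIncl := PpowIncl {
  incl_src : ppowNormal;
  incl_tgt : ppowNormal;
  inclP : (incl_src : set G) `<=` (incl_tgt : set G)
}.

Definition quotg_proj (e : ppowIncl) (u : quotg (incl_src e)) :
  quotg (incl_tgt e) := qclass _ (repr u).

Lemma quotg_projE e x : @quotg_proj e (qclass _ x) = qclass _ x.
Proof.
apply/qclassP/inclP/qclassP; exact: reprK.
Qed.

Fact quotg_projM e : {morph @quotg_proj e : u v / (u * v)%g}.
Proof.
elim/qclass_ind=> x; elim/qclass_ind=> y.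
by rewrite -qclassM !quotg_projE qclassM.
Qed.
HB.instance Definition _ e := isMultiplicative.Build
  (quotg (incl_src e)) (quotg (incl_tgt e)) (@quotg_proj e) (@quotg_projM e).

Definition propCompletion : groupType :=
  @invlim ppowNormal ppowIncl (fun N => quotg N) incl_src incl_tgt
    (fun e => @quotg_proj e).

End ProPCompletion.

Section FreeGroups.
Local Open Scope group_scope.
Local Open Scope quotient_scope.
Variable A : choiceType.

(* The letter (a, true) stands for a, and (a, false) for its inverse.        *)
Definition fgword := seq (A * bool).
HB.instance Definition _ := Choice.on fgword.

Inductive fg_eq : fgword -> fgword -> Prop :=
| fg_refl w : fg_eq w w
| fg_sym w1 w2 : fg_eq w1 w2 -> fg_eq w2 w1
| fg_trans w1 w2 w3 : fg_eq w1 w2 -> fg_eq w2 w3 -> fg_eq w1 w3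
| fg_cancel u v a b : fg_eq (u ++ [:: (a, b); (a, ~~ b)] ++ v) (u ++ v).

Definition fg_eqb (w1 w2 : fgword) : bool := `[< fg_eq w1 w2 >].

Fact fg_eqb_refl : reflexive fg_eqb.
Proof. by move=> w; apply/asboolP; constructor. Qed.
Fact fg_eqb_sym : symmetric fg_eqb.
Proof. by move=> w1 w2; apply/asboolP/asboolP; exact: fg_sym. Qed.
Fact fg_eqb_trans : transitive fg_eqb.
Proof.
move=> w2 w1 w3 /asboolP h1 /asboolP h2; apply/asboolP; exact: fg_trans h1 h2.
Qed.
Canonical fg_equiv := EquivRel fg_eqb fg_eqb_refl fg_eqb_sym fg_eqb_trans.

Definition freeGroup := {eq_quot fg_equiv}.
HB.instance Definition _ := Choice.on freeGroup.

Definition fgclass (w : fgword) : freeGroup := \pi_freeGroup w.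
Definition fggen (a : A) : freeGroup := fgclass [:: (a, true)].

Definition fginvw (w : fgword) : fgword := rev [seq (l.1, ~~ l.2) | l <- w].

Lemma fgclassP w1 w2 : fgclass w1 = fgclass w2 <-> fg_eq w1 w2.
Proof. by split=> [/eqmodP/asboolP|h] //; apply/eqmodP/asboolP. Qed.

Lemma fgclass_ind (P : freeGroup -> Prop) :
  (forall w, P (fgclass w)) -> forall x, P x.
Proof. by move=> h x; rewrite -[x]reprK; apply: h. Qed.

Lemma fg_eq_cat w1 w1' w2 w2' :
  fg_eq w1 w1' -> fg_eq w2 w2' -> fg_eq (w1 ++ w2) (w1' ++ w2').
Proof.
move=> h1 h2; apply: (@fg_trans _ (w1' ++ w2)).
  elim: h1 => [w|u v _|u v w _ + _|u v a b]; rewrite -?catA.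
  - exact: fg_refl.
  - exact: fg_sym.
  - exact: fg_trans.
  - exact: (@fg_cancel u (v ++ w2)).
elim: h2 => [w|u v _|u v w _ + _|u v a b].
- exact: fg_refl.
- exact: fg_sym.
- exact: fg_trans.
- by rewrite (catA w1' u) (catA w1' u v); exact: (@fg_cancel (w1' ++ u) v).
Qed.

Lemma fginvw_cat w1 w2 : fginvw (w1 ++ w2) = fginvw w2 ++ fginvw w1.
Proof. by rewrite /fginvw map_cat rev_cat. Qed.

Lemma fg_eq_inv w1 w2 : fg_eq w1 w2 -> fg_eq (fginvw w1) (fginvw w2).
Proof.
elim=> [w|u v _|u v w _ + _|u v a b].
- exact: fg_refl.
- exact: fg_sym.
- exact: fg_trans.
- rewrite !fginvw_cat -catA /(fginvw [:: _; _]) /= /rev /= negbK.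
  exact: fg_cancel.
Qed.

Lemma fg_eq_mulV w : fg_eq (fginvw w ++ w) [::].
Proof.
elim: w => [|[a b] w IHw]; first exact: fg_refl.
rewrite -[_ :: w]/([:: (a, b)] ++ w) fginvw_cat -catA.
apply: fg_trans IHw; have := @fg_cancel (fginvw w) w a (~~ b).
by rewrite negbK.
Qed.

Lemma fginvwK : involutive fginvw.
Proof.
move=> w; rewrite /fginvw map_rev revK -map_comp map_id_in // => -[a b] _ /=.
by rewrite negbK.
Qed.

Definition fg_mul (x y : freeGroup) := fgclass (repr x ++ repr y).
Definition fg_inv (x : freeGroup) := fgclass (fginvw (repr x)).

Lemma fg_mulE w1 w2 : fg_mul (fgclass w1) (fgclass w2) = fgclass (w1 ++ w2).
Proof. by apply/fgclassP/fg_eq_cat; apply/fgclassP; exact: reprK. Qed.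
Lemma fg_invE w : fg_inv (fgclass w) = fgclass (fginvw w).
Proof. by apply/fgclassP/fg_eq_inv; apply/fgclassP; exact: reprK. Qed.

Fact fg_mulA : associative fg_mul.
Proof.
elim/fgclass_ind=> x; elim/fgclass_ind=> y; elim/fgclass_ind=> z.
by rewrite !fg_mulE catA.
Qed.
Fact fg_mul1 : left_id (fgclass [::]) fg_mul.
Proof. by elim/fgclass_ind=> x; rewrite fg_mulE. Qed.
Fact fg_mul1r : right_id (fgclass [::]) fg_mul.
Proof. by elim/fgclass_ind=> x; rewrite fg_mulE cats0. Qed.
Fact fg_mulV : left_inverse (fgclass [::]) fg_inv fg_mul.
Proof.
elim/fgclass_ind=> x; rewrite fg_invE fg_mulE; apply/fgclassP/fg_eq_mulV.
Qed.
Fact fg_mulVr : right_inverse (fgclass [::]) fg_inv fg_mul.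
Proof.
elim/fgclass_ind=> x; rewrite fg_invE fg_mulE -[X in X ++ _]fginvwK.
by apply/fgclassP/fg_eq_mulV.
Qed.
HB.instance Definition _ := isGroup.Build freeGroup
  fg_mulA fg_mul1 fg_mul1r fg_mulV fg_mulVr.

End FreeGroups.

(* For finite A, the free pro-p group with basis A is the pro-p completion   *)
(* of the free group on A, i.e. the inverse limit of its quotients of        *)
(* p-power order.                                                            *)
Definition freeProP (p : nat) (A : choiceType) : groupType :=
  propCompletion p (freeGroup A).

Definition fully_residually (G H : groupType) : Prop :=
  forall C : seq G, exists f : {multiplicative G -> H}, {in C &, injective f}.

(* Main.v *)
Require Import Defs.
From HB Require Import structures.
From mathcomp Require Import all_boot all_order all_fingroup all_algebra all_solvable.
From mathcomp Require Import mxrepresentation mxabelem.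
From mathcomp Require Import boolp classical_sets cardinality generic_quotient ring.

(* Let [S = R^bin].  For [n <= c] the layer [gam n / gam n.+1] of the free Hall
   [S]-group of class [c] is spanned over [S] by the standard bracketings of the
   Lyndon words of length [n]; here [gam n] is the Hall closure of the [n]-th term
   of the lower central series.  So an element [z <> 1] has a leading coefficient
   [al <> 0], at the smallest Lyndon word of its leading layer.

   A ring homomorphism [R -> Z_p] extends to [phi : S -> Z_p] because [Z_p] is
   binomial and torsion free, and [phi] can be made injective on a given finite
   set.  Through [phi] every finite p-group [Q] is a Hall [S]-group: its [p]-power
   exponent makes [g ^ phi l] meaningful, and for large [i] the [i]-th Petresco
   words vanish on [Q], since in a unipotent representation they lie in
   [1 + J i].  By freeness, [phi] thus induces compatible maps from the free
   pro-Hall group to all finite p-quotients of the free group.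

   In the Magnus representation [a |-> 1 + X_a] over [Z/p^(k+1)], truncated at
   degree [n], the bracketing of a Lyndon word [w] is [w] plus larger words.
   The coefficient of [z] at its leading word is then [phi al], which survives
   modulo [p^(k+1)] for large [k].  A [phi] that is injective on finitely many
   leading coefficients and [0] therefore separates finitely many elements. *)

Set Implicit Arguments.
Unset Strict Implicit.
Unset Printing Implicit Defensive.
Import GRing.Theory.

(** * Hall-closed subgroups and the filtration [gam] *)

Arguments normal_set {G}.

Section Normal.
Local Open Scope group_scope.
Variable G : groupType.

Let gsimp := (@invgM G, @invgK G, @invg1 G, @mulgA G, @mulg1 G, @mul1g G, @mulVg G, @mulgV G,
  @mulgK G, @mulgVK G).

Lemma commgMl (x z y : G) : [~ x * z, y] = [~ x, y] * [~ [~ x, y], z] * [~ z, y].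
Proof.
by rewrite /commg /conjg !gsimp.
Qed.

Lemma commVg (x y : G) : [~ x^-1, y] = [~ x, y]^-1 * [~ [~ x, y]^-1, x^-1].
Proof.
by rewrite /commg /conjg !gsimp.
Qed.

Lemma hall_witt (x y z : G) :
  [~ [~ x, y^-1], z] ^ y * [~ [~ y, z^-1], x] ^ z * [~ [~ z, x^-1], y] ^ x = 1.
Proof.
by rewrite /commg /conjg !gsimp.
Qed.

(** For commuting elements the product of the [n]-th powers is the [n]-th power of the product. The
    factor [tau_1] already accounts for it, so the recursion forces every later word to be
    trivial. *)
Lemma petresco_comm (x : seq G) i : (forall a b, a \in x -> b \in x -> commute a b) ->
  (1 < i)%N -> petresco x i = 1.
Proof.
move=> xC; have prodX n : \prod_(a <- x) a ^+ n = (\prod_(a <- x) a) ^+ n.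
  elim: x xC => [|a x IHx] xC; first by rewrite !big_nil expg1n.
  rewrite !big_cons expgMn ?IHx //; first by move=> b c bx cx; apply: xC; rewrite inE ?bx ?cx orbT.
  rewrite big_seq; apply: commute_prod => b bx; apply: xC; rewrite inE ?eqxx ?bx ?orbT //.
elim/ltn_ind: i => -[//|i] IHi i1; have := petrescoP x i.+1.
have p1 : petresco x 1 = \prod_(a <- x) a.
  by rewrite /petresco /= big_geq // invg1 mul1g; apply: eq_bigr.
rewrite prodX big_ltn // p1 bin1 big_nat_recr //= binn expg1.
have -> : \prod_(2 <= j < i.+1) petresco x j ^+ 'C(i.+1, j) = 1.
  by rewrite big_nat; apply: big1 => j /andP[j1 ji]; rewrite IHi ?expg1n.
by rewrite mul1g -[LHS]mulg1 => /mulgI.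
Qed.

End Normal.

Section NormalSubgroups.
Local Open Scope group_scope.
Variables (G : groupType) (N : normalSubgroup G).

Lemma qclass1 x : qclass N x = 1 <-> normal_set N x.
Proof.
rewrite (_ : 1 = qclass N 1) //; split=> [/esym/qclassP|Nx].
  by rewrite invg1 mul1g.
by apply/esym/qclassP; rewrite invg1 mul1g.
Qed.

Lemma normal_petresco (x : seq G) i :
  (forall a b, a \in x -> b \in x -> normal_set N [~ a, b]) -> (1 < i)%N -> normal_set N (petresco x i).
Proof.
move=> xC i1; apply/qclass1; rewrite (@petresco_morph _ _ (qclass N)); last exact: qclassM.
apply: (@petresco_comm (quotg N)) => // _ _ /mapP[a ax ->] /mapP[b bx ->].
by apply/commgP/eqP; rewrite -(group_morphR (@qclassM G N)); apply/qclass1/xC.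
Qed.

Lemma normal1 : normal_set N 1. Proof. by have [] := normal_subgroup N. Qed.
Lemma normalM x y : normal_set N x -> normal_set N y -> normal_set N (x * y).
Proof. by have [_ h _] := normal_subgroup N; apply: h. Qed.
Lemma normalV x : normal_set N x -> normal_set N x^-1.
Proof. by have [_ _ h] := normal_subgroup N; apply: h. Qed.
Lemma normalR x y : normal_set N x -> normal_set N [~ x, y].
Proof. by move=> Nx; apply: normalM (normalV Nx) (normal_conj _ Nx). Qed.
End NormalSubgroups.

Section HallSubgroups.
Local Open Scope group_scope.
Local Open Scope classical_set_scope.
Variables (R : binomialRingType) (c : nat) (G : hallGroupType R c).
Local Notation "x ^^ l" := (@hpow R c G x l) (at level 29).
Implicit Types (x y z : G) (T X : set G).

Lemma hpowN x l : x ^^ (- l)%R = (x ^^ l)^-1.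
Proof.
by apply: (@mulgI _ (x ^^ l)); rewrite -hpowD subrr hpow0 mulgV.
Qed.

Lemma hpowV x l : x^-1 ^^ l = (x ^^ l)^-1.
Proof. by rewrite -{1}[x]hpow1 -hpowN hpowM mulN1r hpowN. Qed.

Lemma hpow1g l : 1 ^^ l = 1.
Proof. by rewrite -(@hpow0 R c G 1) hpowM mul0r. Qed.

Lemma hpowcJ x y l : (x ^^ l) ^ y = (x ^ y) ^^ l.
Proof. by rewrite /conjg !mulgA hpowJ. Qed.

Definition hall_closed T := [/\ T 1, forall x y, T x -> T y -> T (x * y),
  forall x, T x -> T x^-1 & forall x l, T x -> T (x ^^ l)].

(** An inductive form of the Hall subgroup generated by [X], so that statements about it can be
    proved by induction on how an element is built. *)
Inductive hspan X : G -> Prop :=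
| hspan_gen x : X x -> hspan X x
| hspan_one : hspan X 1
| hspan_mul x y : hspan X x -> hspan X y -> hspan X (x * y)
| hspan_inv x : hspan X x -> hspan X x^-1
| hspan_pow x l : hspan X x -> hspan X (x ^^ l).

Lemma hspan_closed X : hall_closed (hspan X).
Proof. by split; [exact: hspan_one|exact: hspan_mul|exact: hspan_inv|exact: hspan_pow]. Qed.

Lemma hspan_min X T : hall_closed T -> X `<=` T -> hspan X `<=` T.
Proof. by move=> [T1 TM TV TX] XT x; elim=> //; auto. Qed.

Lemma closed_prod T (I : eqType) (r : seq I) (F : I -> G) : hall_closed T ->
  (forall i, i \in r -> T (F i)) -> T (\prod_(i <- r) F i).
Proof.
by move=> [T1 TM _ _] TF; rewrite big_seq; elim/big_rec: _ => // i x ir; apply/TM/TF.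
Qed.

Section HallNormal.
Variable N : normalSubgroup G.
Hypothesis NH : hall_closed (normal_set N).

(* Two elements that commute modulo [N] have trivial higher Petresco words in
   [G / N], so that [x -> x ^^ l] is multiplicative on them modulo [N]. *)
Lemma hpow_mul2 x y l : normal_set N [~ x, y] ->
  exists2 r, normal_set N r & x ^^ l * y ^^ l = (x * y) ^^ l * r.
Proof.
move=> Nxy; have := @hall_petresco R c G [:: x; y] l.
rewrite !big_cons !big_nil !mulg1 => ->; eexists; last reflexivity.
apply: closed_prod => // i; rewrite mem_index_iota => /andP[i1 _].
have [_ _ _ NX] := NH; apply: (NX); apply: normal_petresco => //.
move=> a b; rewrite !inE => /orP[]/eqP-> /orP[]/eqP->; rewrite ?commgg //.
- exact: normal1.
- by rewrite -invgR; apply: normalV.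
- exact: normal1.
Qed.

(** Since [x] and [y] agree modulo [N], the elements [x^-1] and [y] commute there, and [hpow_mul2]
    gives the quotient of the powers as a power of [x^-1 * y]. *)
Lemma hpow_cong x y l : normal_set N (x^-1 * y) ->
  normal_set N ((x ^^ l)^-1 * y ^^ l).
Proof.
move=> Nxy; have [|r Nr] := @hpow_mul2 x^-1 y l.
  have -> : [~ x^-1, y] = (x^-1 * y)^-1 ^ x^-1 * (x^-1 * y).
    by rewrite /commg /conjg !invgM !invgK !mulgA mulgK.
  exact/normalM/Nxy/normal_conj/normalV.
rewrite hpowV => ->; have [_ NM _ NX] := NH.
by apply: (NM) => //; apply: (NX).
Qed.

(** The commutator of [x ^^ l] with [y] is [(x^-1) ^^ l * (x ^ y) ^^ l]. Modulo [N] the two bases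
    commute as soon as [x] commutes with [[~ x, y]]. *)
Lemma comm_hpow x y l : normal_set N [~ [~ x, y], x] ->
  exists2 r, normal_set N r & [~ x ^^ l, y] = [~ x, y] ^^ l * r.
Proof.
move=> Nxyx; have [|r Nr] := @hpow_mul2 x^-1 (x ^ y) l.
  rewrite commVg; set u := [~ x, x ^ y].
  suff Nu : normal_set N u by apply: normalM (normalV Nu) (normalR _ (normalV Nu)).
  rewrite /u -[x ^ y](mulVKg x) -commgEl -invgR commgMl commgg comm1g !mul1g.
  exact: normalV.
by rewrite hpowV -hpowcJ -commgEl => ->; exists r.
Qed.

(** This reduces a commutator estimate to generators of the first argument. *)
Lemma centraliser_closed (D : set G) :
  hall_closed [set y | forall x, D x -> normal_set N [~ y, x]].
Proof.
have [N1 NM NV NX] := NH.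
split=> /=.
- by move=> x _; rewrite comm1g.
- move=> y z Ny Nz x Dx; rewrite commgMl; apply: (NM); last exact: Nz.
  by apply: (NM); [exact: Ny|apply/normalR/Ny].
- move=> y Ny x Dx; rewrite commVg; apply: (NM); first exact/NV/Ny.
  exact/normalR/NV/Ny.
- move=> y l Ny x Dx; have [|r Nr ->] := @comm_hpow y x l.
    exact/normalR/Ny.
  by apply: (NM) => //; apply/NX/Ny.
Qed.
End HallNormal.

(** The Hall closure is taken because the terms of the lower central series need not be stable under
    powers from [R]. The predecessor restores the usual numbering: [gam 1] is the whole group, and
    so is [gam 0]. *)
Definition gam n : set G := hspan (lcs G n.-1).

Lemma gam_closed n : hall_closed (gam n). Proof. exact: hspan_closed. Qed.

Fact gam_subgroup n : is_subgroup (gam n).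
Proof. by split; [exact: hspan_one|exact: hspan_mul|exact: hspan_inv]. Qed.

Fact gam_conj n x y : gam n x -> gam n (x ^ y).
Proof.
elim=> [{}x xn||{}x z _ IHx _ IHz|{}x _ IH|{}x l _ IH].
- apply: hspan_gen; apply: (@lcs_morph G G (fun x => x ^ y)) xn.
  by move=> a b; rewrite conjMg.
- by rewrite conj1g; apply: hspan_one.
- by rewrite conjMg; apply: hspan_mul.
- by rewrite conjVg; apply: hspan_inv.
- by rewrite hpowcJ; apply: hspan_pow.
Qed.

Definition gamN n := NormalSubgroup (gam_subgroup n) (@gam_conj n).

Lemma gam1 x : gam 1 x. Proof. exact: hspan_gen. Qed.

Lemma gamM n x y : gam n x -> gam n y -> gam n (x * y).
Proof. exact: hspan_mul. Qed.
Lemma gamV n x : gam n x -> gam n x^-1.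
Proof. exact: hspan_inv. Qed.
Lemma gamX n x l : gam n x -> gam n (x ^^ l).
Proof. exact: hspan_pow. Qed.

Lemma gamS n : gam n.+1 `<=` gam n.
Proof.
apply: hspan_min; first exact: gam_closed.
by case: n => [|n] x xn; apply: hspan_gen => //; apply: lcsS.
Qed.

Lemma gam_le m n : (m <= n)%N -> gam n `<=` gam m.
Proof.
move=> /subnK <-; elim: (n - m)%N => // k IHk x; rewrite addSn => /gamS; exact: IHk.
Qed.

Lemma gam_last x : gam c.+1 x -> x = 1.
Proof.
have /(_ c.+1) : forall n, n = c.+1 -> gam n x -> x = 1; last exact.
move=> n ->; elim=> [{}x xn||{}x z _ -> _ ->|{}x _ ->|{}x l _ ->] //.
- exact: (@hall_nilpotent R c G).
- by rewrite mulg1.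
- by rewrite invg1.
- by rewrite hpow1g.
Qed.

Lemma gam_comm1 n x y : (0 < n)%N -> gam n x -> gam n.+1 [~ x, y].
Proof.
case: n => // n _ xn; have NH : hall_closed (normal_set (gamN n.+2)) := gam_closed _.
apply: (@hspan_min _ _ (centraliser_closed NH setT) _ x xn) => // z zn w _.
by apply: hspan_gen => T [_ TS]; apply: TS; exists z, w.
Qed.

(** A three-subgroups argument by induction on [j]: once [y] is reduced to a commutator [[~ g, h]],
    the Hall-Witt identity leaves two terms to which the induction hypothesis and [gam_comm1]
    apply. *)
Lemma gam_comm i j x y : (0 < i)%N -> (0 < j)%N ->
  gam i x -> gam j y -> gam (i + j) [~ x, y].
Proof.
move=> i0; case: j => // j _.
elim: j i i0 x y => [|j IHj] i i0 x y xi yj; first by rewrite addn1; apply: gam_comm1.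
have NH : hall_closed (normal_set (gamN (i + j.+2))) := gam_closed _.
rewrite -invgR; apply: gamV.
apply: (@hspan_min _ _ (centraliser_closed NH (gam i)) _ y yj) xi => {x y yj}.
move=> y; apply=> /=; split=> [|_ [g [h [gj ->]]] x xi].
  by have [? ? ? _] := centraliser_closed NH (gam i); split.
have {}gj : gam j.+1 g by apply: hspan_gen.
have := hall_witt g h^-1 x; rewrite invgK => hw.
suff : gam (i + j.+2) ([~ [~ g, h], x] ^ h^-1).
  by move=> /(@gam_conj _ _ h); rewrite -conjgM mulVg conjg1.
have -> : [~ [~ g, h], x] ^ h^-1 =
    ([~ [~ h^-1, x^-1], g] ^ x * [~ [~ x, g^-1], h^-1] ^ g)^-1.
  by apply: (@mulIg _ ([~ [~ h^-1, x^-1], g] ^ x * [~ [~ x, g^-1], h^-1] ^ g)); rewrite mulVg mulgA.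
apply/gamV/gamM; apply: gam_conj.
  rewrite -addSnnS; apply: IHj => //.
  by rewrite -invgR; apply/gamV/gam_comm1/gamV.
rewrite addnS; apply: gam_comm1; first by rewrite addnS.
by apply: IHj => //; apply: gamV.
Qed.

(** * Lie calculus in one layer, modulo a Hall-closed set *)

Section Layer.
Variables (n : nat) (T : set G).
Hypotheses (TH : hall_closed T) (nT : gam n.+1 `<=` T).

(** Modulo [gam n.+1], bracketing with [y] is additive and commutes with powers from [R], so
    membership in [T] spreads from generators to their span. *)
Lemma comm_hspan i j X y : (0 < i)%N -> (0 < j)%N -> (i + j)%N = n ->
  X `<=` gam i -> gam j y -> (forall x, X x -> T [~ x, y]) ->
  forall s, hspan X s -> T [~ s, y].
Proof.
move=> i0 j0 ijn Xi yj XT s sX; have [T1 TM TV TX] := TH.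
have small u v : gam i u -> gam i v -> gam n.+1 [~ [~ u, y], v].
  move=> ui vi; apply: (@gam_le _ (n + i)); first by rewrite -addn1 leq_add2l.
  by apply: gam_comm => //; rewrite -?ijn ?addn_gt0 ?i0 //; apply: gam_comm.
have si' x : hspan X x -> gam i x by apply: hspan_min => //; apply: gam_closed.
elim: sX => [x /XT//||{}s t /si' si0 IHs /si' ti IHt|{}s /si' si0 IH|{}s l /si' si0 IH].
- by rewrite comm1g.
- by rewrite commgMl; apply/TM/IHt/TM/nT/small.
- rewrite commVg; apply: (TM); first by move: (TV _ IH).
  apply: nT; apply: gam_comm1; first by rewrite -ijn addn_gt0 i0.
  by rewrite -ijn; apply/gamV/gam_comm.
- have [|r rn ->] := @comm_hpow (gamN n.+1) (gam_closed _) s y l; first exact: small.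
  by apply: (TM); [apply: TX|apply: nT].
Qed.

Lemma comm_swap x y : T [~ x, y] -> T [~ y, x].
Proof. by have [_ _ TV _] := TH; move=> Txy; rewrite -invgR; apply: (TV). Qed.

Lemma comm_inv i j x y : (0 < i)%N -> (0 < j)%N -> (i + j)%N = n ->
  gam i x -> gam j y -> T [~ x, y] -> T [~ x^-1, y].
Proof.
move=> i0 j0 ijn xi yj Txy; apply: (@comm_hspan i j [set x]) => //.
- by move=> _ ->.
- by move=> _ ->.
- by apply/hspan_inv/hspan_gen.
Qed.

Lemma conj_layer x y : (0 < n)%N -> gam n x -> T (x ^ y) -> T x.
Proof.
move=> n0 xn Txy; have [_ TM TV _] := TH.
have -> : x = x ^ y * [~ x, y]^-1 by rewrite commgEl invgM invgK mulVKg.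
by apply: (TM) => //; apply/TV/nT/gam_comm1.
Qed.

Lemma layer_conj x y : (0 < n)%N -> gam n x -> T x -> T (x ^ y).
Proof.
move=> n0 xn Tx; apply: (@conj_layer _ y^-1) => //; first exact: gam_conj.
by rewrite -conjgM mulgV conjg1.
Qed.

Lemma comm_inv3 i j k x y z : (0 < i)%N -> (0 < j)%N -> (0 < k)%N ->
  (i + j + k)%N = n -> gam i x -> gam j y -> gam k z ->
  T [~ [~ x, y], z] -> T [~ [~ x^-1, y], z].
Proof.
move=> i0 j0 k0 ijk xi yj zk Txyz; rewrite commVg.
have ij0 : (0 < i + j)%N by rewrite addn_gt0 i0.
have xyij : gam (i + j) [~ x, y] by apply: gam_comm.
pose X := [set [~ x, y]; [~ [~ x, y]^-1, x^-1]].
have rS : gam (i + j).+1 [~ [~ x, y]^-1, x^-1].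
  by apply: gam_comm1 => //; apply: gamV.
apply: (@comm_hspan (i + j) k X) => //.
- by move=> _ [->|->] //; apply: gamS.
- move=> _ [->|->] //; apply: nT; rewrite -ijk -!addSn; exact: gam_comm.
- by apply: hspan_mul; [apply: hspan_inv|]; apply: hspan_gen; [left|right].
Qed.

(** The Jacobi identity as a membership rule. It is the Hall-Witt identity, whose inverses and
    conjugations are harmless modulo [gam n.+1]. *)
Lemma comm_jacobi i j k x y z : (0 < i)%N -> (0 < j)%N -> (0 < k)%N ->
  (i + j + k)%N = n -> gam i x -> gam j y -> gam k z ->
  T [~ [~ y, z], x] -> T [~ [~ z, x], y] -> T [~ [~ x, y], z].
Proof.
move=> i0 j0 k0 ijk xi yj zk Tyzx Tzxy; have [_ TM TV _] := TH.
have n0 : (0 < n)%N by rewrite -ijk addn_gt0 k0 orbT.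
have := hall_witt x y^-1 z; rewrite invgK => hw.
have c3 i' j' k' u v w : (0 < i')%N -> (0 < j')%N -> (0 < k')%N ->
    (i' + j' + k')%N = n -> gam i' u -> gam j' v -> gam k' w -> gam n [~ [~ u, v], w].
  move=> ? ? ? <- ? ? ?; apply: gam_comm => //; last exact: gam_comm.
  by rewrite addn_gt0; apply/orP; left.
apply: (@conj_layer _ y^-1) => //; first exact: c3 ijk _ _ _.
have -> : [~ [~ x, y], z] ^ y^-1 =
    ([~ [~ y^-1, z^-1], x] ^ z * [~ [~ z, x^-1], y^-1] ^ x)^-1.
  by apply: (@mulIg _ ([~ [~ y^-1, z^-1], x] ^ z * [~ [~ z, x^-1], y^-1] ^ x)); rewrite mulVg mulgA.
have swap3 i' j' k' u v w : (0 < i')%N -> (0 < j')%N -> (0 < k')%N ->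
    (i' + j' + k')%N = n -> gam i' u -> gam j' v -> gam k' w ->
    T [~ [~ u, v], w] -> T [~ [~ v, u], w].
  move=> i'0 j'0 k'0 e ui vj wk h; rewrite -(invgR u v).
  apply: (@comm_inv (i' + j') k') => //; first by rewrite addn_gt0 i'0.
  exact: gam_comm.
have jki : (j + k + i)%N = n by rewrite -ijk (addnC _ i) addnA.
have kji : (k + j + i)%N = n by rewrite (addnC k) jki.
have ikj : (i + k + j)%N = n by rewrite -ijk addnAC.
have kij : (k + i + j)%N = n by rewrite (addnC k).
apply/TV/TM; apply: layer_conj => //.
- by apply: c3 jki _ _ _ => //; apply: gamV.
- apply: (@comm_inv3 j k i) => //; first exact: gamV.
  apply: (@swap3 k j i) => //; first exact: gamV.
  apply: (@comm_inv3 k j i) => //.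
  exact: (@swap3 j k i).
- by apply: c3 kij _ _ _ => //; apply: gamV.
- apply: comm_swap; apply: (@comm_inv j (k + i)) => //.
  + by rewrite addn_gt0 k0.
  + by rewrite addnC.
  + by apply: gam_comm => //; apply: gamV.
  + apply: comm_swap; apply: (@swap3 i k j) => //; first exact: gamV.
    apply: (@comm_inv3 i k j) => //.
    exact: (@swap3 k i j).
Qed.
End Layer.

End HallSubgroups.

(** * Lyndon words and spanning of the layers *)

Section LyndonWords.
Variable A : finType.
Implicit Types (u v w x y z : seq A) (a b : A).

Definition lta a b := (enum_rank a < enum_rank b)%N.

(* [dlt u v]: at the first position where [u] and [v] differ, [u] is smaller;
   in particular neither word is a prefix of the other. *)
Fixpoint dlt u v : bool :=
  match u, v with
  | a :: u', b :: v' => lta a b || (a == b) && dlt u' v'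
  | _, _ => false
  end.

Fixpoint ltw u v : bool :=
  match u, v with
  | a :: u', b :: v' => lta a b || (a == b) && ltw u' v'
  | [::], _ :: _ => true
  | _, [::] => false
  end.

Lemma lta_irr a : lta a a = false. Proof. exact: ltnn. Qed.

Lemma lta_trans a b c : lta a b -> lta b c -> lta a c.
Proof. exact: ltn_trans. Qed.

Lemma lta_total a b : [|| lta a b, a == b | lta b a].
Proof. by rewrite /lta; case: ltngtP => [||/val_inj/enum_rank_inj->]; rewrite ?eqxx ?orbT. Qed.

Lemma dlt_irr u : dlt u u = false.
Proof. by elim: u => //= a u ->; rewrite lta_irr andbF. Qed.

Lemma dlt_trans u v w : dlt u v -> dlt v w -> dlt u w.
Proof.
elim: u v w => [|a u IHu] [|b v] [|c w] //=.
move=> /orP[ab|/andP[/eqP-> uv]] /orP[bc|/andP[/eqP<- vw]].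
- by rewrite (lta_trans ab bc).
- by rewrite ab.
- by rewrite bc.
- by rewrite eqxx (IHu _ _ uv vw) orbT.
Qed.

Lemma dlt_catr u v x y : dlt u v -> dlt (u ++ x) (v ++ y).
Proof.
elim: u v => [|a u IHu] [|b v] //= /orP[->//|/andP[-> /IHu->]]; by rewrite orbT.
Qed.

Lemma dlt_catl z u v : dlt (z ++ u) (z ++ v) = dlt u v.
Proof. by elim: z => //= a z ->; rewrite lta_irr eqxx. Qed.

Lemma dlt_ltw u v : dlt u v -> ltw u v.
Proof.
by elim: u v => [|a u IHu] [|b v] //= /orP[->//|/andP[-> /IHu->]]; rewrite orbT.
Qed.

Lemma ltw_dlt u v : ltw u v -> dlt u v \/ exists2 s, s != [::] & v = u ++ s.
Proof.
elim: u v => [|a u IHu] [|b v] //=; first by right; exists (b :: v).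
move=> /orP[->|/andP[/eqP-> /IHu[->|[s s0 ->]]]]; first by left.
  by left; rewrite eqxx orbT.
by right; exists s.
Qed.

Lemma ltw_irr u : ltw u u = false.
Proof. by elim: u => //= a u ->; rewrite lta_irr andbF. Qed.

Lemma ltw_trans u v w : ltw u v -> ltw v w -> ltw u w.
Proof.
elim: u v w => [|a u IHu] [|b v] [|c w] //=.
move=> /orP[ab|/andP[/eqP-> uv]] /orP[bc|/andP[/eqP<- vw]].
- by rewrite (lta_trans ab bc).
- by rewrite ab.
- by rewrite bc.
- by rewrite eqxx (IHu _ _ uv vw) orbT.
Qed.

Lemma ltw_total u v : [|| ltw u v, u == v | ltw v u].
Proof.
elim: u v => [|a u IHu] [|b v] //=; rewrite eqseq_cons.
by case/or3P: (lta_total a b) => [->|/eqP->|->]; rewrite ?eqxx ?lta_irr ?orbT //=.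
Qed.

Lemma ltw_catr u v s : ltw u v -> ltw u (v ++ s).
Proof.
by elim: u v => [|a u IHu] [|b v] //= /orP[->//|/andP[-> /IHu->]]; rewrite orbT.
Qed.

Lemma ltw_self_cat u s : s != [::] -> ltw u (u ++ s).
Proof. by elim: u => [|a u IHu] /=; [case: s|rewrite eqxx => /IHu->; rewrite orbT]. Qed.

Definition lew u v := (u == v) || dlt u v.

Lemma lew_dlt_trans u v w : lew u v -> dlt v w -> dlt u w.
Proof. by case/orP=> [/eqP->//|]; apply: dlt_trans. Qed.

Lemma dlt_lew_trans u v w : dlt u v -> lew v w -> dlt u w.
Proof. by move=> uv /orP[/eqP<-//|]; apply: dlt_trans. Qed.

Lemma lew_trans u v w : lew u v -> lew v w -> lew u w.
Proof.
by move=> uv /orP[/eqP<-//|/(lew_dlt_trans uv) uw]; rewrite /lew uw orbT.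
Qed.

Lemma lew_catr u v x : lew u v -> lew (u ++ x) (v ++ x).
Proof. by case/orP=> [/eqP->|/(@dlt_catr _ _ x x) h]; rewrite /lew ?eqxx ?h ?orbT. Qed.

(** A proper suffix is shorter than [w], so [w] cannot be its prefix, and [dlt] says here the same
    as the lexicographic order. *)
Definition lyndon w := w != [::] /\
  forall u v, w = u ++ v -> u != [::] -> v != [::] -> dlt w v.

(** If [u] is not already smaller at a letter, then [v = u ++ s]; cancelling [u] leaves the
    comparison of [v] with its proper suffix [s]. *)
Lemma lyndon_dlt_cat u v : u != [::] -> lyndon v -> ltw u v -> dlt (u ++ v) v.
Proof.
move=> u0 [v0 vL] /ltw_dlt[uv|[s s0 vE]].
  by rewrite -{2}[v]cats0; apply: dlt_catr.
by rewrite {2}vE dlt_catl; apply: vL vE _ s0.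
Qed.

Lemma cat_eq_cases u v x y : u ++ v = x ++ y ->
  [\/ exists2 s, s != [::] & u = x ++ s /\ y = s ++ v, u = x /\ v = y
    | exists2 s, s != [::] & x = u ++ s /\ v = s ++ y].
Proof.
elim: u x => [|a u IHu] [|b x] /=.
- by move=> ->; constructor 2.
- by move=> ->; constructor 3; exists (b :: x).
- by move=> <-; constructor 1; exists (a :: u).
- move=> [-> /IHu[[s s0 [-> ->]]|[-> ->]|[s s0 [-> ->]]]].
  + by constructor 1; exists s.
  + by constructor 2.
  + by constructor 3; exists s.
Qed.

Lemma lyndon_cat u v : lyndon u -> lyndon v -> ltw u v -> lyndon (u ++ v).
Proof.
move=> [u0 uL] Lv uv; have uvv := lyndon_dlt_cat u0 Lv uv.
have [v0 vL] := Lv; split; first by case: u u0 {uL uv uvv}.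
move=> x y /cat_eq_cases[[s s0 [uE ->]]|[_ <-//]|[s s0 [_ vE]]] x0 y0.
  exact/dlt_catr/(uL _ _ uE).
exact/(dlt_trans uvv)/(vL _ _ vE).
Qed.

Inductive btree := Leaf of A | Node of btree & btree.
HB.instance Definition _ := gen_eqMixin btree.

Fixpoint word (t : btree) : seq A :=
  match t with Leaf a => [:: a] | Node t1 t2 => word t1 ++ word t2 end.

Definition tlen t := size (word t).

(* Standard bracketings: [word t] is a Lyndon word and the right subtree of [t]
   spells its smallest proper suffix. *)
Fixpoint good (t : btree) : bool :=
  match t with
  | Leaf _ => true
  | Node t1 t2 => [&& good t1, good t2, ltw (word t1) (word t2) &
      if t1 is Node _ y then ~~ ltw (word y) (word t2) else true]
  end.

Lemma word_neq0 t : word t != [::].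
Proof. by elim: t => //= t1 IH1 t2 _; case: (word t1) IH1. Qed.

Lemma tlen_gt0 t : (0 < tlen t)%N.
Proof. by rewrite /tlen lt0n size_eq0 word_neq0. Qed.

Lemma tlenN t1 t2 : tlen (Node t1 t2) = (tlen t1 + tlen t2)%N.
Proof. by rewrite /tlen size_cat. Qed.

Lemma good_lyndon t : good t -> lyndon (word t).
Proof.
elim: t => [a _|t1 IH1 t2 IH2 /and4P[/IH1 L1 /IH2 L2 t12 _]]; last exact: lyndon_cat.
split=> // u v /(congr1 size); rewrite size_cat /=.
by case: u v => [|? [|? u]] [|? v].
Qed.

(** A cut inside the right factor is settled because that factor is Lyndon. A cut inside the left
    factor is settled by induction and the last condition of [good]. *)
Lemma good_min_suffix t p s : good t -> p != [::] -> s != [::] ->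
  word t = p ++ s ->
  if t is Node _ t2 then s = word t2 \/ ltw (word t2) s else False.
Proof.
elim: t p s => [a|u IHu v _] p s.
  by case: p => [|? [|? ?]]; case: s.
move=> /and4P[gu gv uv uyv] p0 s0 /cat_eq_cases[[q q0 [uE ->]]|[_ vE]|[q q0 [_ vE]]].
- have := IHu _ _ gu p0 q0 uE; case: u {IHu gu uv uE} uyv => // _ y yv yq; right.
  suff [->|/ltw_catr->//] : q = word v \/ ltw (word v) q.
    exact/ltw_self_cat/word_neq0.
  case/or3P: (ltw_total (word y) (word v)) yv => [->//|/eqP<-//|vy _].
  by right; case: yq => [->//|]; apply: ltw_trans.
- by left.
- by right; apply/dlt_ltw/(proj2 (good_lyndon gv) _ _ vE).
Qed.

(** The right factor is recovered from the word as its smallest proper suffix, so Lyndon words can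
    serve as indices of standard bracketings. *)
Lemma word_inj t t' : good t -> good t' -> word t = word t' -> t = t'.
Proof.
have LN a (u v : btree) : word (Leaf a) = word (Node u v) -> False.
  move=> /(congr1 size); rewrite -!/(tlen _) tlenN => e.
  by have := leq_add (tlen_gt0 u) (tlen_gt0 v); rewrite -e.
elim: t t' => [a|u IHu v IHv] [a'|u' v'] gt gt'.
- by case=> ->.
- by move/LN.
- by move/esym/LN.
move=> e; have vv' : word v = word v'.
  case: (good_min_suffix gt (word_neq0 _) (word_neq0 _) e) => // h1.
  case: (good_min_suffix gt' (word_neq0 _) (word_neq0 _) (esym e)) => // h2.
  by have := ltw_trans h1 h2; rewrite ltw_irr.
move: gt gt' => /and4P[gu gv _ _] /and4P[gu' gv' _ _].
rewrite (IHv v') // (IHu u') //; move: e => /= /cat_eq_cases.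
have cyc s : s != [::] -> word v <> s ++ word v.
  move=> s0 /(congr1 size)/eqP; rewrite size_cat -{1}[size _]add0n eqn_add2r.
  by rewrite eq_sym size_eq0 (negPf s0).
by rewrite -vv' => -[[s /cyc s0 []]|[]//|[s /cyc s0 []]].
Qed.

(** The termination measure of Jacobi rewriting: it drops when [w] is replaced by a larger word of
    length [n]. *)
Definition above n w := #|[set t : n.-tuple A | dlt w t]|.

Lemma above_lt n w w' : size w' = n -> dlt w w' -> (above n w' < above n w)%N.
Proof.
move=> nw' ww'; apply/proper_card/properP; split.
  by apply/fintype.subsetP => t; rewrite !inE; apply: dlt_trans.
exists (Tuple (introT eqP nw')); by rewrite !inE // dlt_irr.
Qed.

(** Finiteness comes from [word_inj]: each of the finitely many words of length [n] has at most one
    standard bracketing. *)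
Lemma exists_good_list (n : nat) : exists s : seq btree,
  uniq s /\ forall t, (t \in s) = good t && (tlen t == n).
Proof.
pose P (w : n.-tuple A) t := good t /\ word t = w.
pose f (w : n.-tuple A) : option btree :=
  if pselect (exists t, P w t) is left h then Some (projT1 (cid h)) else None.
have fP (w : n.-tuple A) t : f w = Some t <-> P w t.
  rewrite /f; case: pselect => [h|h]; last by split=> // Pt; case: h; exists t.
  case: (cid h) => t' [gt' wt'] /=; split=> [[<-//]|[gt wt]].
  by congr Some; apply: word_inj; rewrite // wt wt'.
exists (undup (pmap f (enum {: n.-tuple A}))); split; first exact: undup_uniq.
move=> t; rewrite mem_undup mem_pmap; apply/mapP/andP => [[w _ /esym/fP[gt wt]]|].
  by rewrite /tlen wt size_tuple.
move=> [gt /eqP nt]; exists (Tuple (introT eqP nt)); first by rewrite mem_enum.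
by apply/esym/fP.
Qed.

Lemma exists_min_word (s : seq btree) (P : pred btree) : has P s ->
  exists2 t, t \in s & P t /\
    forall t', t' \in s -> P t' -> ~~ ltw (word t') (word t).
Proof.
elim: s => //= u s IHs; have [/IHs[t ts [Pt tmin]] _|/hasPn sP] := boolP (has P s).
  have [/andP[Pu ut]|ut] := boolP (P u && ltw (word u) (word t)).
    exists u; rewrite ?mem_head //; split=> // t'; rewrite inE => /predU1P[->|t's Pt'].
      by rewrite ltw_irr.
    by apply: contra (tmin _ t's Pt') => /ltw_trans/(_ ut).
  exists t; rewrite ?inE ?ts ?orbT //; split=> // t'; rewrite inE => /predU1P[->|].
    by move=> Pu; rewrite Pu in ut.
  exact: tmin.
rewrite orbF => Pu; exists u; rewrite ?mem_head //; split=> // t'.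
rewrite inE => /predU1P[->|/sP/negPf->//].
by rewrite ltw_irr.
Qed.
End LyndonWords.

(** * Rewriting commutators into standard brackets *)

Section Spanning.
Local Open Scope group_scope.
Local Open Scope classical_set_scope.
Variables (A : finType) (R : binomialRingType) (c : nat) (G : hallGroupType R c).
Variable x : A -> G.
Local Notation "g ^^ l" := (@hpow R c G g l) (at level 29).
Local Notation gam := (@gam R c G).

Fixpoint gval (t : btree A) : G :=
  match t with Leaf a => x a | Node t1 t2 => [~ gval t1, gval t2] end.

Lemma gval_gam t : gam (tlen t) (gval t).
Proof.
move: t; apply: btree_ind => [a|t1 IH1 t2 IH2]; first exact: gam1.
by rewrite tlenN; apply: gam_comm; rewrite ?tlen_gt0.
Qed.

(** Keeping the lower bound [w] records that rewriting never decreases the word, which is what makes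
    the induction of [comm_good] close up. *)
Definition upper n w : set G := hspan ([set g | exists t : btree A,
  [/\ good t, tlen t = n, lew w (word t) & g = gval t]] `|` gam n.+1).

Lemma upper_closed n w : hall_closed (upper n w). Proof. exact: hspan_closed. Qed.

Lemma upper_gam n w : gam n.+1 `<=` upper n w.
Proof. by move=> g ng; apply: hspan_gen; right. Qed.

Lemma upper_le n w w' : lew w w' -> upper n w' `<=` upper n w.
Proof.
move=> ww'; apply: hspan_min; first exact: upper_closed.
move=> g [[t [gt nt wt gE]]|ng]; last exact: upper_gam.
by apply: hspan_gen; left; exists t; split=> //; apply: lew_trans wt.
Qed.

Lemma comm_upper i j k w w' g : (0 < j)%N -> (0 < i)%N -> (i + j)%N = k ->
  gam j g ->
  (forall t, good t -> tlen t = i -> lew w (word t) -> upper k w' [~ gval t, g]) ->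
  forall s, upper i w s -> upper k w' [~ s, g].
Proof.
move=> j0 i0 ijk jg H; apply: (@comm_hspan _ _ _ k _ (upper_closed _ _) _ i j) => //.
- exact: upper_gam.
- by move=> h [[t [gt <- wt ->]]|/gamS//]; exact: gval_gam.
- move=> h [[t [gt nt wt ->]]|ih]; first exact: H.
  by apply: upper_gam; rewrite -ijk -addSn; apply: gam_comm.
Qed.

(* Jacobi rewriting terminates: a bracket that is not standard is replaced by
   brackets with a larger word, or the same word and a shorter left factor. *)
Lemma comm_good n t1 t2 : good t1 -> good t2 -> ltw (word t1) (word t2) ->
  (tlen t1 + tlen t2)%N = n ->
  upper n (word t1 ++ word t2) [~ gval t1, gval t2].
Proof.
elim/ltn_ind: n t1 t2 => n IHn t1 t2.
have [m] := ubnP (above n (word t1 ++ word t2)).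
elim: m t1 t2 => // m IHm t1 t2; rewrite ltnS.
have [k] := ubnP (tlen t1).
elim: k t1 t2 => // k IHk t1 t2 t1k t12m g1 g2 t12 n12.
have [gN|gN] := boolP (good (Node t1 t2)).
  apply: hspan_gen; left; exists (Node t1 t2); split=> //; first by rewrite tlenN.
  by rewrite /lew eqxx.
case: t1 t1k t12m g1 t12 n12 gN => [a|u y]; first by rewrite /= => _ _ _ -> _; rewrite g2.
set W := word _ ++ word _ => uyk Wm guy uyv n_eq gN.
(* Only the last condition of [good] can fail here. *)
have yv : ltw (word y) (word t2) by apply: contraR gN => yv; apply/and4P.
have Luy := good_lyndon guy; have [gu gy uy] : [/\ good u, good y & ltw (word u) (word y)].
  by move/and4P: guy => [].
have u0 := tlen_gt0 u; have y0 := tlen_gt0 y; have v0 := tlen_gt0 t2.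
have uv := ltw_trans uy yv.
have nE : (tlen u + tlen y + tlen t2)%N = n by rewrite -tlenN.
have gt2 := gval_gam t2.
have swap w g h : upper n w [~ g, h] -> upper n w [~ h, g].
  by rewrite -(invgR g h); have [_ _ V _] := upper_closed n w; apply: V.
have IH w t t' : dlt W w -> word t ++ word t' = w -> size w = n ->
    good t -> good t' -> ltw (word t) (word t') -> upper n W [~ gval t, gval t'].
  move=> Ww wE nw gt gt' tt'; apply: (@upper_le _ _ w); first by rewrite /lew Ww orbT.
  rewrite -wE; apply: IHm => //; last by rewrite /tlen -size_cat wE.
  by rewrite wE; apply: leq_trans Wm; apply: above_lt.
rewrite -[gval (Node u y)]/([~ gval u, gval y]).
apply: (@comm_jacobi _ _ _ n _ (upper_closed _ _) _ (tlen u) (tlen y) (tlen t2));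
  rewrite //; try exact: gval_gam; first exact: upper_gam.
(* The term [[[y, v], u]], where [v] is [t2]: brackets [t] occurring in [[y, v]] have a word at
   least [yv]. Equality gives back [W] with the shorter left factor [u]; otherwise [u t] is larger
   than [W]. *)
- have := IHn (tlen y + tlen t2)%N _ y t2 gy g2 yv erefl.
  rewrite -{1}nE -addnA -{1}[(_ + tlen t2)%N]add0n ltn_add2r => /(_ u0).
  have yvu : (tlen y + tlen t2 + tlen u)%N = n by rewrite -nE addnC addnA.
  have yv0 : (0 < tlen y + tlen t2)%N by rewrite addn_gt0 y0.
  move=> hh; refine (comm_upper u0 yv0 yvu (gval_gam u) _ hh).
  move=> t gt nt yvt; apply: swap.
  have ut : ltw (word u) (word t).
    apply: ltw_trans uy _; case/orP: yvt => [/eqP<-|/dlt_ltw].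
      exact/ltw_self_cat/word_neq0.
    by apply/ltw_trans/ltw_self_cat/word_neq0.
  have nut : (tlen u + tlen t)%N = n by rewrite nt addnA.
  case/orP: yvt => [/eqP yvt|yvt].
    have -> : W = word u ++ word t by rewrite -yvt /W /= catA.
    apply: IHk => //.
    + apply: leq_trans (_ : tlen (Node u y) <= k)%N => //.
      by rewrite tlenN -addn1 leq_add2l.
    + by rewrite -yvt catA.
  apply: (IH (word u ++ word t)) => //; last by rewrite size_cat.
  by rewrite /W /= -catA dlt_catl.
(* The term [[[v, u], y]]: now [t] has a word at least [uv]. Both [t y], bounded below by [uvy], and
   [y t] exceed [W = uyv]: the first because [yv < vy], the second because [uy < y]. *)
- have := IHn (tlen u + tlen t2)%N _ u t2 gu g2 uv erefl.
  rewrite -{1}nE addnAC -{1}[(_ + tlen t2)%N]addn0 ltn_add2l => /(_ y0) h.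
  have {}h : upper (tlen u + tlen t2) (word u ++ word t2) [~ gval t2, gval u].
    rewrite -(invgR (gval u)); have [_ _ V _] := upper_closed (tlen u + tlen t2) (word u ++ word t2).
    exact: V.
  have uvy : (tlen u + tlen t2 + tlen y)%N = n by rewrite -nE addnAC.
  have uv0 : (0 < tlen u + tlen t2)%N by rewrite addn_gt0 u0.
  refine (comm_upper y0 uv0 uvy (gval_gam y) _ h).
  move=> t gt nt uvt.
  have nty : (tlen t + tlen y)%N = n by rewrite nt addnAC.
  case/or3P: (ltw_total (word t) (word y)) => [ty|/eqP/word_inj ty|yt].
  + apply: (IH (word t ++ word y)) => //; last by rewrite size_cat.
    apply: dlt_lew_trans (lew_catr (word y) uvt).
    rewrite /W /= -!catA dlt_catl.
    rewrite -[_ ++ _]cats0; apply: dlt_catr; apply: lyndon_dlt_cat => //.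
      exact: word_neq0.
    exact: good_lyndon.
  + by rewrite ty // commgg; have [] := upper_closed n W.
  + apply: swap; apply: (IH (word y ++ word t)) => //; last by rewrite size_cat addnC.
    apply: dlt_catr; apply: (proj2 Luy) => //; exact: word_neq0.
Qed.
End Spanning.

(** * Normal forms in the layers of a generated Hall group *)

Section Generation.
Local Open Scope group_scope.
Local Open Scope classical_set_scope.
Variables (A : finType) (R : binomialRingType) (c : nat) (G : hallGroupType R c).
Variable x : A -> G.
Local Notation "g ^^ l" := (@hpow R c G g l) (at level 29).
Local Notation gam := (@gam R c G).
Local Notation gval := (@gval A R c G x).

Definition bspan n : set G := hspan ([set g | exists t : btree A,
  [/\ good t, tlen t = n & g = gval t]] `|` gam n.+1).

Lemma bspan_closed n : hall_closed (bspan n). Proof. exact: hspan_closed. Qed.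

Lemma bspan_gam n : gam n.+1 `<=` bspan n.
Proof. by move=> g ng; apply: hspan_gen; right. Qed.

Lemma upper_bspan n w : @upper A R c G x n w `<=` bspan n.
Proof.
apply: hspan_min; first exact: bspan_closed.
move=> g [[t [gt nt _ gE]]|ng]; last exact: bspan_gam.
by apply: hspan_gen; left; exists t.
Qed.

Lemma comm_good_bspan n t t' : good t -> good t' -> (tlen t + tlen t')%N = n ->
  bspan n [~ gval t, gval t'].
Proof.
move=> gt gt' n_eq; case/or3P: (ltw_total (word t) (word t')) => [tt'|/eqP tt'|tt'].
- by apply: upper_bspan (comm_good x gt gt' tt' n_eq).
- by rewrite (word_inj gt gt' tt') commgg; have [] := bspan_closed n.
- rewrite -(invgR (gval t')); have [_ _ V _] := bspan_closed n; apply: V.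
  by apply: upper_bspan (comm_good x gt' gt tt' _); rewrite addnC.
Qed.

Hypothesis x_gen : forall g, hspan (range x) g.

(** A generator of the next layer is a commutator of an element of the previous layer with an
    arbitrary element. Both are expanded into brackets, by induction and by [x_gen], and linearity
    leaves the commutators of two brackets. *)
Lemma gam_bspan n : (0 < n)%N -> gam n `<=` bspan n.
Proof.
have all1 g : bspan 1 g.
  apply: (hspan_min (bspan_closed 1)) (x_gen g) => _ [a _ <-].
  by apply: hspan_gen; left; exists (Leaf a).
case: n => // n _; elim: n => [|n IHn]; first by move=> g _; exact: all1.
have Tg := bspan_closed n.+2; have [T1 TM TV TX] := Tg.
have gam_gen i h : (0 < i)%N -> ([set g | exists t : btree A,
    [/\ good t, tlen t = i & g = gval t]] `|` gam i.+1) h -> gam i h.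
  by move=> i0 [[t [gt <- ->]]|/gamS//]; exact: gval_gam.
apply: (hspan_min Tg) => g /= gn; apply: (gn (bspan n.+2)); split; first by split.
move=> {gn} _ [g' [h [g'n ->]]].
have {}g'n : bspan n.+1 g' by apply: IHn; apply: hspan_gen.
refine (comm_hspan Tg (@bspan_gam n.+2) (ltn0Sn n) (ltn0Sn 0) (addn1 n.+1) _ _ _ g'n).
- by move=> k; exact: gam_gen.
- exact: gam1.
move=> k [[t [gt nt ->]]|nk]; last exact/bspan_gam/gam_comm1.
rewrite -(invgR h); apply: (TV).
refine (comm_hspan Tg (@bspan_gam n.+2) (ltn0Sn 0) (ltn0Sn n) (add1n n.+1) _ _ _ (all1 h)).
- by move=> l; exact: gam_gen.
- by rewrite -nt; exact: gval_gam.
move=> l [[t' [gt' nt' ->]]|nl].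
  by apply: comm_good_bspan; rewrite // nt nt'.
apply: bspan_gam; rewrite -addn2 addnC; apply: gam_comm => //.
by rewrite -nt; exact: gval_gam.
Qed.

Section Coefficients.
Variables (I : eqType) (n : nat) (e : I -> G).
Hypotheses (n0 : (0 < n)%N) (en : forall i, gam n (e i)).
Local Notation N := (gamN G n.+1).
Local Notation P s al := (\prod_(i <- s) e i ^^ al i).

Lemma gam_prod s al : gam n (P s al).
Proof. by apply: closed_prod; [exact: gam_closed|move=> i _; apply: gamX]. Qed.

Lemma prodD s (al be : I -> R) : exists2 r, gam n.+1 r &
  P s al * P s be = P s (fun i => al i + be i)%R * r.
Proof.
elim: s => [|i s [r rn IHs]].
  by exists 1; rewrite ?big_nil ?mulg1 //; have [] := gam_closed G n.+1.
rewrite !big_cons hpowD.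
set p := P s al; set q := P s be; set ei := e i ^^ be i.
exists (r * [~ p, ei] ^ q).
  by apply: gamM => //; apply/gam_conj/gam_comm1/gam_prod.
rewrite -/p -/q in IHs.
rewrite -!mulgA; congr (_ * _).
have -> : p * (ei * q) = ei * (p * q) * [~ p, ei] ^ q.
  by rewrite /commg /conjg !mulgA !mulgK mulgV mul1g.
by rewrite IHs !mulgA.
Qed.

Lemma prodN s (al : I -> R) : exists2 r, gam n.+1 r &
  (P s al)^-1 = P s (fun i => - al i)%R * r.
Proof.
have [r rn e1] := prodD s al (fun i => - al i)%R; exists r^-1; first exact: gamV.
apply: (@mulgI _ (P s al)); rewrite mulgV mulgA e1.
rewrite big1 ?mul1g ?mulgV // => i _; by rewrite subrr hpow0.
Qed.

Lemma prodX s (al : I -> R) l : exists2 r, gam n.+1 r &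
  (P s al) ^^ l = P s (fun i => al i * l)%R * r.
Proof.
elim: s => [|i s [r rn IHs]].
  by exists 1; rewrite ?big_nil ?hpow1g ?mulg1 //; have [] := gam_closed G n.+1.
rewrite !big_cons; set p := P s al.
have NH : hall_closed (normal_set N) := gam_closed G n.+1.
have [|r' r'n e1] := @hpow_mul2 _ _ _ _ NH (e i ^^ al i) p l.
  by apply: gam_comm1 => //; apply: gamX.
exists (r * r'^-1); first by apply/gamM/gamV.
by rewrite mulgA -(mulgA (_ ^^ _)) -IHs -hpowM e1 mulgK.
Qed.

(** Modulo [gam n.+1] the layer is a module over [R]; collecting factors leaves one exponent for
    each index. *)
Lemma span_coef s g : uniq s ->
  hspan ([set h | exists2 i, i \in s & h = e i] `|` gam n.+1) g ->
  exists al : I -> R, exists2 r, gam n.+1 r & g = P s al * r.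
Proof.
move=> us; have [r1 rM rV rX] := gam_closed G n.+1.
have P0 al : (forall i, i \in s -> al i = 0%R) -> P s al = 1.
  by move=> al0; rewrite big_seq big1 // => i is_; rewrite al0 // hpow0.
elim=> {g} [g [[i is_ ->]|gn]||g h _ [al [r rn ->]] _ [be [r' r'n ->]]
    |g _ [al [r rn ->]]|g l _ [al [r rn ->]]].
- exists (fun j => (j == i)%:R%R), 1; rewrite ?mulg1 //.
  elim: s us is_ {P0} => //= j s IHs /andP[js us]; rewrite inE big_cons.
  case: eqVneq => [ij _|ij /= is_].
    rewrite -ij hpow1 big_seq big1 ?mulg1 // => k ks; case: eqP => [ki|_]; last exact: hpow0.
    by rewrite ki ij in ks; rewrite ks in js.
  by rewrite -IHs // hpow0 mul1g.
- by exists (fun=> 0%R), g => //; rewrite P0 ?mul1g.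
- by exists (fun=> 0%R), 1 => //; rewrite P0 ?mul1g.
- have [r'' r''n e1] := prodD s al be; exists (fun i => al i + be i)%R.
  exists (r'' * r ^ P s be * r'); first by apply: (rM) => //; apply/rM/gam_conj.
  by rewrite /conjg !mulgA -e1 !mulgK.
- have [r'' r''n e1] := prodN s al; exists (fun i => - al i)%R.
  exists (r^-1 ^ P s (fun i => - al i)%R * r'').
    by apply: (rM) => //; apply/gam_conj/rV.
  by rewrite invgM e1 /conjg !mulgA mulgV mul1g.
- have [r'' r''n e1] := prodX s al l; exists (fun i => al i * l)%R.
  have /(@hpow_cong _ _ _ N (gam_closed G n.+1) _ _ l) :
      normal_set N ((P s al)^-1 * (P s al * r)) by rewrite mulKg.
  set h := _^-1 * _ => hn; exists (r'' * h); first exact: (rM).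
  by rewrite /h mulgA -e1 mulVKg.
Qed.
End Coefficients.

Lemma gam_coef n g : (0 < n)%N -> gam n g ->
  exists (s : seq (btree A)) (al : btree A -> R),
    [/\ uniq s, forall t, t \in s -> good t /\ tlen t = n &
    exists2 r, gam n.+1 r & g = \prod_(t <- s) gval t ^^ al t * r].
Proof.
move=> n0 gn; have [s [us sP]] := exists_good_list A n.
have sn t : t \in s -> good t /\ tlen t = n by rewrite sP => /andP[-> /eqP].
(* The default value 1 puts [e t] into [gam n] for every tree, as [span_coef] demands. *)
pose e t := if t \in s then gval t else 1.
have en t : gam n (e t).
  rewrite /e; case: ifP => [/sn[_ <-]|_]; first exact: gval_gam.
  by have [] := gam_closed G n.
have [] := @span_coef _ n e n0 en s g us.
  apply: hspan_min (gam_bspan n0 gn); first exact: hspan_closed.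
  move=> h [[t [gt nt hE]]|hn]; apply: hspan_gen; last by right.
  by left; exists t; rewrite ?/e sP gt nt eqxx.
move=> al [r rn ->]; exists s, al; split=> //; exists r => //.
by congr (_ * _); apply: eq_big_seq => t ts; rewrite /e ts.
Qed.

End Generation.

(** * Filtered rings and polynomial sequences *)

Section FilteredRing.
Local Open Scope ring_scope.
Variables (E : pzRingType) (J : nat -> E -> Prop).

Record ring_filtration : Prop := RingFiltration {
  fil0 : forall i, J i 0;
  filD : forall i x y, J i x -> J i y -> J i (x + y);
  filN : forall i x, J i x -> J i (- x);
  filM : forall i j x y, J i x -> J j y -> J (i + j) (x * y);
  filS : forall i x, J i.+1 x -> J i x;
  fil_one : J 0 1
}.

Hypothesis JF : ring_filtration.

Lemma filB i x y : J i x -> J i y -> J i (x - y).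
Proof. by move=> xi yi; apply: (filD JF xi (filN JF yi)). Qed.

Lemma fil_le i j x : (i <= j)%N -> J j x -> J i x.
Proof. by move=> /subnK <-; elim: (j - i)%N => // k IHk /(filS JF). Qed.

Lemma filMn i x n : J i x -> J i (x *+ n).
Proof.
move=> xi; elim: n => [|n IHn]; first exact: fil0 JF _.
by rewrite mulrS; apply: (filD JF).
Qed.

Lemma fil_sum (I : Type) (r : seq I) (F : I -> E) i :
  (forall k, J i (F k)) -> J i (\sum_(k <- r) F k).
Proof.
by move=> FJ; apply: big_ind => // [|x y]; [exact: fil0|exact: filD].
Qed.

Section Differences.
Implicit Types (f g : nat -> E).

Definition diff f n := f n.+1 - f n.

(** Polynomial sequences with respect to a filtration: each of the first [m] differences gains one
    step. *)
Fixpoint pol m k f : Prop :=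
  (forall n, J k (f n)) /\ if m is m'.+1 then pol m' k.+1 (diff f) else True.

Lemma pol_val m k f n : pol m k f -> J k (f n).
Proof. by case: m => [|m] []. Qed.

Lemma pol_iter m k f n : pol m k f -> J (m + k) (iter m diff f n).
Proof.
elim: m k f => [|m IHm] k f; first by case.
by case=> _ /IHm; rewrite addnS iterSr.
Qed.

Lemma polS m k f : pol m.+1 k f -> pol m k f.
Proof. by elim: m k f => [|m IHm] k f [fk h]; split=> //; apply: IHm. Qed.

Lemma pol_wkS m k f : pol m k.+1 f -> pol m k f.
Proof.
elim: m k f => [|m IHm] k f [fk h].
  by split=> // n; apply: (filS JF).
by split=> [n|]; [apply: (filS JF)|apply: IHm].
Qed.

Lemma pol_wk m k f : pol m k f -> pol m 0 f.
Proof. by elim: k => // k IHk /pol_wkS. Qed.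

Lemma pol_shift m k f : pol m k f -> pol m k (fun n => f n.+1).
Proof.
elim: m k f => [|m IHm] k f [fk h]; split=> //.
exact: (IHm _ (diff f)).
Qed.

Lemma pol0 m k : pol m k (fun=> 0).
Proof.
elim: m k => [|m IHm] k; split=> //; try by move=> _; apply: (fil0 JF).
by rewrite (_ : diff _ = fun=> 0) //; apply: funext => n; rewrite /diff subrr.
Qed.

Lemma polC m k e : J k e -> pol m k (fun=> e).
Proof.
case: m => [|m] ek; split=> //.
rewrite (_ : diff _ = fun=> 0); first exact: pol0.
by apply: funext => n; rewrite /diff subrr.
Qed.

Lemma polD m k f g : pol m k f -> pol m k g -> pol m k (fun n => f n + g n).
Proof.
elim: m k f g => [|m IHm] k f g [fk h] [gk h']; split=> //;
  try by move=> n; apply: (filD JF).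
rewrite (_ : diff _ = fun n => diff f n + diff g n); first exact: IHm.
by apply: funext => n; rewrite /diff addrACA opprD.
Qed.

Lemma polN m k f : pol m k f -> pol m k (fun n => - f n).
Proof.
elim: m k f => [|m IHm] k f [fk h]; split=> //; try by move=> n; apply: (filN JF).
rewrite (_ : diff _ = fun n => - diff f n); first exact: IHm.
by apply: funext => n; rewrite /diff opprB addrC opprK.
Qed.

(** By the Leibniz rule for differences. *)
Lemma polM m k l f g : pol m k f -> pol m l g -> pol m (k + l) (fun n => f n * g n).
Proof.
elim: m k l f g => [|m IHm] k l f g pf pg; split=> //;
  try by move=> n; apply: (filM JF); apply: pol_val; eassumption.
rewrite (_ : diff _ = fun n => diff f n * g n.+1 + f n * diff g n).
  apply: polD.
    by rewrite -addSn; apply: IHm; [case: pf|apply/pol_shift/polS].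
  by rewrite -addnS; apply: IHm; [apply/polS|case: pg].
by apply: funext => n; rewrite /diff mulrBl mulrBr addrA subrK.
Qed.

Lemma iter_diff0 i f : (0 < i)%N -> (forall n, (n < i)%N -> f n = f 0%N) ->
  iter i diff f 0 = f i - f 0%N.
Proof.
elim: i f => // i IHi f _ fc; case: i IHi fc => [|i] IHi fc //.
rewrite iterSr IHi //; first by rewrite /diff (fc 1%N) // subrr subr0 (fc i.+1).
by move=> n ni; rewrite /diff !(fc n.+1) ?(fc n) ?(fc 1%N) // ltnS ltnW.
Qed.
End Differences.

(** * Leading terms of group elements in a filtered ring *)

Section Representation.
Variables (Q : groupType) (rho : Q -> E).
Hypotheses (rhoM : {morph rho : g h / (g * h)%g >-> g * h}) (rho1 : rho 1%g = 1).
Hypothesis rhoJ : forall g, J 1 (rho g - 1).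

Definition aug g := rho g - 1.

Definition lieb (x y : E) := x * y - y * x.

Lemma rho_aug g : rho g = 1 + aug g. Proof. by rewrite addrC subrK. Qed.

Lemma fil_rho g : J 0 (rho g).
Proof.
by rewrite rho_aug; apply: (filD JF (fil_one JF)); apply/(filS JF)/rhoJ.
Qed.

Lemma aug1 : aug 1%g = 0. Proof. by rewrite /aug rho1 subrr. Qed.

Lemma augM g h : aug (g * h)%g = aug g + aug h + aug g * aug h.
Proof.
rewrite /aug rhoM mulrBl mul1r -[RHS]addrA.
rewrite [rho h - 1 + _]addrC subrK mulrBr mulr1 [RHS]addrC addrA subrK //.
Qed.

Lemma fil_augM i g h : J i (aug g) -> J i (aug h) -> J i (aug (g * h)%g).
Proof.
move=> gi hi; rewrite augM; apply: (filD JF); first exact: (filD JF).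
by apply: fil_le (filM JF gi hi); apply: leq_addr.
Qed.

Lemma augV g : aug g^-1%g = - (rho g^-1%g * aug g).
Proof. by rewrite /aug mulrBr -rhoM mulVg rho1 mulr1 opprB. Qed.

Lemma fil_augV i g : J i (aug g) -> J i (aug g^-1%g).
Proof.
by move=> gi; rewrite augV; apply: (filN JF); have := filM JF (fil_rho g^-1%g) gi.
Qed.

Lemma fil_augX i g n : J i (aug g) -> J i (aug (g ^+ n)%g).
Proof.
move=> gi; elim: n => [|n IHn]; first by rewrite expg0 aug1; apply: fil0 JF _.
by rewrite expgS; apply: fil_augM.
Qed.

(** Factoring [rho (h * g)^-1] out of [rho [~ g, h] - 1] leaves [rho (g * h) - rho (h * g)], which
    is the Lie bracket of the augmentations. *)
Lemma augR g h :
  aug [~ g, h]%g = lieb (aug g) (aug h) + aug (g^-1 * h^-1)%g * lieb (aug g) (aug h).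
Proof.
have -> : lieb (aug g) (aug h) = rho (g * h)%g - rho (h * g)%g.
  have e a b : aug a * aug b = aug (a * b)%g - (aug a + aug b).
    by rewrite augM addrC addKr.
  by rewrite /lieb !e (addrC (aug h)) opprB addrA subrK /aug opprB addrA subrK.
rewrite -[X in X + _]mul1r -mulrDl -rho_aug mulrBr -!rhoM.
by rewrite /aug /commg /conjg !mulgA mulgVK mulVg rho1.
Qed.

Lemma fil_lieb i j x y : J i x -> J j y -> J (i + j) (lieb x y).
Proof.
by move=> xi yj; apply: filB; [|rewrite addnC]; apply: (filM JF).
Qed.

Lemma comm_lead i j g h : J i (aug g) -> J j (aug h) ->
  J (i + j).+1 (aug [~ g, h]%g - lieb (aug g) (aug h)).
Proof.
move=> gi hj; rewrite augR addrC addKr -add1n.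
by apply: (filM JF); [exact: rhoJ|exact: fil_lieb].
Qed.

Lemma fil_augR i j g h : J i (aug g) -> J j (aug h) -> J (i + j) (aug [~ g, h]%g).
Proof.
move=> gi hj; rewrite -[aug _](subrK (lieb (aug g) (aug h))).
by apply: (filD JF (filS JF (comm_lead gi hj))); apply: fil_lieb.
Qed.

Lemma mul_lead i g h : (0 < i)%N -> J i (aug g) -> J i (aug h) ->
  J i.+1 (aug (g * h)%g - (aug g + aug h)).
Proof.
move=> i0 gi hi; rewrite augM addrC addKr.
by apply: fil_le (filM JF gi hi); rewrite -addn1 leq_add2l.
Qed.

Lemma exp_lead i g n : (0 < i)%N -> J i (aug g) ->
  J i.+1 (aug (g ^+ n)%g - aug g *+ n).
Proof.
move=> i0 gi; elim: n => [|n IHn].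
  by rewrite expg0 aug1 subr0; apply: fil0 JF _.
rewrite expgS mulrS.
have := filD JF (mul_lead i0 gi (fil_augX n gi)) IHn.
move: (aug (g ^+ n)%g) => y; move: (aug g) (aug _) => z t.
by rewrite opprD !addrA subrK -addrA -opprD.
Qed.

Lemma fil_lcs i g : lcs Q i g -> J i.+1 (aug g).
Proof.
elim: i g => [|i IHi] g; first by move=> _; apply: rhoJ.
move=> gi; apply: (gi [set g | J i.+2 (aug g)])%classic; split.
  split=> /= [|x y|x]; [|exact: fil_augM|exact: fil_augV].
  by rewrite aug1; apply: fil0 JF _.
move=> _ [x [y [/IHi xi ->]]] /=; rewrite -addn1.
by apply: fil_augR => //; apply: rhoJ.
Qed.

(** By [exp_lead], the leading term of a [q]-th power is [q] times the old one, hence zero, so each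
    [q]-th power gains a filtration step. *)
Lemma fil_exp q i s g : (0 < i)%N -> (forall e : E, e *+ q = 0) ->
  J i (aug g) -> J (i + s) (aug (g ^+ (q ^ s))%g).
Proof.
move=> i0 q0 gi; elim: s => [|s IHs]; first by rewrite addn0 expg1.
rewrite expnS mulnC expgnA addnS -[aug _]subr0 -(q0 (aug (g ^+ (q ^ s))%g)).
by apply: exp_lead => //; rewrite addn_gt0 i0.
Qed.

(** By Pascal's rule, a difference trades [C(n, j.+1)] for [C(n, j)] up to a factor from [J 0], so
    the lost unit of [j] is gained in [k]. *)
Lemma pol_binX m k j g : J (j + k) (aug g) ->
  pol m k (fun n => aug (g ^+ 'C(n, j))%g).
Proof.
elim: m k j g => [|m IHm] k j g gjk.
  by split=> // n; apply: fil_augX; apply: fil_le gjk; apply: leq_addl.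
case: j gjk => [|j] gjk.
  rewrite (_ : (fun n => _) = fun=> aug g); first exact: polC.
  by apply: funext => n; rewrite bin0.
split=> [n|]; first by apply: fil_augX; apply: fil_le gjk; apply: leq_addl.
rewrite (_ : diff _ = fun n => rho (g ^+ 'C(n, j.+1))%g * aug (g ^+ 'C(n, j))%g).
  rewrite -[k.+1]add0n; apply: polM; last by apply: IHm; rewrite addnS -addSn.
  rewrite (_ : (fun n => _) = fun n => 1 + aug (g ^+ 'C(n, j.+1))%g).
    by apply: polD; [apply/polC/(fil_one JF)|apply/pol_wk/IHm/gjk].
  by apply: funext => n; rewrite rho_aug.
apply: funext => n; rewrite /diff binS expgnDr /aug rhoM mulrBr mulr1.
by rewrite opprB addrA subrK.
Qed.

Definition gpol m (u : nat -> Q) := pol m 0 (fun n => rho (u n)).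

Lemma gpolC m g : gpol m (fun=> g).
Proof. by apply/polC/fil_rho. Qed.

Lemma gpolM m u v : gpol m u -> gpol m v -> gpol m (fun n => (u n * v n)%g).
Proof.
move=> mu mv; rewrite /gpol (_ : (fun n => _) = fun n => rho (u n) * rho (v n)).
  exact: polM mu mv.
by apply: funext => n; rewrite rhoM.
Qed.

Lemma gpolV m u : gpol m u -> gpol m (fun n => (u n)^-1%g).
Proof.
elim: m => [|m IHm] mu; first by split=> // n; apply: fil_rho.
split=> [n|]; first exact: fil_rho.
have {}IHm := IHm (polS mu).
rewrite (_ : diff _ = fun n =>
  - (rho (u n.+1)^-1%g * diff (fun n => rho (u n)) n * rho (u n)^-1%g)).
  apply: polN; rewrite -[1%N]addn0; apply: polM (IHm).
  by rewrite -[1%N]add0n; apply: polM; [exact: (pol_shift IHm)|case: mu].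
apply: funext => n; rewrite /diff mulrBr mulrBl -!rhoM mulVg mulgK.
by rewrite mul1g opprB.
Qed.

Lemma gpol_prod m (I : eqType) (r : seq I) (u : I -> nat -> Q) :
  (forall i, i \in r -> gpol m (u i)) -> gpol m (fun n => \prod_(i <- r) u i n)%g.
Proof.
elim: r => [|i r IHr] ur.
  rewrite (_ : (fun n => _) = fun=> 1%g); first exact: gpolC.
  by apply: funext => n; rewrite big_nil.
rewrite (_ : (fun n => _) = fun n => (u i n * \prod_(i <- r) u i n)%g).
  by apply: gpolM; [apply/ur/mem_head|apply: IHr => j jr; apply: ur; rewrite inE jr orbT].
by apply: funext => n; rewrite big_cons.
Qed.

Lemma gpol_binX m j g : J j (aug g) -> gpol m (fun n => g ^+ 'C(n, j))%g.
Proof.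
move=> gj; rewrite /gpol (_ : (fun n => _) = fun n => 1 + aug (g ^+ 'C(n, j))%g).
  by apply: polD; [apply/polC/(fil_one JF)|apply: pol_binX; rewrite addn0].
by apply: funext => n; rewrite rho_aug.
Qed.

(* [n |-> a_1^n ... a_k^n] is a polynomial sequence, and its coefficient in
   degree [i], after the lower ones have been divided out, is the value at [i]. *)
Lemma fil_petresco (x : seq Q) i : J i (aug (petresco x i)).
Proof.
elim/ltn_ind: i => -[_|i IHi]; first by apply: (filB (fil_rho _) (fil_one JF)).
pose u n := ((\prod_(1 <= j < i.+1) petresco x j ^+ 'C(n, j))^-1 * \prod_(a <- x) a ^+ n)%g.
have uP : gpol i.+1 u.
  apply: gpolM; first apply: gpolV; apply: gpol_prod.
    by move=> j; rewrite mem_index_iota => /andP[_ ji]; apply/gpol_binX/IHi.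
  move=> a _; have := @gpol_binX i.+1 1 a (rhoJ a).
  by congr (gpol _ _); apply: funext => n; rewrite bin1.
have u1 n : (n < i.+1)%N -> u n = 1%g.
  move=> ni; have e : (\prod_(n.+1 <= j < i.+1) petresco x j ^+ 'C(n, j))%g = 1%g.
    by rewrite big_nat; apply: big1 => j /andP[nj _]; rewrite bin_small.
  by rewrite /u petrescoP (@big_cat_nat _ _ _ n.+1) //= e mulg1 mulVg.
have ui : u i.+1 = petresco x i.+1.
  by rewrite /u petrescoP [X in (_ * X)%g]big_nat_recr //= binn expg1 mulKg.
(* As [u] is trivial below [i.+1], its difference of order [i.+1] at 0 is just
   [rho (u i.+1) - 1]. *)
have := pol_iter 0 uP; rewrite iter_diff0 //; last by move=> n ni; rewrite !u1.
by rewrite (u1 0%N) // ui rho1 addn0.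
Qed.

End Representation.
End FilteredRing.

(** * Finite p-groups *)

Section FiniteAlias.
Variables (Q : groupType) (F : finType) (f : Q -> F) (f_inj : injective f).

Definition finverse (y : F) : option Q :=
  if pselect (exists x, f x = y) is left h then Some (projT1 (cid h)) else None.

Lemma finverseK : pcancel f finverse.
Proof.
move=> x; rewrite /finverse; case: pselect => [h|[]]; last by exists x.
by congr Some; apply: f_inj; case: (cid h).
Qed.

(** The embedding is an argument of the type, so that the finite structure, and with it finite group
    theory, can be attached to the abstract group [Q]. *)
Definition fin_alias (_ : injective f) : Type := Q.
HB.instance Definition _ := Group.on (fin_alias f_inj).
HB.instance Definition _ : isCountable (fin_alias f_inj) := PCanIsCountable finverseK.
HB.instance Definition _ : isFinite (fin_alias f_inj) :=
  @PCanIsFinite (fin_alias f_inj) F f finverse finverseK.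

Definition fin_group : finGroupType := fin_alias f_inj.
End FiniteAlias.

Lemma card_fin_group (Q : groupType) (F : finType) (f : Q -> F) (f_inj : injective f) n :
  ([set: Q] #= `I_n)%card <-> #|fin_group f_inj| = n.
Proof.
have e : ([set: Q] #= `I_#|fin_group f_inj|)%card.
  apply/card_set_bijP; exists (fun x : fin_group f_inj => enum_rank x : nat); split.
  - by move=> x _ /=; apply: ltn_ord.
  - by move=> x y _ _ /= /val_inj/enum_rank_inj.
  - move=> i /= ilt; exists (enum_val (Ordinal ilt) : fin_group f_inj) => //.
    by rewrite enum_valK.
split=> [h|<- //]; apply/esym/card_eq_II/(card_eq_trans _ e).
by rewrite card_eq_sym.
Qed.

Lemma card_embed (Q : groupType) n : ([set: Q] #= `I_n.+1)%card ->
  exists f : Q -> 'I_n.+1, injective f.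
Proof.
move=> /card_set_bijP[f [fI fi _]]; exists (fun x => inord (f x)) => x y.
move=> /(congr1 val); rewrite /= !inordK; try by apply: fI.
by apply: fi; rewrite inE.
Qed.

Section PGroupFlag.
Local Open Scope ring_scope.
Variables (p : nat) (p_pr : prime p) (gT : finGroupType).
Local Notation G := [set: gT]%G.
Hypothesis pG : (p.-group G)%g.

(** The vectors annihilated by every product of [k] operators [rG g - 1], that is, by the [k]-th
    power of the augmentation ideal. *)
Fixpoint flag n (rG : mx_representation 'F_p G n) k (v : 'rV_n) : Prop :=
  if k is k'.+1 then forall g, flag rG k' (v *m rG g - v) else v = 0.

(** A p-group acting in characteristic [p] fixes a nonzero vector; dividing by the fixed vectors
    lowers the dimension. *)
Lemma flag_full n (rG : mx_representation 'F_p G n) : exists m, forall v, flag rG m v.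
Proof.
elim/ltn_ind: n rG => -[|n] IHn rG; first by exists 0%N => v; rewrite /= thinmx0.
pose U := rfix_mx rG G.
have U0 : U != 0 by apply: (rfix_pgroup_pchar (pchar_Fp p_pr)).
have Um : mxmodule rG U by apply: normal_rfix_mx_module; apply: normal_refl.
have [|m mP] := IHn _ _ (factmod_repr Um).
  by rewrite mxrank_coker ltn_subrL lt0n mxrank_eq0 U0.
exists m.+1 => v; have {mP} := mP (in_factmod U v).
elim: m v => [|m IHm] v /=.
  move=> /eqP; rewrite in_factmod_eq0 => /rfix_mxP vU g.
  by rewrite vU ?subrr ?inE.
move=> h g; apply: IHm; have := h g.
by rewrite linearB /= in_factmodJ ?inE.
Qed.

Variables (n : nat) (rG : mx_representation 'F_p G n).

Lemma flag0 k : flag rG k 0.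
Proof. by elim: k => //= k IHk g; rewrite mul0mx subr0. Qed.

Lemma flagD k u v : flag rG k u -> flag rG k v -> flag rG k (u + v).
Proof.
elim: k u v => [|k IHk] u v /=; first by move=> -> ->; rewrite addr0.
move=> hu hv g; rewrite mulmxDl opprD addrACA; exact: IHk.
Qed.

Lemma flagN k u : flag rG k u -> flag rG k (- u).
Proof.
elim: k u => [|k IHk] u /=; first by move=> ->; rewrite oppr0.
by move=> hu g; rewrite mulNmx -opprD; apply: IHk.
Qed.

Lemma flagS k u : flag rG k u -> flag rG k.+1 u.
Proof.
elim: k u => [|k IHk] u /=; first by move=> -> g; rewrite mul0mx subr0.
by move=> hu g; apply/IHk/hu.
Qed.

Definition flag_fil i (e : 'M['F_p]_n) :=
  forall k v, flag rG (k + i) v -> flag rG k (v *m e).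

Lemma flag_filtration : ring_filtration flag_fil.
Proof.
split.
- by move=> i k v _; rewrite mulmx0; apply: flag0.
- by move=> i x y hx hy k v kv; rewrite mulmxDr; apply: flagD; [apply: hx|apply: hy].
- by move=> i x hx k v kv; rewrite mulmxN; apply/flagN/hx.
- move=> i j x y hx hy k v kv; rewrite mulmxA; apply/hy/hx.
  by rewrite -addnA (addnC j).
- by move=> i x hx k v kv; apply: hx; rewrite addnS; apply: flagS.
- by move=> k v; rewrite addn0 mulmx1.
Qed.

Lemma flag_fil_rho g : flag_fil 1 (rG g - 1).
Proof. by move=> k v; rewrite addn1 mulmxBr mulmx1; apply. Qed.

Lemma flag_fil_eq0 m e : (forall v, flag rG m v) -> flag_fil m e -> e = 0.
Proof.
move=> mP em; apply/row_matrixP => i; rewrite row0 rowE.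
exact: (em 0%N _ (mP _)).
Qed.
End PGroupFlag.

(** The regular representation over [F_p] is faithful and unipotent: [flag_fil m] is zero once the
    flag is full at [m]. Elements whose augmentation lies that deep are therefore trivial. *)
Lemma pgroup_petresco (p : nat) (p_pr : prime p) (gT : finGroupType) :
  (p.-group [set: gT]%G)%g -> exists m, forall c, (m <= c)%N ->
    nilpotent_le c gT /\ forall (x : seq gT) i, (c < i)%N -> petresco x i = 1%g.
Proof.
move=> pG; pose rG := regular_repr 'F_p [set: gT]%G.
have [m mP] := flag_full p_pr pG rG.
have JF := flag_filtration rG.
have rM : {morph rG : g h / (g * h)%g >-> (g * h)%R}.
  by move=> g h; rewrite repr_mxM ?inE.
have r1 : rG 1%g = 1%R by rewrite repr_mx1.
have rJ := @flag_fil_rho _ _ _ rG.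
have aug_inj g i : (m <= i)%N -> flag_fil rG i (aug rG g) -> g = 1%g.
  move=> mi /(fil_le JF mi)/(flag_fil_eq0 mP)/eqP; rewrite subr_eq0 => /eqP rg.
  have /fintype.subsetP/(_ g) := regular_mx_faithful 'F_p [set: gT]%G.
  by move=> k1; apply/set1P/k1/rkerP; rewrite inE.
exists m => c mc; split=> [g gc|x i ci].
- by apply: aug_inj (leqW mc) _; apply: (fil_lcs JF rM r1 rJ).
- by apply: aug_inj (leq_trans mc (ltnW ci)) _; apply: (fil_petresco JF rM r1 rJ).
Qed.

Lemma pfinite_petresco (p : nat) (p_pr : prime p) (Q : groupType) k :
  ([set: Q] #= `I_(p ^ k))%card ->
  (forall g : Q, g ^+ (p ^ k) = 1)%g /\ exists m, forall c, (m <= c)%N ->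
    nilpotent_le c Q /\ forall (x : seq Q) i, (c < i)%N -> petresco x i = 1%g.
Proof.
move=> Qpk; have [f f_inj] : exists f : Q -> 'I_(p ^ k).-1.+1, injective f.
  by apply: card_embed; rewrite prednK // expn_gt0 prime_gt0.
have := (card_fin_group f_inj (p ^ k)).1 Qpk; set gT := fin_group f_inj => cQ.
split=> [g|].
  by have := @expg_cardG gT [set: gT]%G g; rewrite inE cardsT cQ => /(_ isT).
have pG : (p.-group [set: gT]%G)%g.
  by rewrite /pgroup cardsT cQ pnatX pnat_id.
have [m mP] := pgroup_petresco p_pr pG.
have idM : @group_morph Q gT id by [].
exists m => c /mP[Qc Qp]; split=> [x /(lcs_morph idM)/Qc//|x i ci].
by rewrite -[LHS]/(id _) -[RHS](Qp (map id x) i ci); apply: (petresco_morph idM).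
Qed.

Lemma exponent_ppow (p : nat) (p_pr : prime p) (Q : groupType) (F : finType)
    (f : Q -> F) m : injective f -> (forall g : Q, g ^+ (p ^ m) = 1)%g ->
  exists k, ([set: Q] #= `I_(p ^ k))%card.
Proof.
move=> f_inj Qm; pose gT := fin_group f_inj.
have pG : (p.-group [set: gT]%G)%g.
  rewrite -pnat_exponent; apply: (@pnat_dvd _ (p ^ m)); last by rewrite pnatX pnat_id.
  by apply/exponentP => g _; apply: Qm.
have [k cG] := p_natP pG; exists k; apply/(card_fin_group f_inj).
by rewrite -cG cardsT.
Qed.

(** * Binomials in Z_p and extension to the binomial closure *)

Section PadicBinomials.
Local Open Scope ring_scope.
Variables (p : nat) (p_pr : prime p).

Lemma ppow_gt1 k : (1 < p ^ k.+1)%N.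
Proof. by rewrite -[1%N](exp1n k.+1) ltn_exp2r ?prime_gt1. Qed.

Lemma natZp_eq k a b :
  (a%:R = b%:R :> 'Z_(p ^ k.+1)) <-> a = b %[mod p ^ k.+1].
Proof.
split=> [/(congr1 val)|ab]; first by rewrite /= !val_Zp_nat ?ppow_gt1.
by apply/val_inj; rewrite /= !val_Zp_nat ?ppow_gt1.
Qed.

Lemma padic_level_nat (x : padic p) k j : (k <= j)%N ->
  val x k = (val x j : nat)%:R.
Proof.
by move=> kj; rewrite -[LHS]natr_Zp; apply/natZp_eq/esym/padic_level.
Qed.

(** Cancelling [d] costs [logn p d] digits of precision. *)
Lemma mod_ppow_cancel d k a b : (0 < d)%N ->
  (d * a = d * b %[mod p ^ (k.+1 + logn p d)])%N -> a = b %[mod p ^ k.+1].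
Proof.
move=> d0; wlog ab : a b / (b <= a)%N => [hw|].
  have [/hw//|/ltnW/hw h] := leqP b a; by move=> /esym/h.
move=> /eqP; rewrite eqn_mod_dvd ?leq_mul2l ?ab ?orbT // -mulnBr => h.
apply/eqP; rewrite eqn_mod_dvd //; have [->|ab0] := posnP (a - b).
  exact: dvdn0.
move: h; rewrite !pfactor_dvdn ?muln_gt0 ?d0 // lognM // addnC.
by rewrite leq_add2l.
Qed.

(** The quotients [q k] are coherent only up to the precision lost in cancelling [d]. Level [k] of
    the result is therefore read from [q (k + v)]. *)
Lemma padic_div (z : padic p) d : (0 < d)%N ->
  (forall k, exists q, val z k = (d * q)%:R) -> exists y, y * d%:R = z.
Proof.
move=> d0 /boolp.choice[q qP]; pose v := logn p d.
have qC k j : (k + v <= j)%N -> q j = q (k + v)%N %[mod p ^ k.+1].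
  move=> kj; apply: (@mod_ppow_cancel d) => //; rewrite addSn.
  apply/natZp_eq; rewrite -qP (padic_level_nat _ kj); apply/natZp_eq.
  rewrite qP val_Zp_nat ?ppow_gt1 // modn_dvdm //.
  by apply: dvdn_exp2l; rewrite ltnS.
have yP k : red ((q (k.+1 + v)%N)%:R : 'Z_(p ^ k.+2)) = (q (k + v)%N)%:R.
  by rewrite red_nat; apply/natZp_eq/qC; rewrite leq_add2r.
pose y : padic p := exist (@padic_coherent p) _ (padic_of_subproof yP).
exists y; apply: padic_eqP => k /=; rewrite padic_natE -natrM mulnC.
rewrite (padic_level_nat z (leq_addr v k)) qP; apply/natZp_eq.
by rewrite val_Zp_nat ?ppow_gt1 // modn_dvdm // dvdn_exp2l // ltnS leq_addr.
Qed.

Lemma prod_natB (S : pzRingType) m n :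
  \prod_(i < n) (m%:R - i%:R) = (m ^_ n)%:R :> S.
Proof.
elim: n => [|n IHn]; first by rewrite big_ord0.
rewrite big_ord_recr /= IHn ffactnSr natrM.
have [nm|mn] := leqP n m; first by rewrite natrB.
by rewrite ffact_small // !mul0r.
Qed.

Lemma padic_falling (y : padic p) n k m : val y k = m%:R ->
  val (\prod_(i < n) (y - i%:R)) k = (n`! * 'C(m, n))%:R.
Proof.
move=> ym; rewrite mulnC bin_ffact -prod_natB.
elim: n => [|n IHn]; first by rewrite !big_ord0.
by rewrite !big_ord_recr /= -IHn -ym padic_natE.
Qed.

Lemma padic_binomial (y : padic p) n :
  exists b, b * n`!%:R = \prod_(i < n) (y - i%:R).
Proof.
apply: padic_div; first exact: fact_gt0.
move=> k; exists 'C(val y k, n); apply: padic_falling.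
by rewrite natr_Zp.
Qed.

(** Lets binomials of p-adic exponents be replaced by integer binomials of one sufficiently precise
    approximation. *)
Lemma padic_binomial_approx (y b : padic p) n k j :
  b * n`!%:R = \prod_(i < n) (y - i%:R) -> (k + logn p n`! <= j)%N ->
  val b k = 'C(val y j, n)%:R.
Proof.
move=> bE kj; rewrite (padic_level_nat b (leq_trans (leq_addr _ _) kj)).
apply/natZp_eq/(@mod_ppow_cancel n`!); rewrite ?fact_gt0 // addSn.
have /natZp_eq : ((n`! * val b j)%:R = (n`! * 'C(val y j, n))%:R :> 'Z_(p ^ j.+1)).
  have := congr1 (fun x : padic p => val x j) bE.
  rewrite (padic_falling n (esym (natr_Zp (val y j)))) => <-.
  by rewrite /= padic_natE mulnC natrM natr_Zp.
move=> h; rewrite -(modn_dvdm (n`! * val b j) (dvdn_exp2l p (_ : (k + logn p n`!).+1 <= j.+1)%N)) ?ltnS //.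
by rewrite h modn_dvdm // dvdn_exp2l.
Qed.

Lemma padic_intI (d : int) (x y : padic p) :
  d != 0 -> x * d%:~R = y * d%:~R -> x = y.
Proof.
have [_ ZM Zn] := padic_domain0 p_pr.
move=> d0 /eqP; rewrite -subr_eq0 -mulrBl => /eqP/ZM[/eqP|].
  by rewrite subr_eq0 => /eqP.
case: d d0 => [[|n]|n] // _ /eqP; first by rewrite (negPf (Zn n)).
by rewrite NegzE mulrNz oppr_eq0 (negPf (Zn n)).
Qed.
End PadicBinomials.

(** * Extending homomorphisms to the binomial closure *)

Section BinomialExtension.
Local Open Scope ring_scope.
Variables (p : nat) (p_pr : prime p) (R : comPzRingType) (dR : domain0 R).

Section Extension.
Variable f : {rmorphism R -> padic p}.

Lemma rmorph_mulrz r (d : int) : f (r *~ d) = f r * d%:~R.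
Proof. by rewrite mulrzr; apply: rmorphMz. Qed.

(** The extension of [f] to fractions is given by its graph, because a fraction need not have a
    value in [Z_p]. Torsion-freeness makes the relation functional. *)
Definition frac_rel (s : Zloc R) (y : padic p) :=
  exists r d (d0 : d != 0), s = Zfrac r d0 /\ y * d%:~R = f r.

Lemma frac_relE r d (d0 : d != 0) y : frac_rel (Zfrac r d0) y -> y * d%:~R = f r.
Proof.
move=> [r' [d' [d'0 [/Zfrac_eqP[t [t0 e]] yd']]]].
have := congr1 f e; rewrite !rmorph_mulrz -yd' => h.
apply: (padic_intI p_pr (mulf_neq0 d'0 t0)); rewrite h.
by rewrite !intrM; ring.
Qed.

Lemma frac_rel_fun s y y' : frac_rel s y -> frac_rel s y' -> y = y'.
Proof.
move=> [r [d [d0 [-> yd]]]] /frac_relE yd'.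
by apply: (padic_intI p_pr d0); rewrite yd yd'.
Qed.

Lemma frac_rel_of r : frac_rel (Zloc_of r) (f r).
Proof. by exists r, 1, (oner_neq0 _); rewrite mulr1. Qed.

Lemma frac_relD s y s' y' : frac_rel s y -> frac_rel s' y' -> frac_rel (s + s') (y + y').
Proof.
move=> [r [d [d0 [-> yd]]]] [r' [d' [d'0 [-> yd']]]].
exists (r *~ d' + r' *~ d), (d * d'), (mulf_neq0 d0 d'0); split.
  exact: ZlocD.
by rewrite rmorphD !rmorph_mulrz -yd -yd' intrM; ring.
Qed.

Lemma frac_relM s y s' y' : frac_rel s y -> frac_rel s' y' -> frac_rel (s * s') (y * y').
Proof.
move=> [r [d [d0 [-> yd]]]] [r' [d' [d'0 [-> yd']]]].
exists (r * r'), (d * d'), (mulf_neq0 d0 d'0); split; first exact: ZlocM.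
by rewrite rmorphM /= -yd -yd' intrM; ring.
Qed.

Lemma frac_relN s y : frac_rel s y -> frac_rel (- s) (- y).
Proof.
move=> [r [d [d0 [-> yd]]]]; exists (- r), d, d0; split; first exact: ZlocN.
by rewrite rmorphN /= -yd mulNr.
Qed.

Lemma frac_rel_nat n : frac_rel n%:R n%:R.
Proof. by have := frac_rel_of n%:R; rewrite !rmorph_nat. Qed.

Lemma frac_rel_binom s y n : frac_rel s y -> exists b, frac_rel (Zloc_binom s n) b.
Proof.
move=> sy; have [b bE] := padic_binomial p_pr y n; exists b; rewrite /Zloc_binom.
have : frac_rel (\prod_(i < n) (s - i%:R)) (\prod_(i < n) (y - i%:R)).
  elim: n {b bE} => [|n IHn]; first by rewrite !big_ord0; apply: (frac_rel_nat 1).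
  rewrite !big_ord_recr /=; apply: frac_relM => //.
  by apply/frac_relD/frac_relN/frac_rel_nat.
rewrite -bE => -[r [d [d0 [-> bd]]]].
exists (r * 1), (d * n`!), (mulf_neq0 d0 (fact_neq0 n)); split; first exact: ZlocM.
by rewrite mulr1 -bd intrM -[n`!%:~R]/(n`!%:R); ring.
Qed.

(** The fractions with a value form a subring containing [R] and are closed under binomials, so they
    exhaust every stage of the closure. *)
Lemma frac_rel_total (s : binc dR) : exists y, frac_rel (val s) y.
Proof.
have /binc_predP[k] := valP s; elim: k (val s) => [//|[|k] IHk] {}s.
  by move=> [r _ <-]; exists (f r); apply: frac_rel_of.
apply: (_ : (smallest _ _ `<=` [set s | exists y, frac_rel s y])%classic).
move=> x; apply; split; first split.
- by exists 1; apply: (frac_rel_nat 1).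
- by move=> u v [y uy] [z vz]; exists (y - z); apply/frac_relD/frac_relN.
- by move=> u v [y uy] [z vz]; exists (y * z); apply: frac_relM.
- by move=> u [/IHk//|[a [n [[/IHk[y ay] _] ->]]]]; apply: frac_rel_binom ay.
Qed.

Definition binc_ext (s : binc dR) : padic p := projT1 (cid (frac_rel_total s)).

Lemma binc_extP s : frac_rel (val s) (binc_ext s).
Proof. exact: projT2 (cid (frac_rel_total s)). Qed.

Fact binc_ext_zmod : zmod_morphism binc_ext.
Proof.
move=> s t; apply: (frac_rel_fun (binc_extP _)).
by rewrite rmorphB; apply/frac_relD/frac_relN/binc_extP/binc_extP.
Qed.

Fact binc_ext_monoid : monoid_morphism binc_ext.
Proof.
split=> [|s t]; apply: (frac_rel_fun (binc_extP _)).
  by rewrite rmorph1; apply: (frac_rel_nat 1).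
by rewrite rmorphM; apply/frac_relM/binc_extP/binc_extP.
Qed.

HB.instance Definition _ :=
  GRing.isZmodMorphism.Build (binc dR) (padic p) binc_ext binc_ext_zmod.
HB.instance Definition _ :=
  GRing.isMonoidMorphism.Build (binc dR) (padic p) binc_ext binc_ext_monoid.

Definition binc_morph : {rmorphism binc dR -> padic p} := binc_ext.
End Extension.

Lemma binc_fully_residually_padic : fully_residually_padic p R ->
  fully_residually_padic p (binc dR).
Proof.
move=> hR M.
have /boolp.choice[nd ndP] (s : binc dR) : exists rd : R * {d : int | d != 0},
    val s = Zfrac rd.1 (valP rd.2).
  move: (val s); apply: ZlocP => r d d0.
  exists (r, exist (fun d : int => d != 0) d d0) => /=.
  by congr Zfrac; apply: bool_irrelevance.
(* Two fractions are compared by cross-multiplication, so [f] has to be injective on all these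
   products. *)
pose m s t := (nd s).1 *~ val (nd t).2.
have [f f_inj] := hR (allpairs m M M).
exists (binc_morph f) => s t sM tM /= st; apply/val_inj.
have sE u : binc_ext f u * (val (nd u).2)%:~R = f (nd u).1.
  by apply: (@frac_relE f _ _ (valP (nd u).2)); rewrite -ndP; exact: binc_extP.
have {}st : binc_ext f s = binc_ext f t := st.
rewrite !ndP; apply: (@Zfrac_eq _ _ _ _ _ _ _ 1) => //; rewrite !mulr1.
apply: f_inj; try exact: allpairs_f.
have -> : f ((nd s).1 *~ val (nd t).2) = f (nd s).1 * (val (nd t).2)%:~R.
  exact: rmorph_mulrz.
have -> : f ((nd t).1 *~ val (nd s).2) = f (nd t).1 * (val (nd s).2)%:~R.
  exact: rmorph_mulrz.
by rewrite -!sE st mulrAC.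
Qed.
End BinomialExtension.

(** * Maps to the free pro-p group *)

Section PadicPowers.
Local Open Scope group_scope.
Variables (p : nat) (p_pr : prime p) (S : binomialRingType).
Variable phi : {rmorphism S -> padic p}.

(* [Q] is a Hall [S]-group of class [c] for the powers [ppow k]. *)
Record padic_group (Q : groupType) (c k : nat) : Prop := PadicGroup {
  padic_nilpotent : nilpotent_le c Q;
  padic_petresco : forall (x : seq Q) i, (c < i)%N -> petresco x i = 1;
  padic_exponent : forall g : Q, g ^+ (p ^ k) = 1
}.

(** Level [k] is a residue modulo [p ^ k.+1], one digit more than the exponent [p ^ k] asks for. *)
Definition ppow (Q : groupType) k (g : Q) (l : S) := g ^+ (val (phi l) k : nat).

Section Exponent.
Variables (Q : groupType) (k : nat).
Hypothesis Qk : forall g : Q, g ^+ (p ^ k) = 1.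
Implicit Types (g : Q) (l : S).

Lemma expg_ppow_eq g a b : a = b %[mod p ^ k.+1] -> g ^+ a = g ^+ b.
Proof.
have e m : g ^+ m = g ^+ (m %% p ^ k.+1)%N.
  rewrite {1}(divn_eq m (p ^ k.+1)) expgnDr mulnC expnSr -mulnA expgnA Qk.
  by rewrite expg1n mul1g.
by move=> ab; rewrite e ab -e.
Qed.

Lemma ppowE g l n : val (phi l) k = n%:R%R -> ppow k g l = g ^+ n.
Proof.
by move=> ln; apply/expg_ppow_eq/(natZp_eq p_pr); rewrite natr_Zp.
Qed.

Lemma ppow_level g l j : (k <= j)%N -> ppow k g l = ppow j g l.
Proof. by move=> kj; apply/ppowE/padic_level_nat. Qed.

Lemma ppow0 g : ppow k g 0%R = 1.
Proof. by rewrite (@ppowE _ _ 0) // rmorph0. Qed.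
Lemma ppow1 g : ppow k g 1%R = g.
Proof. by rewrite (@ppowE _ _ 1) // rmorph1. Qed.
Lemma ppowD g a b : ppow k g (a + b)%R = ppow k g a * ppow k g b.
Proof.
rewrite (@ppowE g (a + b)%R (val (phi a) k + val (phi b) k)%N) ?expgnDr //.
by rewrite rmorphD natrD !natr_Zp.
Qed.
Lemma ppowM g a b : ppow k (ppow k g a) b = ppow k g (a * b)%R.
Proof.
rewrite (@ppowE g (a * b)%R (val (phi a) k * val (phi b) k)%N) ?expgnA //.
by rewrite rmorphM natrM !natr_Zp.
Qed.
Lemma ppowJ (x y : Q) l : y^-1 * ppow k x l * y = ppow k (y^-1 * x * y) l.
Proof. by rewrite -!mulgA -!/(_ ^ y) /ppow conjXg. Qed.
End Exponent.

Lemma ppow_morph (Q Q' : groupType) (u : Q -> Q') k g l :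
  group_morph u -> u (ppow k g l) = ppow k (u g) l.
Proof. by move=> uM; rewrite /ppow (group_morphX uM). Qed.

Lemma ppow_petresco (Q : groupType) c k (h : padic_group Q c k) (x : seq Q) l :
  \prod_(a <- x) ppow k a l = ppow k (\prod_(a <- x) a) l *
    \prod_(2 <= i < c.+1) ppow k (petresco x i) (binr l i).
Proof.
have Qk := padic_exponent h; case: (posnP c) => [c0|c0].
  have Q1 (g : Q) : g = 1 by apply: (padic_nilpotent h); rewrite c0.
  by rewrite [LHS]Q1 [RHS]Q1.
(* The extra digits cover the denominators [i!] for all [i <= c], so one natural number [n] can
   replace [phi l] throughout. The identity then becomes [petrescoP] at [n]. *)
pose j := (k + logn p c`!)%N; pose n := val (phi l) j : nat.
have -> : \prod_(a <- x) ppow k a l = \prod_(a <- x) a ^+ n.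
  by apply: eq_bigr => a _; rewrite (ppow_level Qk _ _ (leq_addr (logn p c`!) k)).
have -> : \prod_(2 <= i < c.+1) ppow k (petresco x i) (binr l i) =
    \prod_(2 <= i < c.+1) petresco x i ^+ 'C(n, i).
  apply: eq_big_nat => i /andP[_ ic]; apply: (ppowE Qk).
  apply: (padic_binomial_approx p_pr (y := phi l)).
    rewrite -[i`!%:R%R](rmorph_nat phi) -rmorphM binrP rmorph_prod.
    by apply: eq_bigr => i' _; rewrite rmorphB rmorph_nat.
  rewrite /j leq_add2l; apply: dvdn_leq_log; rewrite ?fact_gt0 //.
  by rewrite -(bin_fact (ic : i <= c)%N) dvdn_mull // dvdn_mulr.
rewrite petrescoP (ppow_level Qk _ _ (leq_addr (logn p c`!) k)).
have p1 : petresco x 1 = \prod_(a <- x) a.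
  by rewrite /petresco /= big_geq // invg1 mul1g; apply: eq_bigr.
have -> : ppow j (\prod_(a <- x) a) l = petresco x 1 ^+ 'C(n, 1).
  by rewrite p1 bin1.
rewrite -(@big_ltn _ _ _ 1 c.+1 (fun i => petresco x i ^+ 'C(n, i))) //.
(* One product stops at [n], the other at [c]. Both extend to [n + c]: factors beyond [n] have a
   zero binomial as exponent, those beyond [c] have a trivial Petresco word. *)
have ext m : (n <= m \/ c <= m)%N -> (m <= n + c)%N ->
    \prod_(1 <= i < m.+1) petresco x i ^+ 'C(n, i) =
    \prod_(1 <= i < (n + c).+1) petresco x i ^+ 'C(n, i).
  move=> mb mnc; rewrite [RHS](@big_cat_nat _ _ _ m.+1) //=.
  rewrite [X in _ = _ * X](_ : _ = 1) ?mulg1 // big_nat.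
  apply: big1 => i /andP[mi _]; case: mb => mb.
    by rewrite bin_small // (leq_ltn_trans mb).
  by rewrite (padic_petresco h) ?expg1n // (leq_ltn_trans mb).
rewrite (ext n) ?leq_addr //; last by left.
by rewrite -(ext c) ?leq_addl //; right.
Qed.

Definition padic_hall Q c k (_ : padic_group Q c k) : Type := Q.

Section HallInstance.
Variables (Q : groupType) (c k : nat) (h : padic_group Q c k).
HB.instance Definition _ := Group.on (padic_hall h).
Let Qk := padic_exponent h.
Let idM : @group_morph (padic_hall h) Q id. Proof. by []. Qed.

Fact padic_hall_nilpotent : nilpotent_le c (padic_hall h).
Proof. by move=> x /(lcs_morph idM)/(padic_nilpotent h). Qed.

Fact padic_hall_petresco (x : seq (padic_hall h)) (l : S) :
  \prod_(a <- x) (ppow k (a : Q) l : padic_hall h) =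
  ppow k (\prod_(a <- x) a : Q) l *
  \prod_(2 <= i < c.+1) (ppow k (petresco x i : Q) (binr l i) : padic_hall h).
Proof.
have := ppow_petresco h (map id x) l; rewrite !big_map => e.
rewrite [LHS]e; congr (_ * _); apply: eq_bigr => i _.
by rewrite -(petresco_morph idM).
Qed.

HB.instance Definition _ := isHall.Build S c (padic_hall h)
  padic_hall_nilpotent (ppow0 Qk) (ppow1 Qk) (ppowD Qk) (ppowM Qk) (@ppowJ Q k)
  padic_hall_petresco.
End HallInstance.

Lemma padic_group_up Q c k c' k' : (c <= c')%N -> (k <= k')%N ->
  padic_group Q c k -> padic_group Q c' k'.
Proof.
move=> cc' kk' [hn hp he]; split.
- rewrite -(subnK cc'); elim: (c' - c)%N => // m IHm g; rewrite addSn => /lcsS.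
  exact: IHm.
- by move=> x i ci; apply/hp/(leq_ltn_trans cc').
- by move=> g; rewrite -(subnKC kk') expnD expgnA he expg1n.
Qed.

Section Lift.
Variable A : Type.

Definition padic_lift Q c k (h : padic_group Q c k) (f : A -> Q) :
  hallFree A S c -> Q := @hlift A S c (padic_hall h) f.

Lemma padic_liftM Q c k (h : padic_group Q c k) f : group_morph (padic_lift h f).
Proof. exact: (@hlift_morph A S c (padic_hall h)). Qed.

Lemma padic_liftX Q c k (h : padic_group Q c k) f g l :
  padic_lift h f (@hpow S c (hallFree A S c) g l) = ppow k (padic_lift h f g) l.
Proof. by have [_] := @hlift_hall A S c (padic_hall h) f; apply. Qed.

Lemma padic_lift_gen Q c k (h : padic_group Q c k) f a :
  padic_lift h f (hgen S c a) = f a.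
Proof. exact: (@hlift_gen A S c (padic_hall h)). Qed.

Lemma padic_lift_uniq Q c k (h : padic_group Q c k) f (u : hallFree A S c -> Q) :
  group_morph u -> (forall g l, u (@hpow S c _ g l) = ppow k (u g) l) ->
  (forall a, u (hgen S c a) = f a) -> u =1 padic_lift h f.
Proof.
move=> uM uX uf; apply: (@hlift_uniq A S c (padic_hall h)) => //.
- exact: hlift_hall.
- by move=> a; rewrite uf padic_lift_gen.
Qed.

(** Uniqueness of Hall lifts: raising the level does not change the powers, and composing with
    [hall_psi] gives the lift in the next class. The choices made in [phi_comp] are thus
    immaterial. *)
Lemma padic_lift_indep Q c k c' k' (h : padic_group Q c k) (h' : padic_group Q c' k') f
    (x : proHallFree A S) : padic_lift h f (val x c) = padic_lift h' f (val x c').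
Proof.
wlog [cc' kk'] : c k c' k' h h' / (c <= c' /\ k <= k')%N => [hw|].
  have h2 := padic_group_up (leq_maxl c c') (leq_maxl k k') h.
  rewrite (hw _ _ _ _ h h2) ?(hw _ _ _ _ h' h2) ?leq_maxl ?leq_maxr //.
have h2 := padic_group_up (leqnn c) kk' h.
have -> : padic_lift h f (val x c) = padic_lift h2 f (val x c).
  apply: padic_lift_uniq => [|g l|a]; first exact: padic_liftM.
    by rewrite padic_liftX (ppow_level (padic_exponent h) _ _ kk').
  exact: padic_lift_gen.
move: h'; rewrite -(subnK cc'); elim: (c' - c)%N => [|m IHm] h'.
  by congr (padic_lift _ _ _); apply: Prop_irrelevance.
have h3 := padic_group_up (leq_addl m c) (leqnn _) h2.
rewrite (IHm h3) -(invlimP x (m + c)%N) /=.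
apply: (@padic_lift_uniq _ _ _ h' f (fun y => padic_lift h3 f (hall_psi y))).
- by move=> y z; rewrite gmulfM padic_liftM.
- by move=> g l; have [_ ->] := hall_psi_hall A S (m + c); rewrite padic_liftX.
- by move=> a; rewrite hall_psi_gen padic_lift_gen.
Qed.
End Lift.

Section PhiMap.
Variable A : choiceType.
Local Notation F := (freeGroup A).

Lemma exists_padic_group (N : ppowNormal p F) :
  exists ck, padic_group (quotg N) ck.1 ck.2.
Proof.
have [k Nk] := ppow_index N; have [he [m mP]] := pfinite_petresco p_pr Nk.
by exists (m, k); have [hn hp] := mP m (leqnn m); split.
Qed.

Definition free_image (N : normalSubgroup F) (a : A) : quotg N := qclass N (fggen a).

Definition phi_comp (N : ppowNormal p F) (x : proHallFree A S) : quotg N :=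
  padic_lift (projT2 (cid (exists_padic_group N))) (free_image N)
    (val x (projT1 (cid (exists_padic_group N))).1).

Lemma phi_compE (N : ppowNormal p F) c k (h : padic_group (quotg N) c k) x :
  phi_comp N x = padic_lift h (free_image N) (val x c).
Proof. exact: padic_lift_indep. Qed.

Lemma phi_coherent x : invlim_coherent
  (G := fun N : ppowNormal p F => quotg N) (fun e => @quotg_proj p F e)
  (fun N => phi_comp N x).
Proof.
apply/asboolP => e; have [[c k] /= h] := exists_padic_group (incl_src e).
have [[c' k'] /= h'] := exists_padic_group (incl_tgt e).
have {}h := padic_group_up (leq_maxl c c') (leq_maxl k k') h.
have {}h' := padic_group_up (leq_maxr c c') (leq_maxr k k') h'.
rewrite (phi_compE h) (phi_compE h').
apply: (@padic_lift_uniq _ _ _ _ h' _ (fun y => quotg_proj (padic_lift h _ y))).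
- by move=> y z; rewrite padic_liftM quotg_projM.
- by move=> g l; rewrite padic_liftX; apply: ppow_morph; apply: quotg_projM.
- by move=> a; rewrite padic_lift_gen quotg_projE.
Qed.

Definition phi_map (x : proHallFree A S) : freeProP p A :=
  exist _ (fun N => phi_comp N x) (phi_coherent x).

Fact phi_mapM : {morph phi_map : x y / x * y}.
Proof.
by move=> x y; apply: invlim_eqP => N /=; rewrite /phi_comp /= padic_liftM.
Qed.
HB.instance Definition _ := isMultiplicative.Build (proHallFree A S) (freeProP p A)
  phi_map phi_mapM.
End PhiMap.
End PadicPowers.

(** * The Magnus representation *)

Section FreeGroupLift.
Local Open Scope group_scope.
Variables (A : choiceType) (G : groupType) (f : A -> G).

Definition fgval (w : fgword A) : G :=
  \prod_(l <- w) (if l.2 then f l.1 else (f l.1)^-1).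

Definition fglift (x : freeGroup A) : G := fgval (repr x).

Lemma fglift_class w : fglift (fgclass w) = fgval w.
Proof.
have fg_eqP w1 w2 : fg_eq w1 w2 -> fgval w1 = fgval w2.
  elim=> [//|u v _ ->//|u v w' _ -> _ ->//|u v a b].
  rewrite /fgval !big_cat !big_cons big_nil /= mulg1.
  by case: b; rewrite ?mulgV ?mulVg mul1g.
by apply/fg_eqP/fgclassP; apply: reprK.
Qed.

Lemma fgliftM : group_morph fglift.
Proof.
elim/fgclass_ind=> u; elim/fgclass_ind=> v.
by rewrite [_ * _]fg_mulE !fglift_class /fgval big_cat.
Qed.

Lemma fglift_gen a : fglift (fggen a) = f a.
Proof. by rewrite fglift_class /fgval big_seq1. Qed.
End FreeGroupLift.

Section Kernel.
Local Open Scope group_scope.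
Local Open Scope quotient_scope.
Variables (G H : groupType) (f : G -> H) (fM : group_morph f).

Fact kernel_subgroup : is_subgroup [set x | f x = 1]%classic.
Proof.
split=> /= [|x y fx fy|x fx]; first exact: group_morph1.
  by rewrite fM fx fy mulg1.
by rewrite group_morphV // fx invg1.
Qed.

Fact kernel_conj (x y : G) : f x = 1 -> f (x ^ y) = 1.
Proof. by move=> fx; rewrite /conjg !fM fx mul1g group_morphV // mulVg. Qed.

Definition kernel := NormalSubgroup kernel_subgroup kernel_conj.

Definition kernel_map (u : quotg kernel) : H := f (repr u).

Lemma kernel_mapE x : kernel_map (qclass kernel x) = f x.
Proof.
have /qclassP : qclass kernel (repr (qclass kernel x)) = qclass kernel x.
  exact: reprK.
by rewrite /= fM group_morphV // => /mulg1_eq; rewrite invgK.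
Qed.

Lemma kernel_mapM : group_morph kernel_map.
Proof.
by elim/qclass_ind=> x; elim/qclass_ind=> y; rewrite -qclassM !kernel_mapE.
Qed.

Lemma kernel_map_inj : injective kernel_map.
Proof.
elim/qclass_ind=> x; elim/qclass_ind=> y; rewrite !kernel_mapE => fxy.
by apply/qclassP; rewrite /= fM group_morphV // fxy mulVg.
Qed.
End Kernel.

Section UnipotentGroup.
Local Open Scope ring_scope.
Variables (E : pzRingType) (J : nat -> E -> Prop) (JF : ring_filtration J).

Definition unip_pred (x : E * E) := [&& x.1 * x.2 == 1, x.2 * x.1 == 1,
  `[< J 1 (x.1 - 1) >] & `[< J 1 (x.2 - 1) >]].

(* Elements of [1 + J 1], paired with their inverses. *)
Definition unip (_ : ring_filtration J) := {x : E * E | unip_pred x}.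
HB.instance Definition _ := Choice.on (unip JF).

Definition unip_val (u : unip JF) : E := (val u).1.

Lemma unip_val_inj : injective unip_val.
Proof.
move=> [[x x'] /= xP] [[y y'] /= yP]; rewrite /unip_val /= => xy.
apply/val_inj; rewrite /= xy; congr (_, _); move: xP yP; rewrite xy.
move=> /and4P[/= _ /eqP x'y _ _] /and4P[/= /eqP yy' _ _ _].
by rewrite -[x']mulr1 -yy' mulrA x'y mul1r.
Qed.

Lemma unip_valJ u : J 1 (unip_val u - 1).
Proof. by case/and4P: (valP u) => _ _ /asboolP. Qed.

Fact unip_one_subproof : unip_pred (1, 1).
Proof.
apply/and4P; split; rewrite /= ?mulr1 // subrr; apply/asboolP; exact: fil0 JF _.
Qed.

Lemma unip_JM x y : J 1 (x - 1) -> J 1 (y - 1) -> J 1 (x * y - 1).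
Proof.
move=> xJ yJ; have -> : x * y - 1 = (x - 1) * (y - 1) + (x - 1) + (y - 1).
  by rewrite mulrBr mulr1 mulrBl mul1r subrK addrA subrK.
exact: (filD JF (filD JF (filS JF (filM JF xJ yJ)) xJ) yJ).
Qed.

Fact unip_mul_subproof (u v : unip JF) :
  unip_pred ((val u).1 * (val v).1, (val v).2 * (val u).2).
Proof.
case/and4P: (valP u) => /eqP u1 /eqP u2 /asboolP u3 /asboolP u4.
case/and4P: (valP v) => /eqP v1 /eqP v2 /asboolP v3 /asboolP v4.
apply/and4P; split=> /=; last 2 first; try by apply/asboolP/unip_JM.
  by rewrite mulrA -(mulrA (val u).1) v1 mulr1 u1.
by rewrite mulrA -(mulrA (val v).2) u2 mulr1 v2.
Qed.

Fact unip_inv_subproof (u : unip JF) : unip_pred ((val u).2, (val u).1).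
Proof. by case/and4P: (valP u) => *; apply/and4P; split. Qed.

Definition unip_one : unip JF := exist unip_pred _ unip_one_subproof.
Definition unip_mul (u v : unip JF) : unip JF := exist unip_pred _ (unip_mul_subproof u v).
Definition unip_inv (u : unip JF) : unip JF := exist unip_pred _ (unip_inv_subproof u).

Fact unip_mulA : associative unip_mul.
Proof. by move=> u v w; apply: unip_val_inj; apply: mulrA. Qed.
Fact unip_mul1 : left_id unip_one unip_mul.
Proof. by move=> u; apply: unip_val_inj; apply: mul1r. Qed.
Fact unip_mul1r : right_id unip_one unip_mul.
Proof. by move=> u; apply: unip_val_inj; apply: mulr1. Qed.
Fact unip_mulV : left_inverse unip_one unip_inv unip_mul.
Proof. by move=> u; apply: unip_val_inj; case/and4P: (valP u) => _ /eqP. Qed.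
Fact unip_mulVr : right_inverse unip_one unip_inv unip_mul.
Proof. by move=> u; apply: unip_val_inj; case/and4P: (valP u) => /eqP. Qed.
HB.instance Definition _ := isGroup.Build (unip JF)
  unip_mulA unip_mul1 unip_mul1r unip_mulV unip_mulVr.

(** The inverse of [1 + x] is the finite geometric series in [- x]. *)
Lemma exists_unip x m : J 1 x -> x ^+ m = 0 -> exists u, unip_val u = 1 + x.
Proof.
move=> xJ xm; pose y := \sum_(i < m) (- x) ^+ i.
have ym : (- x) ^+ m = 0 by rewrite exprNn xm mulr0.
have e : (1 + x) * y = 1.
  have := subrX1 (- x) m; rewrite ym sub0r => /(congr1 -%R).
  by rewrite opprK -mulNr opprB opprK => <-.
have xy : x * y = y * x.
  rewrite /y mulr_suml mulr_sumr; apply: eq_bigr => i _.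
  by apply: commrX; apply: commrN; apply: commr_refl.
have e' : y * (1 + x) = 1 by rewrite mulrDr mulr1 -xy -[X in X + _]mul1r -mulrDl.
have yJ0 : J 0 y.
  apply: (fil_sum JF) => i; elim: (i : nat) => [|k IHk]; first exact: fil_one JF.
  by rewrite exprS; apply: (filM JF (i := 0) (j := 0)) IHk; apply/(filN JF)/(filS JF).
have P : unip_pred (1 + x, y).
  apply/and4P; split=> /=; rewrite ?e ?e' //; apply/asboolP; first by rewrite addrC addKr.
  have -> : y - 1 = - (x * y) by rewrite -e mulrDl mul1r opprD addrA subrr sub0r.
  by apply: (filN JF); have := filM JF xJ yJ0.
by exists (exist unip_pred _ P).
Qed.
End UnipotentGroup.

Section Magnus.
Local Open Scope ring_scope.
Variables (A : finType) (n : nat) (K : comNzRingType).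
Local Notation N := #|{: n.-bseq A}|.
Local Notation E := 'M[K]_N.

Definition wd (r : 'I_N) : seq A := enum_val r : n.-bseq A.

Lemma size_wd r : (size (wd r) <= n)%N. Proof. exact: size_bseq. Qed.

Lemma wd_inj : injective wd.
Proof. by move=> r s /val_inj/enum_val_inj. Qed.

Lemma wd_surj w : (size w <= n)%N -> exists r, wd r = w.
Proof. by move=> wn; exists (enum_rank (Bseq wn)); rewrite /wd enum_rankK. Qed.

Definition mfil i (M : E) :=
  forall r s, (size (wd s) < size (wd r) + i)%N -> M r s = 0.

Lemma mfil_filtration : ring_filtration mfil.
Proof.
split.
- by move=> i r s _; rewrite mxE.
- by move=> i M M' h h' r s rs; rewrite mxE h ?h' ?addr0.
- by move=> i M h r s rs; rewrite mxE h ?oppr0.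
- move=> i j M M' h h' r s rs; rewrite mxE big1 // => t _.
  have [rt|rt] := ltnP (size (wd t)) (size (wd r) + i); first by rewrite h ?mul0r.
  by rewrite h' ?mulr0 // (leq_trans rs) // addnA leq_add2r.
- by move=> i M h r s rs; apply: h; rewrite addnS ltnS ltnW.
- move=> r s; rewrite addn0 mxE; case: eqP => // ->; by rewrite ltnn.
Qed.

Lemma mfil_eq0 i M : (n < i)%N -> mfil i M -> M = 0.
Proof.
move=> ni h; apply/matrixP => r s; rewrite mxE h //.
by rewrite (leq_ltn_trans (size_wd s)) // ltn_addl.
Qed.

(** Right multiplication by [a] on noncommutative polynomials truncated above degree [n], in the
    basis of words. *)
Definition letter a : E := \matrix_(r, s) (wd s == rcons (wd r) a)%:R.

Lemma letter_mfil a : mfil 1 (letter a).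
Proof.
move=> r s; rewrite mxE addn1; case: eqP => // ->.
by rewrite size_rcons ltnn.
Qed.

(** Read entrywise, [M] behaves like right multiplication by [w] plus [dlt]-larger words of the same
    length. *)
Definition leading w (M : E) :=
  (forall r s, wd s = wd r ++ w -> M r s = 1) /\
  forall r s, M r s != 0 -> exists2 v, wd s = wd r ++ v & size v = size w /\ lew w v.

Lemma leading_letter a : leading [:: a] (letter a).
Proof.
split=> r s; first by move=> e; rewrite mxE e cats1 eqxx.
rewrite mxE; case: (wd s =P _) => [-> _|]; last by rewrite eqxx.
by exists [:: a]; rewrite ?cats1 // /lew eqxx.
Qed.

Lemma leading_mul_cases u v M M' r s : leading u M -> leading v M' ->
  (M * M') r s != 0 -> exists2 w, wd s = wd r ++ w &
    size w = size (u ++ v) /\ lew (u ++ v) w.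
Proof.
move=> [_ hM] [_ hM'] MM'0.
have [t] : exists t, M r t * M' t s != 0.
  apply: contrapT => h; case/eqP: MM'0; rewrite mxE big1 // => t _.
  by apply/eqP; apply: contrapT => /negP ht; apply: h; exists t.
have [->|Mt] := eqVneq (M r t) 0; first by rewrite mul0r eqxx.
have [->|M't] := eqVneq (M' t s) 0; first by rewrite mulr0 eqxx.
have [u' tE [su uu']] := hM _ _ Mt; have [v' sE [sv vv']] := hM' _ _ M't.
move=> _; exists (u' ++ v'); first by rewrite sE tE catA.
split; first by rewrite !size_cat su sv.
case/orP: uu' => [/eqP<-|uu']; last by rewrite /lew dlt_catr ?orbT.
by rewrite /lew dlt_catl; case/orP: vv' => [/eqP<-|->]; rewrite ?eqxx ?orbT.
Qed.

Lemma leading_mul1 u v M M' r s : leading u M -> leading v M' ->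
  wd s = wd r ++ u ++ v -> (M * M') r s = 1.
Proof.
move=> [M1 hM] [M'1 hM'] sE.
have [|t tE] := @wd_surj (wd r ++ u).
  by apply: leq_trans (size_wd s); rewrite sE catA (size_cat (_ ++ _)) leq_addr.
rewrite mxE (bigD1 t) //= M1 // M'1 ?tE -?catA // mulr1 big1 ?addr0 // => t' tt'.
have [->|Mt] := eqVneq (M r t') 0; first by rewrite mul0r.
have [->|M't] := eqVneq (M' t' s) 0; first by rewrite mulr0.
have [u' t'E [su _]] := hM _ _ Mt; have [v' sE' [sv _]] := hM' _ _ M't.
case/negP: tt'; apply/eqP/wd_inj; rewrite tE t'E; congr (_ ++ _).
move: sE; rewrite sE' t'E -catA => /eqP; rewrite eqseq_cat // eqxx /=.
by rewrite eqseq_cat // => /andP[/eqP].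
Qed.

Lemma lieb_entry (M M' : E) r s : lieb M M' r s = (M * M') r s - (M' * M) r s.
Proof. by rewrite /lieb; move: (M * M') (M' * M) => X Y; rewrite !mxE. Qed.

(** The words contributed by [M' * M] are at least [v ++ u], so they cannot disturb the coefficient
    1 at [u ++ v]. *)
Lemma leading_lieb u v M M' : leading u M -> leading v M' ->
  dlt (u ++ v) (v ++ u) -> leading (u ++ v) (lieb M M').
Proof.
move=> hM hM' uv; split=> r s.
  move=> sE; have e1 := leading_mul1 hM hM' sE.
  have e2 : (M' * M) r s = 0.
    apply/eqP/negPn/negP => /(leading_mul_cases hM' hM)[w sE' [_ vuw]].
    have : w = u ++ v.
      move: sE; rewrite sE' => /eqP; rewrite eqseq_cat // => /andP[_ /eqP->] //.
    move=> wE; rewrite wE in vuw; have := dlt_lew_trans uv vuw.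
    by rewrite dlt_irr.
  by rewrite lieb_entry e1 e2 subr0.
move=> h; have [e|] := eqVneq ((M * M') r s) 0; last exact: leading_mul_cases.
have h' : (M' * M) r s != 0.
  apply: contraNneq h => e'.
  by rewrite lieb_entry e e' subr0.
have [w sE [sw vuw]] := leading_mul_cases hM' hM h'; exists w => //.
split; first by rewrite sw !size_cat addnC.
by rewrite /lew (dlt_lew_trans uv vuw) orbT.
Qed.

Fixpoint lval (t : btree A) : E :=
  match t with Leaf a => letter a | Node t1 t2 => lieb (lval t1) (lval t2) end.

Lemma leading_lval t : good t -> leading (word t) (lval t).
Proof.
elim: t => [a _|t1 IH1 t2 IH2 /and4P[g1 g2 t12 _]]; first exact: leading_letter.
apply: leading_lieb; [exact: IH1|exact: IH2|].
rewrite -[_ ++ _]cats0; apply: dlt_catr; apply: lyndon_dlt_cat => //.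
  exact: word_neq0.
exact: good_lyndon.
Qed.
End Magnus.

Section Bracket.
Local Open Scope ring_scope.
Variable E : pzRingType.
Implicit Types x y : E.

Lemma liebBl x x' y : lieb (x - x') y = lieb x y - lieb x' y.
Proof.
by rewrite /lieb mulrBl mulrBr !opprB [y * x' - _]addrC addrACA [_ + y * x']addrC.
Qed.

Lemma liebBr x y y' : lieb x (y - y') = lieb x y - lieb x y'.
Proof.
by rewrite /lieb mulrBl mulrBr !opprB [y' * x - _]addrC addrACA [_ + y' * x]addrC.
Qed.
End Bracket.

(** * Finite p-quotients of the free group from the Magnus representation *)

Section MagnusQuotient.
Local Open Scope ring_scope.
Variables (p : nat) (p_pr : prime p) (A : finType) (n k : nat).
Local Notation K := 'Z_(p ^ k.+1).
Local Notation E := 'M[K]_#|{: n.-bseq A}|.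
Let JF := @mfil_filtration A n K.

Lemma letter_nilpotent a : (@letter A n K a) ^+ n.+1 = 0.
Proof.
apply: (@mfil_eq0 A n K n.+1) => //; elim: n.+1 => [|m IHm].
  exact: fil_one JF.
by rewrite exprS -add1n; apply: (filM JF (@letter_mfil A n K a)).
Qed.

Definition magnus_gen a : unip JF :=
  projT1 (cid (exists_unip JF (@letter_mfil A n K a) (letter_nilpotent a))).

Lemma magnus_genE a : unip_val (magnus_gen a) = 1 + @letter A n K a.
Proof. exact: projT2 (cid (exists_unip _ _ _)). Qed.

Let FM := @fgliftM A (unip JF) magnus_gen.

Definition magnus_kernel : normalSubgroup (freeGroup A) := kernel FM.

Definition magnus (u : quotg magnus_kernel) : E := unip_val (@kernel_map _ _ _ FM u).

Lemma magnus_inj : injective magnus.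
Proof. by move=> u v /unip_val_inj/kernel_map_inj. Qed.

Lemma magnusM : {morph magnus : u v / (u * v)%g >-> u * v}.
Proof. by move=> u v; rewrite /magnus (@kernel_mapM _ _ _ FM). Qed.

Lemma magnus1 : magnus 1%g = 1.
Proof. by rewrite /magnus (group_morph1 (@kernel_mapM _ _ _ FM)). Qed.

Lemma magnusJ u : @mfil A n K 1 (magnus u - 1).
Proof. exact: unip_valJ. Qed.

Lemma magnus_free_image a : aug magnus (free_image magnus_kernel a) = @letter A n K a.
Proof.
by rewrite /aug /magnus /free_image kernel_mapE fglift_gen magnus_genE addrC addKr.
Qed.

Lemma magnus_eq1 i (u : quotg magnus_kernel) : (n < i)%N -> @mfil A n K i (aug magnus u) -> u = 1%g.
Proof.
move=> ni /(mfil_eq0 ni)/eqP; rewrite subr_eq0 => /eqP u1.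
by apply: magnus_inj; rewrite u1 magnus1.
Qed.

(** Each power by [p ^ k.+1] gains a filtration step, since that number is zero in the coefficient
    ring; [n] steps from [J 1] pass the truncation degree. *)
Lemma magnus_exponent (u : quotg magnus_kernel) : (u ^+ (p ^ (k.+1 * n)) = 1)%g.
Proof.
apply: (@magnus_eq1 (1 + n)); first by rewrite add1n.
rewrite expnM; apply: (fil_exp JF magnusM magnus1) => //; last exact: magnusJ.
move=> M; apply/matrixP => r s; rewrite mulmxnE mxE.
have pk0 : (p ^ k.+1)%:R = 0 :> K.
  by apply/(natZp_eq p_pr _ _ 0); rewrite modnn mod0n.
by rewrite -[M r s *+ _]mulr_natr pk0 mulr0.
Qed.

Lemma magnus_index : exists e, ([set: quotg magnus_kernel] #= `I_(p ^ e))%card.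
Proof. exact: (exponent_ppow p_pr magnus_inj magnus_exponent). Qed.

Lemma magnus_padic_group c : (n <= c)%N ->
  padic_group p (quotg magnus_kernel) c (k.+1 * n).
Proof.
move=> nc; split; last exact: magnus_exponent.
- move=> u uc; apply: (@magnus_eq1 c.+1) => //.
  exact: (fil_lcs JF magnusM magnus1 magnusJ).
- move=> x i ci; apply: (@magnus_eq1 i); first exact: leq_ltn_trans ci.
  exact: (fil_petresco JF magnusM magnus1 magnusJ).
Qed.

Section HallImage.
Variables (S : binomialRingType) (phi : {rmorphism S -> padic p}) (c e : nat).
Hypotheses (ke : (k <= e)%N) (QP : padic_group p (quotg magnus_kernel) c e).
Local Notation G := (hallFree A S c).
Local Notation H := (padic_lift p_pr phi QP (free_image magnus_kernel)).
Local Notation J := (@mfil A n K).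
Local Notation gv := (@gval A S c G (hgen S c)).
Let image g := aug magnus (H g).

Let HM : group_morph H := padic_liftM p_pr phi QP _.

Lemma image_gam m g : @gam S c G m g -> J m (image g).
Proof.
elim=> [{}g gm||x y _ xm _ ym|x _ xm|x l _ xm].
- apply: (fil_le JF (leqSpred m)).
  exact: (fil_lcs JF magnusM magnus1 magnusJ) (lcs_morph HM gm).
- rewrite /image (group_morph1 HM) aug1 ?magnus1 //; exact: fil0 JF _.
- by rewrite /image HM; apply: (fil_augM JF magnusM).
- by rewrite /image (group_morphV HM); apply: (fil_augV JF magnusM magnus1 magnusJ).
- by rewrite /image padic_liftX; apply: (fil_augX JF magnusM magnus1).
Qed.

(** By [comm_lead] the leading term of a group commutator is the Lie bracket, and replacing its
    arguments by their own leading terms changes it only in higher degree. *)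
Lemma image_gval (t : btree A) :
  J (tlen t).+1 (image (gv t) - @lval A n K t).
Proof.
elim: t => [a|t1 IH1 t2 IH2].
  rewrite /image /= padic_lift_gen magnus_free_image subrr; exact: fil0 JF _.
have I1 := image_gam (@gval_gam A S c G (hgen S c) t1).
have I2 := image_gam (@gval_gam A S c G (hgen S c) t2).
have L1 : J (tlen t1) (@lval A n K t1).
  by rewrite -[lval _ _ _](subKr (image (gv t1))); apply/(filB JF I1)/(filS JF).
rewrite tlenN; have := comm_lead JF magnusM magnus1 magnusJ I1 I2.
rewrite -(group_morphR HM) -!/(image _).
move: (image (gv t1)) (image (gv t2)) I1 I2 IH1 IH2 => x y I1 I2 IH1 IH2 h.
rewrite -[image _](subrK (lieb x y)) -addrA; apply: (filD JF h).
move: L1 IH1 IH2; rewrite /=; move: (@lval A n K t1) (@lval A n K t2) => x' y' L1 IH1 IH2.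
have -> : lieb x y - lieb x' y' = lieb (x - x') y + lieb x' (y - y').
  by rewrite liebBl liebBr addrA subrK.
apply: (filD JF); first by rewrite -addSn; apply: (fil_lieb JF).
by rewrite -addnS; apply: (fil_lieb JF).
Qed.

(** To leading order, products become sums and powers become multiples. The first half of the
    conclusion feeds [mul_lead] in the induction. *)
Lemma image_prod i (s : seq (btree A)) (al : btree A -> S) : (0 < i)%N ->
  (forall t, t \in s -> tlen t = i) ->
  let P := (\prod_(t <- s) @hpow S c G (gv t) (al t))%g in
  J i (image P) /\
  J i.+1 (image P - \sum_(t <- s) @lval A n K t *+ (val (phi (al t)) e : nat)).
Proof.
move=> i0; elim: s => [|t s IHs] si /=.
  rewrite !big_nil /image (group_morph1 HM) aug1 ?magnus1 // subr0.
  by split; exact: fil0 JF _.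
rewrite !big_cons; set g := hpow _ _; set P := (\prod_(_ <- _) _)%g.
have [|IP IPs] := IHs; first by move=> u us; apply: si; rewrite inE us orbT.
have ti : tlen t = i by apply/si/mem_head.
have tI : J i (image (gv t)) by rewrite -ti; apply/image_gam/(@gval_gam A S c G (hgen S c)).
have gI : J i (image g).
  by rewrite /image padic_liftX; apply: (fil_augX JF magnusM magnus1).
split; first by rewrite /image HM; apply: (fil_augM JF magnusM).
have gL : J i.+1 (image g - @lval A n K t *+ (val (phi (al t)) e : nat)).
  have := exp_lead JF magnusM magnus1 (val (phi (al t)) e) i0 tI.
  have := @image_gval t; rewrite ti => /(filMn JF (val (phi (al t)) e)).
  rewrite mulrnBl => h1 h2; have := filD JF h2 h1.
  by rewrite addrA subrK /image padic_liftX.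
have := mul_lead JF magnusM i0 gI IP; rewrite -HM -!/(image _) => h.
have := filD JF h (filD JF gL IPs).
by congr (J _ _); rewrite [image g - _ + _]addrACA -opprD addrA subrK.
Qed.
End HallImage.
End MagnusQuotient.

(** * Detecting nontrivial elements in finite p-quotients *)

Section Detection.
Variables (p : nat) (p_pr : prime p) (A : finType) (S : binomialRingType).

Lemma hallFree_gen c (g : hallFree A S c) :
  @hspan S c (hallFree A S c) (range (hgen S c)) g.
Proof.
have gen_rng a : range (@hgen A S c) (hgen S c a) by exists a.
rewrite -[g]reprK; elim: (repr g) => [a||t1 IH1 t2 IH2|t1 IH1|t1 IH1 l].
- exact/hspan_gen/gen_rng.
- exact: hspan_one.
- suff -> : \pi_(hallFree A S c)%qT (HMul t1 t2) = (hclass c t1 * hclass c t2)%g by apply: hspan_mul.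
  by apply: hallFreeP => G f; rewrite (@hlift_morph A S c G f) !hlift_class.
- suff -> : \pi_(hallFree A S c)%qT (HInv t1) = (hclass c t1)^-1%g by apply: hspan_inv.
  apply: hallFreeP => G f.
  by rewrite (group_morphV (@hlift_morph A S c G f)) !hlift_class.
- suff -> : \pi_(hallFree A S c)%qT (HPow t1 l) =
    @hpow S c (hallFree A S c) (hclass c t1) l by apply: hspan_pow.
  by apply: hallFreeP => G f; have [_ ->] := @hlift_hall A S c G f; rewrite !hlift_class.
Qed.

Lemma exists_layer c (g : hallFree A S c) : g != 1%g -> exists n,
  [/\ (0 < n <= c)%N, @gam S c _ n g & ~ @gam S c _ n.+1 g].
Proof.
move=> g1; apply: contrapT => h; case/eqP: g1; apply: (@gam_last S c).
suff: forall m, (m <= c)%N -> @gam S c (hallFree A S c) m.+1 g by apply.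
elim=> [|m IHm] mc; first exact: gam1.
have gm := IHm (ltnW mc); apply: contrapT => gm'.
by apply: h; exists m.+1; split.
Qed.

(* The witness is the coefficient at the smallest Lyndon word of the leading
   layer of [z]: in a Magnus representation no other term reaches that word. *)
Lemma exists_witness (z : proHallFree A S) : z <> 1%g -> exists2 al : S, al <> 0%R &
  forall phi : {rmorphism S -> padic p}, phi al <> 0%R -> phi_map p_pr phi z <> 1%g.
Proof.
move=> z1; have [c zc] : exists c, val z c != 1%g.
  apply: contrapT => /forallNP h; apply: z1; apply: invlim_eqP => c.
  by apply/eqP; apply: contrapT => /negP/h.
have [n [/andP[n0 nc] zn zn']] := exists_layer zc.
have [s [al [us sP [r rn zE]]]] := gam_coef (@hallFree_gen c) n0 zn.
have /exists_min_word[t0 t0s [al0 t0min]] : has (fun t => al t != 0%R) s.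
  apply: contrapT => /negP/hasPn h; apply: zn'; rewrite zE big_seq big1 ?mul1g // => t ts.
  by have := h t ts; rewrite negbK => /eqP->; apply: hpow0.
exists (al t0) => [|phi phi0]; first exact/eqP.
have [k yk] : exists k, val (phi (al t0)) k != 0%R.
  apply: contrapT => /forallNP h; apply: phi0; apply: padic_eqP => k.
  by apply/eqP; apply: contrapT => /negP/h.
pose N := PpowNormal (magnus_index p_pr A n k).
(* Large enough for the exponent of the quotient, and at least [k], so that the residue of
   [phi (al t0)] at level [k] can still be read off. *)
pose e' := maxn k (k.+1 * n).
have QP : padic_group p (quotg (magnus_kernel p A n k)) c e'.
  exact: padic_group_up (leqnn c) (leq_maxr _ _) (magnus_padic_group p_pr A k nc).
move=> /(congr1 (fun x : freeProP p A => val x N)) /=.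
have -> := @phi_compE p p_pr S phi A N c e' QP z; rewrite zE => Hz1.
have [_] := image_prod p_pr phi QP al n0 (fun t ts => (sP t ts).2).
set H := padic_lift _ _ _ _ in Hz1 *; set P := (\prod_(_ <- _) _)%g in Hz1 *.
have HM : group_morph H := padic_liftM p_pr phi QP _.
(* If [z] had trivial image, [H P] would equal [H r^-1], which lies beyond the truncation degree
   because [r] belongs to [gam n.+1]. *)
have JP : @mfil A n 'Z_(p ^ k.+1) n.+1 (aug (@magnus p A n k) (H P)).
  have -> : H P = H r^-1%g.
    by apply: (@mulIg _ (H r)); rewrite -!HM mulVg (group_morph1 HM).
  exact/(image_gam p_pr phi QP)/gamV.
set L := (\sum_(_ <- _) _)%R => JL.
have {JP JL} : L = 0%R.
  have JF := @mfil_filtration A n 'Z_(p ^ k.+1).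
  apply: (@mfil_eq0 A n _ n.+1) => //.
  by rewrite -[L](subKr (aug (@magnus p A n k) (H P))); apply: (filB JF).
(* The row of the empty word and the column of [word t0] give the coefficient at [word t0]. *)
have [r0 r0E] := @wd_surj A n [::] isT.
have [|s0 s0E] := @wd_surj A n (word t0); first by rewrite -/(tlen t0) (sP t0 t0s).2.
move=> /matrixP/(_ r0 s0); rewrite mxE summxE (bigD1_seq t0) //= big_seq_cond big1 => [|t].
  rewrite addr0 mulmxnE.
  have [h1 _] := leading_lval n ('Z_(p ^ k.+1)) (sP t0 t0s).1.
  rewrite h1; last by rewrite r0E s0E.
  move=> e0; case/eqP: yk; rewrite -e0.
  by rewrite (padic_level_nat p_pr (phi (al t0)) (leq_maxl k (k.+1 * n))).
move=> /andP[ts tt0]; rewrite mulmxnE; have [gt _] := sP t ts.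
have [at0|at0] := eqVneq (al t) 0%R; first by rewrite at0 rmorph0.
have [M0|M0] := eqVneq (@lval A n 'Z_(p ^ k.+1) t r0 s0) 0%R; first by rewrite M0 mul0rn.
have [_ /(_ _ _ M0)] := leading_lval n ('Z_(p ^ k.+1)) gt.
(* A contribution of another [t] would need its word to equal that of [t0], against [word_inj], or
   to be smaller, against minimality. *)
rewrite r0E s0E /= => -[v <- [_ /orP[/eqP tt0'|/dlt_ltw]]].
  by case/eqP: tt0; apply: word_inj => //; apply: (sP t0 t0s).1.
by move=> lt; have /negP := t0min t ts at0.
Qed.
End Detection.

Theorem theorem4p2 (p : nat) (p_pr : prime p) (A : finType) :
  (forall (R : comPzRingType) (hR : fully_residually_padic p R),
     fully_residually
       (proHallFree A (binc (fully_residually_domain0 p_pr hR)))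
       (freeProP p A)) /\
  (forall (R : comAlgType (padic p)) (hR : alg_fully_residually_padic R),
     fully_residually
       (proHallFree A (binc (fully_residually_domain0 p_pr
                               (alg_fully_residually_ring hR))))
       (freeProP p A)).
Proof.
(* An algebra homomorphism is a ring homomorphism, so the algebra case is an instance of the ring
   case. *)
suff main (R : comPzRingType) (hR : fully_residually_padic p R) : fully_residually
    (proHallFree A (binc (fully_residually_domain0 p_pr hR))) (freeProP p A).
  by split=> R hR; apply: main.
move=> C; pose S : binomialRingType := binc (fully_residually_domain0 p_pr hR).
have /boolp.choice[al alP] (z : proHallFree A S) : exists al : S,
    z <> 1%g -> al <> 0%R /\ forall phi : {rmorphism S -> padic p},
      phi al <> 0%R -> phi_map p_pr phi z <> 1%g.
  have [->|/(@exists_witness p p_pr)[al al0 alP]] := pselect (z = 1%g); first by exists 0%R.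
  by exists al.
(* Including 0 in the list turns injectivity into nonvanishing of the witnesses of all quotients of
   two elements of [C]. *)
have [phi phi_inj] := @binc_fully_residually_padic p p_pr R (fully_residually_domain0 p_pr hR) hR
  (0%R :: [seq al (x * y^-1)%g | x : proHallFree A S <- C, y : proHallFree A S <- C]).
exists (@phi_map p p_pr S phi A) => x y xC yC /= xy.
apply: contrapT => nxy.
have /alP[al0 /(_ phi) alphi] : (x * y^-1)%g <> 1%g by move=> /divg1_eq.
case: alphi; last first.
  by rewrite phi_mapM (group_morphV (@phi_mapM p p_pr S phi A)) xy mulgV.
move=> phi0; apply: al0; apply: phi_inj; rewrite ?inE ?eqxx ?rmorph0 //.
by rewrite allpairs_f ?orbT.
Qed.
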